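(* Let $\Omega\subset\mathbb R^d$ ($d\ge 2$) be an open bounded convex domain with smooth boundary, let $d<p<\infty$, and let $g\in W^{2-1/p,p}(\partial\Omega)$. Let $H_D$ and $\widetilde H_D$ be the internal data corresponding to the coefficient sets $(\gamma,\sigma_a,\sigma_b)$ and $(\gamma,\sigma_a,\widetilde\sigma_b)$ respectively (same $\Xi,\gamma,\sigma_a$, same boundary sources $\varepsilon g$), where $\Xi,\gamma,\sigma_a,\sigma_b,\widetilde\sigma_b\in\mathcal C^2(\overline\Omega)$ are bounded below pointwise by a constant $c_0>0$ and have $\mathcal C^2(\overline\Omega)$-norms at most a constant $C_0$. Then $$\|(\sigma_b-\widetilde\sigma_b)(u^{(1)})^2\|_{L^p(\Omega)}\le C\,\|H_D^{(2)}-\widetilde H_D^{(2)}\|_{W^{2,p}(\Omega)}.$$ If, in addition, $\underline g:=\inf_{\partial\Omega}g>0$, then $$\|\sigma_b-\widetilde\sigma_b\|_{L^p(\Omega)}\le C\,\|H_D^{(2)}-\widetilde H_D^{(2)}\|_{W^{2,p}(\Omega)},$$ where the constant $C>0$ depends on $\Omega,\gamma,\Xi$ and $\sigma_a$.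
   Context: For small $\varepsilon>0$, $u(\mathbf x;\varepsilon)\in W^{2,p}(\Omega)$ is the (small) solution of $-\nabla\cdot\gamma\nabla u+\sigma_au+\sigma_bu^2=0$ in $\Omega$, $u=\varepsilon g$ on $\partial\Omega$. The internal datum is $H_D(\mathbf x;\varepsilon)=\Xi[\sigma_au+\sigma_bu^2]$. Linearizations at $\varepsilon=0$: $u^{(1)}=\partial_\varepsilon u|_{\varepsilon=0}$ solves $-\nabla\cdot\gamma\nabla u^{(1)}+\sigma_au^{(1)}=0$ in $\Omega$, $u^{(1)}=g$ on $\partial\Omega$; $u^{(2)}=\partial_\varepsilon^2u|_{\varepsilon=0}$ solves $-\nabla\cdot\gamma\nabla u^{(2)}+\sigma_au^{(2)}+2\sigma_b(u^{(1)})^2=0$ in $\Omega$, $u^{(2)}=0$ on $\partial\Omega$. Also $H_D^{(2)}=\partial_\varepsilon^2H_D|_{\varepsilon=0}=\Xi(\sigma_au^{(2)}+2\sigma_b(u^{(1)})^2)$. Tildes denote the same quantities with $\widetilde\sigma_b$ in place of $\sigma_b$; since $u^{(1)}$ does not depend on $\sigma_b$, $\widetilde u^{(1)}=u^{(1)}$.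
   Formalization: In the second estimate the constant C may depend also on inf g over the boundary; this is unavoidable, since replacing g by tg multiplies the right side by t² but leaves the left side fixed. In both estimates C may also depend on the fixed p, c_0 and C_0. *)

(* Defs.v *)
From HB Require Import structures.
From mathcomp Require Import all_boot all_order all_algebra.
From mathcomp Require Import all_classical all_reals all_analysis.
Set Implicit Arguments.
Unset Strict Implicit.
Unset Printing Implicit Defensive.
Import Order.TTheory GRing.Theory Num.Theory.
Import numFieldNormedType.Exports.
Local Open Scope classical_set_scope.
Local Open Scope ring_scope.

Definition rV_display : measure_display.
Proof. by constructor. Qed.

(* The product sigma-algebra of the Borel sets of R, i.e. the Borel sets of
   R^n. *)
Section rV_measurable.
Context {R : realType} (n : nat).

Definition coord_rV (i : 'I_n) (x : 'rV[R]_n) : measurableTypeR R := x 0 i.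

Let rV_set0 : g_sigma_preimage coord_rV set0.
Proof. exact: sigma_algebra0. Qed.

Let rV_setC A : g_sigma_preimage coord_rV A -> g_sigma_preimage coord_rV (~` A).
Proof. exact: sigma_algebraC. Qed.

Let rV_bigcup (F : _^nat) : (forall i, g_sigma_preimage coord_rV (F i)) ->
  g_sigma_preimage coord_rV (\bigcup_i (F i)).
Proof. exact: sigma_algebra_bigcup. Qed.

HB.instance Definition _ := @isMeasurable.Build rV_display
  'rV[R]_n (g_sigma_preimage coord_rV) rV_set0 rV_setC rV_bigcup.

Lemma measurable_coord_rV (i : 'I_n) : measurable_fun setT (coord_rV i).
Proof.
move=> _ Y mY; rewrite setTI; apply: sub_sigma_algebra => /=.
rewrite -bigcup_seq/=; exists i => /=; first by rewrite mem_index_enum.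
by exists Y => //; rewrite setTI.
Qed.

Lemma measurable_fun_coord_rV d (T : measurableType d) (f : T -> 'rV[R]_n) :
  (forall i, measurable_fun setT (coord_rV i \o f)) -> measurable_fun setT f.
Proof.
move=> mf; suff pre : g_sigma_preimage (fun i => coord_rV i \o f) `<=` measurable.
  move=> _ A mA; rewrite setTI; apply: pre.
  by rewrite g_sigma_preimage_comp; exists A => //; rewrite setTI.
apply: smallest_sub; first exact: sigma_algebra_measurable.
rewrite -bigcup_seq /= => A [i _ [B mB <-]].
exact: mf.
Qed.

End rV_measurable.

(* x with the entry a inserted at position i; col' i is its left inverse. *)
Definition insert_coord {R : realType} n (i : 'I_n) (a : R) (x : 'rV[R]_n.-1)
    : 'rV[R]_n :=
  \row_j (if unlift i j is Some k then x 0 k else a).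

(* The product measure of m1 and m2, transported from R * R^n to R^(n+1). *)
Section prod_rV.
Context {R : realType} (n : nat).
Context (m1 : {sigma_finite_measure set (measurableTypeR R) -> \bar R}).
Context (m2 : {sigma_finite_measure set 'rV[R]_n -> \bar R}).

Definition cons_rV (z : measurableTypeR R * 'rV[R]_n) : 'rV[R]_n.+1 :=
  insert_coord ord0 z.1 z.2.

Lemma measurable_cons_rV : measurable_fun setT cons_rV.
Proof.
apply: measurable_fun_coord_rV => i.
case: (unliftP ord0 i) => [j ->|->].
  rewrite (_ : _ \o _ = coord_rV j \o snd).
    by apply: measurableT_comp => //; exact: measurable_coord_rV.
  by apply/funext => z; rewrite /coord_rV /= mxE liftK.
rewrite (_ : _ \o _ = fst) //.
by apply/funext => z; rewrite /coord_rV /= mxE unlift_none.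
Qed.

Let uncons_rV (x : 'rV[R]_n.+1) : measurableTypeR R * 'rV[R]_n :=
  (x 0 ord0, \row_j x 0 (lift ord0 j)).

Let measurable_uncons_rV : measurable_fun setT uncons_rV.
Proof.
apply/measurable_fun_pairP; split; first exact: measurable_coord_rV.
apply: measurable_fun_coord_rV => i.
rewrite (_ : _ \o _ = coord_rV (lift ord0 i)); first exact: measurable_coord_rV.
by apply/funext => x; rewrite /coord_rV /= mxE.
Qed.

Let cons_rVK : cancel cons_rV uncons_rV.
Proof.
move=> [a y]; congr pair; first by rewrite mxE unlift_none.
by apply/rowP => j; rewrite !mxE liftK.
Qed.

Definition prod_rV : set 'rV[R]_n.+1 -> \bar R :=
  pushforward (m1 \x m2)%E cons_rV.

Let prod_rV0 : prod_rV set0 = 0%E.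
Proof. by rewrite /prod_rV /pushforward preimage_set0 measure0. Qed.

Let prod_rV_ge0 A : (0 <= prod_rV A)%E.
Proof. by rewrite /prod_rV /pushforward; exact: measure_ge0. Qed.

Let prod_rV_sigma_additive : semi_sigma_additive prod_rV.
Proof.
have mpre A : measurable A -> measurable (cons_rV @^-1` A).
  by move=> mA; rewrite -[X in measurable X]setTI; exact: measurable_cons_rV.
move=> F mF tF mUF; rewrite /prod_rV /pushforward preimage_bigcup.
apply: measure_semi_sigma_additive.
- by move=> k; exact: mpre.
- apply/trivIsetP => /= i j _ _ ij; rewrite -preimage_setI.
  by move/trivIsetP : tF => /(_ _ _ _ _ ij) ->//; rewrite preimage_set0.
- by rewrite -preimage_bigcup; exact: mpre.
Qed.

HB.instance Definition _ := isMeasure.Build _ _ _ prod_rV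
  prod_rV0 prod_rV_ge0 prod_rV_sigma_additive.

Let prod_rV_sigma_finite : sigma_finite setT prod_rV.
Proof.
have /sigma_finiteP[F [TF ndF Foo]] := sigma_finiteT m1.
have /sigma_finiteP[G [TG ndG Goo]] := sigma_finiteT m2.
exists (fun k => uncons_rV @^-1` (F k `*` G k)).
  rewrite -preimage_bigcup -(preimage_setT uncons_rV); congr (_ @^-1` _).
  rewrite -setXTT TF TG predeqE => -[x y]; split=> [[/= [n1 _ Fx] [k _ Gy]]|].
    exists (maxn n1 k) => //; split.
    - by move: x Fx; exact/subsetPset/ndF/leq_maxl.
    - by move: y Gy; exact/subsetPset/ndG/leq_maxr.
  by move=> [k _ []/= ? ?]; split; exists k.
move=> k; have [mF Fk] := Foo k; have [mG Gk] := Goo k; split.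
  rewrite -[X in measurable X]setTI; apply: measurable_uncons_rV => //.
  exact: measurableX.
rewrite /prod_rV /pushforward -comp_preimage (_ : _ \o _ = id); last first.
  by apply/funext => z; exact: cons_rVK.
rewrite preimage_id product_measure1E//.
by rewrite lte_mul_pinfty// ge0_fin_numE.
Qed.

HB.instance Definition _ := Measure_isSigmaFinite.Build _ _ _ prod_rV
  prod_rV_sigma_finite.

End prod_rV.

Fixpoint lebesgue_rV {R : realType} n
    : {sigma_finite_measure set 'rV[R]_n -> \bar R} :=
  match n return {sigma_finite_measure set 'rV[R]_n -> \bar R} with
  | 0 => dirac (0 : 'rV[R]_0)
  | n'.+1 => prod_rV lebesgue_measure (lebesgue_rV n')
  end.

(* s = [:: i1; ..; ik] stands for the derivative d_i1 (.. (d_ik f)). *)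
Definition partial {R : realType} n (s : seq 'I_n) (f : 'rV[R]_n -> R)
    : 'rV[R]_n -> R :=
  foldr (fun i g x => 'D_(delta_mx 0 i) g x) f s.

(* 'D_v g x is a junk value when g is not derivable at x along v, hence the
   explicit derivability conditions. *)
Definition Ck_on {R : realType} n (k : nat) (U : set 'rV[R]_n)
    (f : 'rV[R]_n -> R) :=
  forall s, (size s <= k)%N ->
    {in U, forall x, {for x, continuous (partial s f)}} /\
    ((size s < k)%N ->
     {in U, forall x i, derivable (partial s f) x (delta_mx 0 i)}).

Definition smooth {R : realType} n (f : 'rV[R]_n -> R) :=
  forall k, Ck_on k setT f.

Section C2_closure.
Context {R : realType} (n : nat) (Om : set 'rV[R]_n).

(* C^2(closure Om): the derivatives of order at most 2 of f in the open set Om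
   extend continuously to closure Om. *)
Definition C2_closure (f : 'rV[R]_n -> R) :=
  [/\ Ck_on 2 Om f,
      {within closure Om, continuous f} &
      forall s, (size s <= 2)%N -> exists2 F : 'rV[R]_n -> R,
        {within closure Om, continuous F} & {in Om, F =1 partial s f}].

Definition C2_norm (f : 'rV[R]_n -> R) : \bar R :=
  ereal_sup [set y | exists s x,
    [/\ (size s <= 2)%N, Om x & y = `|partial s f x|%:E]].

Definition coefficient (c0 C0 : R) (f : 'rV[R]_n -> R) :=
  [/\ C2_closure f, forall x, closure Om x -> c0 <= f x &
      (C2_norm f <= C0%:E)%E].

End C2_closure.

Section domain.
Context {R : realType} (n : nat).
Implicit Types (Om U : set 'rV[R]_n).

Definition bdry Om := closure Om `\` interior Om.

(* In the open set U, Om is one of the two sides of the graph of psi, the i-th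
   coordinate being expressed as a function of the others. *)
Definition graph_chart Om (i : 'I_n) (above : bool) (psi : 'rV[R]_n.-1 -> R) U :=
  [/\ open U, smooth psi &
      forall y, U y ->
        (Om y <-> if above then psi (col' i y) < y 0 i
                  else y 0 i < psi (col' i y))].

Definition smooth_boundary Om :=
  forall x, bdry Om x -> exists i above psi U,
    U x /\ graph_chart Om i above psi U.

Definition smooth_convex_domain Om :=
  [/\ open Om, Om !=set0, bounded_set Om,
      convex_set (Om : set (convex_lmodType 'rV[R]_n)) & smooth_boundary Om].

End domain.

Section sobolev.
Context {R : realType} (n : nat) (p : R).
Implicit Types (Om : set 'rV[R]_n) (f v phi : 'rV[R]_n -> R).
Local Notation mu := (@lebesgue_rV R n).

Definition Lp_norm Om f : \bar R := 'N[mu]_(p%:E)[EFin \o (f \_ Om)].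

Definition in_Lp Om f := measurable_fun Om f /\ (Lp_norm Om f < +oo)%E.

Definition test_function Om phi :=
  smooth phi /\ exists K : set 'rV[R]_n,
    [/\ compact K, K `<=` Om & forall x, ~ K x -> phi x = 0].

Definition is_weak_partial Om (s : seq 'I_n) f v :=
  forall phi, test_function Om phi ->
    \int[mu]_(x in Om) (f x * partial s phi x) =
    (-1) ^+ size s * \int[mu]_(x in Om) (v x * phi x).

(* For s != [::] this is a representative of the weak derivative, which is
   unique up to a negligible set; it is 0 if there is none in L^p. *)
Definition weak_partial Om (s : seq 'I_n) f : 'rV[R]_n -> R :=
  if s is [::] then f
  else get [set v | in_Lp Om v /\ is_weak_partial Om s f v].

Definition in_Wkp (k : nat) Om f :=
  in_Lp Om f /\
  forall s, (size s <= k)%N -> exists v, in_Lp Om v /\ is_weak_partial Om s f v.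

(* A mixed derivative of order j is counted once for each of its orderings
   t : j.-tuple 'I_n. *)
Definition Wkp_norm (k : nat) Om f : \bar R :=
  ((\sum_(j < k.+1) \sum_(t : j.-tuple 'I_n)
      Lp_norm Om (weak_partial Om t f) `^ p) `^ p^-1)%E.

Definition gagliardo (theta : R) Om f : \bar R :=
  (\int[mu]_(x in Om) \int[mu]_(y in Om)
    (`|f x - f y| `^ p /
     Num.sqrt (\sum_i (x 0 i - y 0 i) ^+ 2) `^ (n%:R + theta * p))%:E)%E.

(* Sobolev-Slobodeckij space of order k + theta, 0 < theta < 1. *)
Definition in_Wsp (k : nat) (theta : R) Om f :=
  in_Wkp k Om f /\
  forall t : k.-tuple 'I_n, (gagliardo theta Om (weak_partial Om t f) < +oo)%E.

(* div F = f, the divergence being taken in the weak sense. *)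
Definition is_weak_div Om (F : 'I_n -> 'rV[R]_n -> R) f :=
  forall phi, test_function Om phi ->
    \int[mu]_(x in Om) (\sum_i F i x * partial [:: i] phi x) =
    - \int[mu]_(x in Om) (f x * phi x).

(* For p > n a function of W^{1,p}(Om) has a representative that is continuous
   on closure Om, whose values on the boundary are its trace. *)
Definition has_trace Om f g := exists v : 'rV[R]_n -> R,
  [/\ {within closure Om, continuous v},
      {ae mu, forall x, Om x -> v x = f x} &
      forall x, bdry Om x -> v x = g x].

(* v is the derivative at t of u : I -> W^{k,p}(Om) (one-sided if t is an
   endpoint of I). *)
Definition is_Wkp_derive (k : nat) Om (I : set R) (u : R -> 'rV[R]_n -> R)
    (t : R) v :=
  in_Wkp k Om v /\
  Wkp_norm k Om (fun x => (u s x - u t x) / (s - t) - v x)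
    @[s --> within (I `\ t) (nbhs t)] --> 0%E.

(* v1 and v2 are the first and second derivatives at 0 of
   u : [0, eps0[ -> W^{k,p}(Om). *)
Definition Wkp_derive12_at0 (k : nat) Om (eps0 : R) (u : R -> 'rV[R]_n -> R)
    v1 v2 :=
  exists u' : R -> 'rV[R]_n -> R,
    [/\ forall t, 0 <= t < eps0 ->
          in_Wkp k Om (u t) /\ is_Wkp_derive k Om `[0, eps0[ u t (u' t),
        u' 0 = v1 & is_Wkp_derive k Om `[0, eps0[ u' 0 v2].

End sobolev.

(* g in W^{k+theta,p} of the boundary: its expression in every local graph chart
   has this regularity. *)
Definition in_Wsp_bdry {R : realType} n (p : R) (k : nat) (theta : R)
    (Om : set 'rV[R]_n) (g : 'rV[R]_n -> R) :=
  forall i above psi U, graph_chart Om i above psi U ->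
    let graph y := insert_coord i (psi y) y in
    in_Wsp p k theta (graph @^-1` U) (g \o graph).

Section model.
Context {R : realType} (n : nat) (p : R) (Om : set 'rV[R]_n).
Implicit Types (Xi gamma sigma_a sigma_b g : 'rV[R]_n -> R).

(* - div (gamma grad u) + sigma_a u + sigma_b u^2 = 0 in Om, u = g on the
   boundary. *)
Definition semilinear_solution gamma sigma_a sigma_b g (u : 'rV[R]_n -> R) :=
  [/\ in_Wkp p 2 Om u,
      is_weak_div Om (fun i x => gamma x * weak_partial p Om [:: i] u x)
        (fun x => sigma_a x * u x + sigma_b x * u x ^+ 2) &
      has_trace Om u g].

Definition internal_datum Xi sigma_a sigma_b (u : 'rV[R]_n -> R) x :=
  Xi x * (sigma_a x * u x + sigma_b x * u x ^+ 2).

(* u1 is the first derivative at eps = 0 of the branch of small solutions u eps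
   with boundary source eps * g, and H2 is the second derivative of the
   associated internal data. The branch is singled out among all the solutions
   by u 0 = 0 and its differentiability at 0. *)
Definition linearized_data Xi gamma sigma_a sigma_b g (u1 H2 : 'rV[R]_n -> R) :=
  exists (eps0 : R) (u : R -> 'rV[R]_n -> R) (u2 H1 : 'rV[R]_n -> R),
    [/\ 0 < eps0,
        {ae @lebesgue_rV R n, forall x, Om x -> u 0 x = 0},
        forall eps, 0 < eps < eps0 ->
          semilinear_solution gamma sigma_a sigma_b (fun x => eps * g x) (u eps),
        Wkp_derive12_at0 p 2 Om eps0 u u1 u2 &
        Wkp_derive12_at0 p 2 Om eps0
          (fun eps => internal_datum Xi sigma_a sigma_b (u eps)) H1 H2].

End model.

(* Main.v *)
Require Import Defs.
From mathcomp Require Import all_boot all_order all_algebra.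
From mathcomp Require Import all_classical all_reals all_analysis.
From mathcomp Require Import measurable_realfun.
From mathcomp Require Import ring lra.
Set Implicit Arguments.
Unset Strict Implicit.
Unset Printing Implicit Defensive.
Import Order.TTheory GRing.Theory Num.Theory.
Import numFieldNormedType.Exports.
Local Open Scope classical_set_scope.
Local Open Scope ring_scope.

(** Everything reduces to [L^p] norms, since [Wkp_norm] dominates [Lp_norm]. The
    key is an a priori estimate: if [div (gamma grad w) = f] weakly, [w <= 0] on
    the boundary and [- f <= |F|] where [w > 0], then
    [||max(w, 0)||_p <= C ||F||_p]. It is obtained by testing the equation with
    [(A - exp(lam x_0)) max(w - delta, 0)^(p - 1)], where [lam] is so large that
    [div (gamma grad exp(lam x_0)) >= (C0 + 1) exp(lam x_0)]. This is not a smooth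
    function, so [w] is first mollified: the translates of the mollifier are
    themselves test functions, and the commutator with [gamma] vanishes in the
    limit because [gamma] is uniformly continuous.

    The estimate survives [L^p] limits of pairs [(w, f)], hence differentiation
    in [eps]; applied to the difference of the two branches it gives
    [||u2 - u2'||_p <= C ||(H2 - H2') / Xi||_p]. The product rule, taken in [L^1],
    yields [H2 / Xi = sigma_a u2 + 2 sigma_b u1^2]. Moreover [u1 = u1'], as the
    difference of the branches is controlled by terms of second order in [eps].
    Subtraction gives the first inequality. For the second one, comparison of the
    solutions with [eps kap exp(lam x_0)] shows [u1 >= kap exp(lam x_0) > 0]. *)

(** * Smooth compactly supported functions *)

(** Divided by [Xi], the internal datum is exactly [div (gamma grad u)]. So the difference of the
    data is the right-hand side of a linear equation for the difference of the branches, in which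
    neither [sigma_a] nor [sigma_b] occurs; the unknown coefficient comes in only at the end, by
    pointwise algebra.

    Boundary values are known only through a representative continuous up to the boundary, and weak
    derivatives only against smooth compactly supported functions. Hence the factor
    [max(w - delta, 0)]: it vanishes near the boundary, so that only mollifiers centred well inside
    the domain matter, and [delta] tends to 0 last. The weight [A - exp(lam x_0)] does the work of a
    Poincare inequality: integrating the cross term by parts produces [div (gamma grad exp(lam x_0))
    max(w - delta, 0)^p / p], which is nonnegative and controls the [L^p] norm, while the term
    quadratic in the gradient has the same sign and is dropped. The exponent [p - 1] is the one that
    leads to [L^p] norms, and [p > d >= 2] makes this power continuously differentiable. *)

Section flat_exp.
Context {R : realType}.
Implicit Types (q r : {poly R}) (x : R).

(* The derivative of [q(1/x) exp(- 1/x)] is again of this form. *)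
Definition flat_exp q x : R := if 0 < x then q.[x^-1] * expR (- x^-1) else 0.

Lemma flat_exp_le0 q x : x <= 0 -> flat_exp q x = 0.
Proof. by move=> x0; rewrite /flat_exp ltNge x0. Qed.

Lemma flat_exp_gt0 q x : 0 < x -> flat_exp q x = q.[x^-1] * expR (- x^-1).
Proof. by move=> x0; rewrite /flat_exp x0. Qed.

Lemma flat_expN q x : flat_exp (- q) x = - flat_exp q x.
Proof. by rewrite /flat_exp; case: ifP => _; rewrite ?oppr0// hornerN mulNr. Qed.

(** With [y = 1/x], comparing [exp y] with a single term of its series gives
    [y^i exp(- y) <= i!]. *)
Lemma flat_exp_bounded q : exists M, forall x, `|flat_exp q x| <= M.
Proof.
exists (\sum_(i < size q) `|q`_i| * i`!%:R) => x.
have [x0|x0] := leP x 0.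
  by rewrite flat_exp_le0// normr0 sumr_ge0.
rewrite flat_exp_gt0// horner_coef normrM (ger0_norm (expR_ge0 _)).
apply: le_trans (ler_wpM2r (expR_ge0 _) (ler_norm_sum _ _ _)) _.
rewrite mulr_suml; apply: ler_sum => i _.
rewrite normrM -mulrA; apply: ler_wpM2l => //.
rewrite ger0_norm ?exprn_ge0 ?invr_ge0 ?(ltW x0)//.
rewrite expRN -ler_pdivlMr ?invr_gt0 ?expR_gt0// invrK.
have y0 : 0 <= x^-1 by rewrite invr_ge0 ltW.
rewrite mulrC -ler_pdivrMr//.
case: (nat_of_ord i) => [|k]; first by rewrite fact0 expr0 divr1; apply: le_trans (expR_ge1Dx _); lra.
by apply: le_trans (expR_ge1Dxn k y0); rewrite lerDr.
Qed.

(** A factor [1/x] can be moved into the polynomial, which exhibits the function as [x] times a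
    bounded one. *)
Lemma cvg_flat_exp q : flat_exp q x @[x --> 0^'] --> 0.
Proof.
have [M HM] := flat_exp_bounded ('X * q).
have HE x : flat_exp q x = x * flat_exp ('X * q) x.
  have [x0|x0] := leP x 0; first by rewrite !flat_exp_le0// mulr0.
  by rewrite !flat_exp_gt0// hornerM hornerX !mulrA mulfV ?gt_eqF// mul1r.
apply/norm_cvg0P.
apply: (@squeeze_cvgr _ _ _ _ (cst 0) (fun x => `|x| * M)).
- by near=> x; rewrite normr_ge0/= HE normrM ler_wpM2l.
- exact: cvg_cst.
- rewrite -[X in _ --> X](mul0r M); apply: cvgMl.
  have := @norm_continuous _ R^o 0; rewrite /continuous_at normr0 => h.
  by apply: cvg_trans h; apply: cvg_app; exact: nbhs_dnbhs.
Unshelve. all: end_near. Qed.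

Lemma is_derive_flat_exp q x :
  is_derive x 1 (flat_exp q) (flat_exp ('X^2 * (q - q^`())) x).
Proof.
have [x0|x0|->] := ltgtP x 0.
- rewrite [X in is_derive _ _ _ X]flat_exp_le0 ?ltW//.
  have dc : is_derive x 1 (fun _ : R => 0 : R) 0 by exact: is_derive_cst.
  apply: near_eq_is_derive dc.
  by near=> y; rewrite flat_exp_le0// ltW//; near: y; exact: lt_nbhsl.
- rewrite [X in is_derive _ _ _ X]flat_exp_gt0//.
  have x_neq0 : x != 0 by rewrite gt_eqF.
  have dV : is_derive x 1 (fun y : R => y^-1) (- x ^- 2).
    have := @is_deriveV R id x 1 1 x_neq0 (is_derive_id _ _).
    by rewrite /GRing.scale/= mulr1.
  have d1 := @is_derive1_comp R (horner q) _ x _ _ (is_derive_poly q x^-1) dV.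
  have d2 := @is_derive1_comp R (@expR R) _ x _ _ (is_derive_expR _) (is_deriveN dV).
  apply: (@near_eq_is_derive _ _ _
    (fun y : R => q.[y^-1] * expR (- y^-1)) (flat_exp q)).
    by near=> y; rewrite flat_exp_gt0//; near: y; exact: lt_nbhsr.
  apply: is_derive_eq (is_deriveM d1 d2) _; rewrite /GRing.scale/= !hornerE /=.
  rewrite exprVn; ring.
(* At 0 the difference quotient is itself [flat_exp ('X * q)], whose limit is already known. *)
- rewrite [X in is_derive _ _ _ X]flat_exp_le0//.
  suff h : (fun h => h^-1 *: ((flat_exp q \o shift 0) (h *: 1) - flat_exp q 0)) @ 0^' --> (0 : R).
    by apply: DeriveDef; [apply/cvg_ex; exists 0 | exact/cvg_lim].
  apply: cvg_trans (cvg_flat_exp ('X * q)).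
  apply: near_eq_cvg; near=> h.
  rewrite /= addr0 (flat_exp_le0 _ (lexx 0)) subr0 /GRing.scale/= mulr1.
  have [h0|h0] := leP h 0; first by rewrite !flat_exp_le0// mulr0.
  by rewrite !flat_exp_gt0// hornerM hornerX mulrA.
Unshelve. all: end_near. Qed.

End flat_exp.

Section directional.
Context {R : realType} (n : nat).
Implicit Types (F : 'rV[R]_n -> R) (v y : 'rV[R]_n).

(** An equality of difference quotients and not a chain rule: it reduces directional derivatives to
    one variable without asking for Frechet differentiability. *)
Lemma is_derive_line F v y t d :
  is_derive (t *: v + y) v F d <-> is_derive t (1 : R) (fun s => F (s *: v + y)) d.
Proof.
pose q1 h := h^-1 *: ((F \o shift (t *: v + y)) (h *: v) - F (t *: v + y)).
pose q2 h := h^-1 *: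
  (((fun s => F (s *: v + y)) \o shift t) (h *: 1) - F (t *: v + y)).
have qE : q1 = q2.
  apply/funext => h; rewrite /q1 /q2/=; congr (_ *: (F _ - _)).
  by rewrite [h%:A]mulr1 scalerDl addrA.
split=> -[dF DF].
- split; first by rewrite /derivable -/q2 -qE.
  by rewrite /derive -/q2 -qE.
- split; first by rewrite /derivable -/q1 qE.
  by rewrite /derive -/q1 qE.
Qed.

Lemma is_derive_line0 F v y d :
  is_derive y v F d <-> is_derive (0 : R) (1 : R) (fun s => F (s *: v + y)) d.
Proof. by rewrite -is_derive_line scale0r add0r. Qed.

End directional.

Section bump.
Context {R : realType}.

Definition flat_deriv (q : {poly R}) := 'X^2 * (q - q^`()).

Lemma is_derive_flat_exp_mul q r (a b t : R) :
  is_derive t 1 (fun t => flat_exp q (a + t) * flat_exp r (b - t))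
    (flat_exp (flat_deriv q) (a + t) * flat_exp r (b - t) +
     flat_exp q (a + t) * flat_exp (- flat_deriv r) (b - t)).
Proof.
have da : is_derive t 1 (fun t : R => a + t) 1.
  apply: is_derive_eq (is_deriveD (is_derive_cst a t 1) (is_derive_id t 1)) _.
  by rewrite add0r.
have db : is_derive t 1 (fun t : R => b - t) (-1).
  apply: is_derive_eq
    (is_deriveD (is_derive_cst b t 1) (is_deriveN (is_derive_id t 1))) _.
  by rewrite add0r.
have d1 := is_derive1_comp (is_derive_flat_exp q (a + t)) da.
have d2 := @is_derive1_comp _ (flat_exp r) (fun t => b - t) _ _ _
  (is_derive_flat_exp r (b - t)) db.
apply: is_derive_eq (is_deriveM d1 d2) _.
by rewrite flat_expN /GRing.scale/=; ring.
Qed.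

(* A class closed under derivation, so that products of such functions of the
   coordinates are smooth. *)
Inductive bump_fun : (R -> R) -> Prop :=
| bump_base a b q r :
    bump_fun (fun t => flat_exp q (a + t) * flat_exp r (b - t))
| bump_add f g : bump_fun f -> bump_fun g -> bump_fun (fun t => f t + g t).

Lemma bump_fun_derive f : bump_fun f ->
  exists2 g, bump_fun g & forall t : R, is_derive t 1 f (g t).
Proof.
elim=> [a b q r|{}f g _ [f' bf df] _ [g' bg dg]]; last first.
  exists (fun t => f' t + g' t); first exact: bump_add.
  by move=> t; exact: is_deriveD (df t) (dg t).
exists (fun t => flat_exp (flat_deriv q) (a + t) * flat_exp r (b - t) +
    flat_exp q (a + t) * flat_exp (- flat_deriv r) (b - t)).
  by apply: bump_add; exact: bump_base.
by move=> t; exact: is_derive_flat_exp_mul.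
Qed.

Lemma bump_fun_bounded f : bump_fun f -> exists M, forall t, `|f t| <= M.
Proof.
elim=> [a b q r|{}f g _ [M hM] _ [N hN]].
  have [M hM] := flat_exp_bounded q; have [N hN] := flat_exp_bounded r.
  by exists (M * N) => t; rewrite normrM ler_pM.
exists (M + N) => t; apply: le_trans (ler_normD _ _) _; exact: lerD.
Qed.

Lemma bump_fun_continuous f : bump_fun f -> continuous f.
Proof.
move=> /bump_fun_derive[g _ df] t.
by apply: differentiable_continuous; apply/derivable1_diffP; have [] := df t.
Qed.

Definition prodfun n (a : 'I_n -> R -> R) (y : 'rV[R]_n) := \prod_i a i (y 0 i).

Lemma prodfun_continuous n (a : 'I_n -> R -> R) :
  (forall i, bump_fun (a i)) -> continuous (prodfun a).
Proof.
move=> ba; rewrite /prodfun; elim: (index_enum _) => [|i s ih] y.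
  by under eq_fun do rewrite big_nil; exact: cst_continuous.
under eq_fun do rewrite big_cons.
apply: continuousM; last exact: ih.
apply: (@continuous_comp _ _ _ (fun z : 'rV[R]_n => z 0 i) (a i)).
  exact: coord_continuous.
exact: bump_fun_continuous.
Qed.

Lemma is_derive_prodfun n (a : 'I_n -> R -> R) j g :
  (forall t : R, is_derive t 1 (a j) (g t)) -> forall y,
  is_derive y (delta_mx 0 j) (prodfun a)
    (prodfun (fun i => if i == j then g else a i) y).
Proof.
move=> dg y; apply/is_derive_line0.
have -> : (fun s => prodfun a (s *: delta_mx 0 j + y)) =
    (fun s => a j (s + y 0 j) * \prod_(i | i != j) a i (y 0 i)).
  apply/funext => s; rewrite /prodfun (bigD1 j)//= !mxE !eqxx mulr1.
  congr (_ * _); apply: eq_bigr => i ij.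
  by rewrite !mxE (negbTE ij) andbF mulr0 add0r.
rewrite [X in is_derive _ _ _ X]/prodfun [X in is_derive _ _ _ X](bigD1 j)//= ifT//.
have -> : \prod_(i | i != j) (if i == j then g else a i) (y 0 i) =
    \prod_(i | i != j) a i (y 0 i).
  by apply: eq_bigr => i ij; rewrite (negbTE ij).
have ds : is_derive (0 : R) (1 : R) (fun s : R => s + y 0 j) 1.
  apply: is_derive_eq
    (is_deriveD (is_derive_id (0 : R) (1 : R)) (is_derive_cst (y 0 j) (0 : R) 1)) _.
  by rewrite addr0.
have := @is_derive1_comp _ (a j) (fun s => s + y 0 j) _ _ _ (dg (0 + y 0 j)) ds.
rewrite mulr1 add0r => d1.
apply: is_derive_eq (is_deriveM d1 (is_derive_cst _ (0 : R) (1 : R))) _.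
by rewrite scaler0 add0r /GRing.scale/= mulrC.
Qed.

(** Each partial derivative replaces one factor by its derivative, which is again a [bump_fun]. *)
Lemma partial_prodfun n (a : 'I_n -> R -> R) s : (forall i, bump_fun (a i)) ->
  exists2 a', forall i, bump_fun (a' i) & partial s (prodfun a) = prodfun a'.
Proof.
move=> ba; elim: s => [|j s [a' ba' ih]]; first by exists a.
have [g bg dg] := bump_fun_derive (ba' j).
exists (fun i => if i == j then g else a' i); first by move=> i; case: ifP.
rewrite /= ih; apply/funext => y.
by have [_] := is_derive_prodfun dg y.
Qed.

Lemma smooth_prodfun n (a : 'I_n -> R -> R) :
  (forall i, bump_fun (a i)) -> smooth (prodfun a).
Proof.
move=> ba k s _; have [a' ba' ->] := partial_prodfun s ba.
split=> [y _|_ y _ i]; first exact: prodfun_continuous.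
have [g bg dg] := bump_fun_derive (ba' i).
by have [] := is_derive_prodfun dg y.
Qed.

End bump.

(** * Lebesgue measure on row vectors *)

Section rV_borel.
Context {R : realType} (n : nat).
Implicit Types (x y a : 'rV[R]_n) (r : R).

Definition cube x r : set 'rV[R]_n := [set y | forall i, `|x 0 i - y 0 i| < r].

Lemma cube_ball x r : 0 < r -> cube x r = ball x r.
Proof.
move=> r0; apply/seteqP; split=> [y xy|y [_ xy] i]; last exact: xy.
by split=> // i j; rewrite ord1; exact: xy.
Qed.

Lemma measurable_cube x r : measurable (cube x r).
Proof.
rewrite (_ : cube x r =
    ~` (\bigcup_(i : 'I_n) ~` (coord_rV i @^-1` ball (x 0 i) r))).
  apply/measurableC/countable_bigcupT_measurable; first exact: countableP.
  move=> i; apply: measurableC; rewrite -[X in measurable X]setTI.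
  by apply: measurable_coord_rV => //; exact: measurable_ball.
rewrite setC_bigcup; apply/seteqP; split=> [y xy i _|y xy i].
  by rewrite setCK; exact: xy.
by have := xy i I; rewrite setCK.
Qed.

(** The sigma-algebra is the product one, so [U] has to be exhausted by countably many boxes: the
    cubes contained in [U] with rational centre and radius [1/(k+1)]. *)
Lemma open_measurable_rV (U : set 'rV[R]_n) : open U -> measurable U.
Proof.
move=> oU.
pose q2R (q : 'rV[rat]_n) : 'rV[R]_n := map_mx ratr q.
pose V (p : 'rV[rat]_n * nat) : set 'rV[R]_n :=
  [set y | cube (q2R p.1) p.2.+1%:R^-1 `<=` U /\ cube (q2R p.1) p.2.+1%:R^-1 y].
rewrite (_ : U = \bigcup_p V p).
  apply: countable_bigcupT_measurable; first exact: countableP.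
  move=> p; have [sub|nsub] := pselect (cube (q2R p.1) p.2.+1%:R^-1 `<=` U).
    rewrite (_ : V p = cube (q2R p.1) p.2.+1%:R^-1); first exact: measurable_cube.
    by apply/seteqP; split=> [y []//|y].
  by rewrite (_ : V p = set0)//; apply/seteqP; split=> [y []|].
apply/seteqP; split=> [y Uy|y [p _ [sub py]]]; last exact: sub.
have /nbhs_ballP[e e0 eU] : nbhs y U by exact: open_nbhs_nbhs.
have [k ke] : exists k, k.+1%:R^-1 < e / 2.
  have e20 : 0 < e / 2 by rewrite divr_gt0.
  have [k _ kP] := @cvgr_lt _ _ _ _ _ _ (@cvg_harmonic R) _ e20.
  by exists k; exact: (kP k (leqnn _)).
have qP i : {q : rat | `|ratr q - y 0 i| < k.+1%:R^-1}.
  apply/cid.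
  have [q /= /itvP qy] := @rat_in_itvoo R (y 0 i) (y 0 i + k.+1%:R^-1)
    ltac:(by rewrite ltrDl).
  by exists q; rewrite ger0_norm ?subr_ge0 ?qy// ltrBlDl qy.
exists (\row_i sval (qP i), k) => //; split => /=; last first.
  by move=> i; rewrite !mxE; exact: (svalP (qP i)).
move=> z qz; apply: eU; split=> // i j; rewrite ord1.
have := qz j; rewrite !mxE => h1; have := svalP (qP j) => h2.
rewrite /ball/= (_ : y 0 j - z 0 j = (ratr (sval (qP j)) - z 0 j) -
  (ratr (sval (qP j)) - y 0 j)); last by ring.
apply: le_lt_trans (ler_normB _ _) _; rewrite (splitr e).
by apply: ltrD; [exact: lt_trans h1 ke|exact: lt_trans h2 ke].
Qed.

Lemma continuous_measurable_rV (f : 'rV[R]_n -> R) :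
  continuous f -> measurable_fun setT f.
Proof.
move=> cf; apply: (measurability _ (RGenOpens.measurableE R)).
move=> _ [_ [a [b ->]] <-]; apply: open_measurable_rV.
rewrite setTI; apply: open_comp => //; exact: interval_open.
Qed.

Lemma within_continuous_measurable_rV (A : set 'rV[R]_n) (f : 'rV[R]_n -> R) :
  open A -> {in A, continuous f} -> measurable_fun A f.
Proof.
move=> oA cf; apply: (measurability _ (RGenOpens.measurableE R)).
move=> _ [_ [a [b ->]] <-]; apply: open_measurable_rV.
rewrite openE => x [Ax fx].
apply: filterI; first exact: open_nbhs_nbhs.
have /cf : x \in A by exact/mem_set.
apply; apply: open_nbhs_nbhs; split=> //; exact: interval_open.
Qed.

Lemma measurable_translate_rV a : measurable_fun setT (fun x => x + a).
Proof.
apply: measurable_fun_coord_rV => i.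
rewrite (_ : _ \o _ = (fun x => coord_rV i x + a 0 i)); last first.
  by apply/funext => x; rewrite /coord_rV/= mxE.
by apply: measurable_funD => //; exact: measurable_coord_rV.
Qed.

End rV_borel.

Section lebesgue_rV_theory.
Context {R : realType}.

Lemma lebesgue_measure_translate (a : R) (A : set (measurableTypeR R)) :
  measurable A ->
  lebesgue_measure ((fun x : measurableTypeR R => x + a) @^-1` A) =
  lebesgue_measure A.
Proof.
move=> mA.
pose t : measurableTypeR R -> measurableTypeR R := fun x => x + a.
have mt : measurable_fun setT t by exact: measurable_funD.
pose f := mfun_Sub (mem_set mt).
apply/esym.
apply: (@lebesgue_measure_unique R (pushforward lebesgue_measure f)) mA.
move=> _ [[b c]] _ <-; rewrite /pushforward/=.
rewrite (_ : pushforward _ t _ = lebesgue_measure `]b - a, c - a]%classic).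
  rewrite !lebesgue_measure_itv/= !lte_fin ltrD2r.
  by case: ifP => // _; rewrite -!EFinB; congr EFin; ring.
rewrite /pushforward; congr (lebesgue_measure _).
by apply/seteqP; split=> x /=; rewrite !in_itv/= ltrBlDr lerBrDr.
Qed.

Lemma cons_rV_preimage n (A : set 'rV[R]_n.+1) :
  lebesgue_rV n.+1 A = (lebesgue_measure \x lebesgue_rV n)%E (@cons_rV R n @^-1` A).
Proof. by []. Qed.

(** Induction on the dimension: the translated measure agrees with the product measure on
    rectangles, and these determine it. *)
Lemma lebesgue_rV_translate n (a : 'rV[R]_n) (A : set 'rV[R]_n) :
  measurable A ->
  lebesgue_rV n ((fun x => x + a) @^-1` A) = lebesgue_rV n A.
Proof.
elim: n a A => [|n ih] a A mA.
  by congr (_ _); apply/seteqP; split=> x /=; rewrite [x + a]thinmx0 [x]thinmx0.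
pose T (z : measurableTypeR R * 'rV[R]_n) : measurableTypeR R * 'rV[R]_n :=
  (z.1 + a 0 0, z.2 + col' 0 a).
have mT : measurable_fun setT T.
  apply/measurable_fun_pairP; split; first exact: measurable_funD.
  rewrite (_ : snd \o T = (fun y => y + col' 0 a) \o snd)//.
  by apply: measurableT_comp; [exact: measurable_translate_rV|exact: measurable_snd].
pose f := mfun_Sub (mem_set mT).
rewrite !cons_rV_preimage.
transitivity ((lebesgue_measure \x lebesgue_rV n)%E (T @^-1` (@cons_rV R n @^-1` A))).
  congr (_ _); apply/seteqP; split=> -[x y] /=; congr (A _);
  apply/rowP => j; rewrite !mxE; case: unliftP => [k ->|->]; by rewrite ?mxE.
apply/esym; apply: (@product_measure_unique _ _ _ _ _ _ _
  (pushforward (lebesgue_measure \x lebesgue_rV n)%E f)).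
  move=> B C mB mC; rewrite /pushforward/=.
  transitivity ((lebesgue_measure \x lebesgue_rV n)%E
    (((fun x : measurableTypeR R => x + a 0 0) @^-1` B) `*`
    ((fun y => y + col' 0 a) @^-1` C))); first by [].
  rewrite product_measure1E.
  - by rewrite ih//; congr (_ * _)%E; exact: lebesgue_measure_translate.
  - rewrite -[X in measurable X]setTI; exact: measurable_funD.
  - by rewrite -[X in measurable X]setTI; exact: measurable_translate_rV.
rewrite -[X in measurable X]setTI; exact: measurable_cons_rV.
Qed.

Lemma lebesgue_rV_cube n (x : 'rV[R]_n) r : 0 < r ->
  lebesgue_rV n (cube x r) = ((2 * r) ^+ n)%:E.
Proof.
move=> r0; elim: n x => [|n ih] x.
  rewrite /= diracE mem_set//; by case.
rewrite cons_rV_preimage.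
rewrite (_ : _ @^-1` _ = (ball (x 0 0) r : set (measurableTypeR R)) `*`
    cube (col' 0 x) r).
  rewrite product_measure1E; last 2 first.
  - exact: measurable_ball.
  - exact: measurable_cube.
  have b := lebesgue_measure_ball (x 0 0) (ltW r0).
  by rewrite ih [X in (X * _)%E]b -EFinM exprS; congr (_ * _)%:E; ring.
apply/seteqP; split=> -[t y] /=.
  move=> h; split=> [|i]; first by have := h 0; rewrite mxE unlift_none.
  by have := h (lift 0 i); rewrite !mxE liftK.
move=> [h1 h2] i; rewrite mxE; case: unliftP => [k ->|->//].
by have := h2 k; rewrite mxE.
Qed.

End lebesgue_rV_theory.

(** * Integration on row vectors *)

Section integrable_real.
Context d (T : measurableType d) (R : realType) (mu : {measure set T -> \bar R}).
Local Notation L1 D f := (mu.-integrable D (EFin \o f)).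
Context (D : set T) (mD : measurable D).
Implicit Types (f g : T -> R) (c : R).

Lemma integrable_scale c f : L1 D f -> L1 D (fun x => c * f x).
Proof. by move=> fi; have := integrableZl mD c fi; apply: eq_integrable. Qed.

Lemma integrable_add f g : L1 D f -> L1 D g -> L1 D (fun x => f x + g x).
Proof. by move=> fi gi; have := integrableD mD fi gi; apply: eq_integrable. Qed.

Lemma integrable_sub f g : L1 D f -> L1 D g -> L1 D (fun x => f x - g x).
Proof. by move=> fi gi; have := integrableB mD fi gi; apply: eq_integrable. Qed.

End integrable_real.

Section integrable_helpers.
Context d (T : measurableType d) (R : realType) (mu : {measure set T -> \bar R}).
Local Notation L1 D f := (mu.-integrable D (EFin \o f)).
Implicit Types (f g h : T -> R) (M : R).

Lemma bounded_fun_le h M : (forall x, `|h x| <= M) -> [bounded h x | x in setT].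
Proof.
move=> hM; exists M; split=> [|N MN x _ /=]; first exact: num_real.
exact: le_trans (hM x) (ltW MN).
Qed.

Lemma integrable_bounded_mul f h M :
  L1 setT f -> measurable_fun setT h ->
  (forall x, `|h x| <= M) -> L1 setT (fun x => h x * f x).
Proof.
move=> If mh /bounded_fun_le bh.
by have := integrableMr measurableT mh bh If; apply: eq_integrable.
Qed.

Lemma integrable_dominated f g : measurable_fun setT f ->
  (forall x, `|f x| <= g x) -> L1 setT g ->
  L1 setT f.
Proof.
move=> mf fg; apply: le_integrable => //; first exact/measurable_EFinP.
by move=> x _ /=; rewrite lee_fin (le_trans (fg x))// ler_norm.
Qed.

Lemma integrable_measurable f : L1 setT f ->
  measurable_fun setT f.
Proof. by move=> /measurable_int/measurable_EFinP. Qed.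

Lemma integrable_normr f : L1 setT f -> L1 setT (fun x => `|f x|).
Proof. exact: integrable_norm. Qed.

Lemma integrable_indic_mul (A : set T) M : measurable A -> (mu A < +oo)%E ->
  L1 setT (fun x => M * \1_A x).
Proof.
move=> mA fA.
have h : L1 setT (fun x : T => \1_A x : R).
  apply/integrableP; split; first by apply/measurable_EFinP; exact: measurable_indic.
  under eq_integral => x _ do rewrite /= ger0_norm//.
  by rewrite integral_indic// setIT.
exact: integrable_scale.
Qed.

End integrable_helpers.

Section lebesgue_rV_integral.
Context {R : realType} (n : nat).
Local Notation mu := (@lebesgue_rV R n).
Local Notation L1 D f := (mu.-integrable D (EFin \o f)).
Implicit Types (f g h : 'rV[R]_n -> R) (a x y : 'rV[R]_n) (r M : R).

Lemma ge0_integral_translate_rV (f : 'rV[R]_n -> \bar R) a :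
  measurable_fun setT f -> (forall x, 0 <= f x)%E ->
  (\int[mu]_x f (x + a)%R = \int[mu]_x f x)%E.
Proof.
move=> mf f0; have mt := measurable_translate_rV a.
transitivity (\int[pushforward mu (fun x => x + a)%R]_x f x)%E.
  by rewrite (ge0_integral_pushforward mt)//.
by apply: eq_measure_integral => A mA _; exact: lebesgue_rV_translate.
Qed.

Lemma integrable_translate_rV f a : L1 setT f -> L1 setT (fun x => f (x + a)).
Proof.
move=> /integrableP[/measurable_EFinP mf fi]; apply/integrableP; split.
  by apply/measurable_EFinP; apply: measurableT_comp => //;
    exact: measurable_translate_rV.
rewrite -(ge0_integral_translate_rV a) in fi => //.
by apply/measurable_EFinP; exact: measurableT_comp.
Qed.

Lemma Rintegral_translate_rV f a : L1 setT f ->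
  \int[mu]_x f (x + a) = \int[mu]_x f x.
Proof.
move=> fi; have mt := measurable_translate_rV a.
congr fine; transitivity (\int[pushforward mu (fun x => x + a)%R]_x (f x)%:E)%E.
  rewrite (integral_pushforward mt)//.
    exact: (measurable_int _ fi).
  exact: integrable_translate_rV.
by apply: eq_measure_integral => A mA _; exact: lebesgue_rV_translate.
Qed.

Lemma lebesgue_rV_cube_lty x r : (mu (cube x r) < +oo)%E.
Proof.
have fin s : 0 < s -> (mu (cube x s) < +oo)%E.
  by move=> s0; rewrite lebesgue_rV_cube// ltry.
have [r0|r0] := ltP 0 r; first exact: fin.
have sub : cube x r `<=` cube x 1.
  by move=> y xy i; apply: lt_trans (xy i) _; exact: le_lt_trans r0 ltr01.
apply: le_lt_trans (le_measure mu _ _ sub) (fin _ ltr01); rewrite inE;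
exact: measurable_cube.
Qed.

Lemma integrable_compact_support f M r : measurable_fun setT f ->
  (forall x, `|f x| <= M) -> (forall x, ~ cube 0 r x -> f x = 0) ->
  L1 setT f.
Proof.
move=> mf fM f0.
apply: (@integrable_dominated _ _ _ _ f (fun x => M * \1_(cube 0 r) x)) => //.
  move=> x; rewrite indicE; have [xr|xr] := pselect (cube 0 r x).
    by rewrite mem_set// mulr1.
  by rewrite memNset// mulr0 f0// normr0.
by apply: integrable_indic_mul; [exact: measurable_cube|exact: lebesgue_rV_cube_lty].
Qed.

(** By translation invariance the integral of [f (x + t e_i)] does not depend on [t];
    differentiating under the integral sign at [t = 0] gives the claim without iterated
    integrals. *)
Lemma integral_partial_eq0 (i : 'I_n) f df M r :
  measurable_fun setT f -> (forall x, `|f x| <= M) ->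
  (forall x, ~ cube 0 r x -> f x = 0) ->
  (forall x, ~ cube 0 r x -> df x = 0) ->
  (forall x, is_derive x (delta_mx 0 i) f (df x)) ->
  (forall x, `|df x| <= M) -> \int[mu]_x df x = 0.
Proof.
move=> mf fM f0 d0 dfE dM.
pose e : 'rV[R]_n := delta_mx 0 i.
pose F (t : R) x := f (x + t *: e).
have fi : L1 setT f by exact: integrable_compact_support fM f0.
have dF (t : R) x : is_derive t 1 (F ^~ x) (df (x + t *: e)).
  have /is_derive_line := dfE (t *: e + x).
  by under eq_fun do rewrite addrC; rewrite addrC.
have M0 : 0 <= M by apply: le_trans (fM 0).
have I0 : (`]-1, 1[%classic : set R) 0.
  by rewrite /= in_itv/= ltrN10 ltr01.
have h1 t : (`]-1, 1[%classic : set R) t ->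
    L1 setT (F t).
  by move=> _; exact: integrable_translate_rV.
have h2 t x : (`]-1, 1[%classic : set R) t -> [set: 'rV[R]_n] x ->
    derivable (F ^~ x) t 1 by move=> _ _; have [] := dF t x.
(* As [|t| < 1], all the translates of [df] vanish outside the cube of radius [r + 1]; this gives a
   common dominating function. *)
pose G x := M * \1_(cube 0 (r + 1)) x.
have h3 x : 0 <= G x by rewrite mulr_ge0.
have h4 : L1 setT G.
  by apply: integrable_indic_mul; [exact: measurable_cube|exact: lebesgue_rV_cube_lty].
have h5 t x : (`]-1, 1[%classic : set R) t -> [set: 'rV[R]_n] x ->
    `|partial1of2 F t x| <= G x.
  rewrite /= in_itv/= => /andP[t1 t2] _; rewrite partial1of2E.
  have [_ ->] := dF t x; rewrite /G indicE.
  have [xr|xr] := pselect (cube 0 (r + 1) x); first by rewrite mem_set// mulr1.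
  rewrite memNset// mulr0 d0 ?normr0// => hx; apply: xr => j.
  have := hx j; rewrite !mxE !sub0r !normrN => h.
  have := ler_normB (x 0 j + t * e 0 j) (t * e 0 j); rewrite addrK => h'.
  apply: le_lt_trans h' _; apply: ltr_leD.
    by rewrite /e mxE.
  rewrite normrM mulr_ile1//; first by rewrite ler_norml (ltW t1) ltW.
  by rewrite /e mxE; case: (_ && _); rewrite ?normr1 ?normr0.
have := differentiation_under_integral measurableT I0 h1 h2 h3 h4 h5.
rewrite (_ : (fun t => _) = cst (\int[mu]_x f x)); last first.
  by apply/funext => t; exact: Rintegral_translate_rV.
rewrite derive1_cst => /esym <-; apply: eq_Rintegral => x _.
by rewrite partial1of2E; have [_ ->] := dF 0 x; rewrite scale0r addr0.
Qed.

End lebesgue_rV_integral.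

(** * Integral operators with a translated kernel *)

Section kernel_integral.
Context {R : realType} (n : nat).
Local Notation mu := (@lebesgue_rV R n).
Local Notation L1 D f := (mu.-integrable D (EFin \o f)).
Implicit Types (f g h k Psi : 'rV[R]_n -> R) (a x y : 'rV[R]_n) (r M : R).

(** A correlation rather than a convolution: the kernel appears as its translate centred at [x], the
    very function that will serve as a test function. For an even kernel the two notions agree. *)
Definition kint k g x := \int[mu]_y (k (y - x) * g y).

Lemma measurable_sub_rV :
  measurable_fun setT (fun z : 'rV[R]_n * 'rV[R]_n => z.2 - z.1).
Proof.
apply: measurable_fun_coord_rV => i.
rewrite (_ : _ \o _ = (fun z : 'rV[R]_n * 'rV[R]_n =>
  coord_rV i z.2 - coord_rV i z.1)); last first.
  by apply/funext => x; rewrite /coord_rV/= !mxE.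
by apply: measurable_funB; apply: measurableT_comp => //; exact: measurable_coord_rV.
Qed.

Lemma measurable_shift_rV k x : measurable_fun setT k ->
  measurable_fun setT (fun y => k (y - x)).
Proof. by move=> mk; apply: measurableT_comp => //; exact: measurable_translate_rV. Qed.

Variables (k : 'rV[R]_n -> R) (Mk : R).
Hypotheses (mk : measurable_fun setT k) (kM : forall x, `|k x| <= Mk).
Hypotheses (ki : L1 setT k).
Hypothesis kN : forall x, `|k (- x)| = `|k x|.

Lemma integrable_kernel_mul g x : L1 setT g -> L1 setT (fun y => k (y - x) * g y).
Proof.
by move=> gi; apply: (@integrable_bounded_mul _ _ _ _ _ (fun y => k (y - x)) Mk) => //;
  exact: measurable_shift_rV.
Qed.

Lemma ge0_integral_kernel_shift y :
  (\int[mu]_x `|k (y - x)|%:E = \int[mu]_x `|k x|%:E)%E.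
Proof.
rewrite -[RHS](@ge0_integral_translate_rV _ _ (fun x => `|k x|%:E) (- y)) => //.
  by apply: eq_integral => x _; rewrite -[in RHS]kN opprB.
by apply/measurable_EFinP; exact: measurableT_comp.
Qed.

Lemma measurable_kernel_prod g : measurable_fun setT g ->
  measurable_fun setT
    (fun z : 'rV[R]_n * 'rV[R]_n => k (z.2 - z.1) * g z.2).
Proof.
move=> mg; apply: measurable_funM.
  by apply: measurableT_comp => //; exact: measurable_sub_rV.
by apply: measurableT_comp => //; exact: measurable_snd.
Qed.

(** Tonelli with the inner integral over [x]: since [|k|] is even, that integral does not depend on
    [y], and the product of two [L^1] norms remains. *)
Lemma integrable_kernel_prod g : L1 setT g ->
  (mu \x mu)%E.-integrable setT
    (EFin \o (fun z : 'rV[R]_n * 'rV[R]_n => k (z.2 - z.1) * g z.2)).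
Proof.
move=> gi; have mg := integrable_measurable gi.
apply/integrable21ltyP.
  by apply/measurable_EFinP; exact: measurable_kernel_prod.
rewrite /=.
under eq_integral => y _.
  under eq_integral => x _ do rewrite normrM EFinM muleC.
  rewrite ge0_integralZl//; last first.
    apply/measurable_EFinP.
    under eq_fun do rewrite -kN opprB.
    by apply: measurableT_comp => //; exact: measurable_shift_rV.
  rewrite ge0_integral_kernel_shift.
  over.
have [_ ki'] := integrableP _ _ _ ki.
have [_ gi'] := integrableP _ _ _ gi.
rewrite ge0_integralZr//.
- by apply: lte_mul_pinfty => //; rewrite ?integral_ge0// ge0_fin_numE ?integral_ge0.
- by apply/measurable_EFinP; exact: measurableT_comp.
- exact: integral_ge0.
Qed.

Lemma measurable_kint g : L1 setT g ->
  measurable_fun setT (kint k g).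
Proof.
move=> gi; apply: measurableT_comp => //.
exact: (measurable_fubini_F (integrable_kernel_prod gi)).
Qed.

Lemma integrable_kint g : L1 setT g -> L1 setT (kint k g).
Proof.
move=> gi; have := integrable_fubini_F (integrable_kernel_prod gi).
apply: eq_integrable => // x _; rewrite /fubini_F /kint /=.
rewrite -[LHS]/(\int[mu]_y (k (y - x) * g y)%:E)%E fineK//.
by apply: integrable_fin_num => //; exact: integrable_kernel_mul.
Qed.

Lemma normr_kint_le g x : L1 setT g ->
  `|kint k g x| <= Mk * \int[mu]_y `|g y|.
Proof.
move=> gi; have kgi := integrable_kernel_mul x gi.
apply: le_trans (le_normr_Rintegral measurableT kgi) _.
rewrite -RintegralZl//; last exact: integrable_normr.
apply: le_Rintegral => //; first exact: integrable_normr.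
  have := integrableZl measurableT Mk (integrable_normr gi).
  by apply: eq_integrable.
by move=> y _; rewrite normrM ler_wpM2r.
Qed.

Hypothesis kS : forall x, k (- x) = k x.

(** Fubini; evenness of [k] makes the operator its own transpose. *)
Lemma kint_swap g Psi M : L1 setT g ->
  measurable_fun setT Psi -> (forall x, `|Psi x| <= M) ->
  \int[mu]_x (kint k g x * Psi x) =
  \int[mu]_y (g y * \int[mu]_x (k (x - y) * Psi x)).
Proof.
move=> gi mP PM.
have gPi : (mu \x mu)%E.-integrable setT
    (EFin \o (fun z : 'rV[R]_n * 'rV[R]_n => Psi z.1 * (k (z.2 - z.1) * g z.2))).
  apply: (@integrable_bounded_mul _ _ _ _ _ (fun z => Psi z.1) M) => //.
    exact: integrable_kernel_prod.
  exact: measurableT_comp.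
have := Fubini gPi; rewrite /= => FE.
rewrite /Rintegral; congr fine.
transitivity (\int[mu]_x \int[mu]_y (Psi x * (k (y - x) * g y))%:E)%E.
  apply: eq_integral => x _; rewrite mulrC EFinM /kint fineK; last first.
    by apply: integrable_fin_num => //; exact: integrable_kernel_mul.
  by rewrite -integralZl//; exact: integrable_kernel_mul.
rewrite FE; apply: eq_integral => y _.
have kPi : L1 setT (fun x => k (x - y) * Psi x).
  have h : L1 setT (fun x => k (x - y)).
    exact: integrable_translate_rV.
  have := integrable_bounded_mul h mP PM.
  by apply: eq_integrable => // x _ /=; rewrite mulrC.
rewrite EFinM fineK; last exact: integrable_fin_num.
rewrite -integralZl//; apply: eq_integral => x _.
by rewrite -EFinM -[k (y - x)]kS opprB; congr EFin; ring.
Qed.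

Lemma integral_kint g : L1 setT g ->
  \int[mu]_x kint k g x = (\int[mu]_x k x) * \int[mu]_x g x.
Proof.
move=> gi; have h1 x : `|cst 1 x : R| <= 1 by rewrite normr1.
transitivity (\int[mu]_x (kint k g x * cst 1 x)).
  by apply: eq_Rintegral => x _; rewrite mulr1.
rewrite (kint_swap gi _ h1)// -RintegralZl//; apply: eq_Rintegral => y _.
rewrite mulrC; congr (_ * _).
under eq_Rintegral do rewrite /= mulr1.
exact: Rintegral_translate_rV.
Qed.

End kernel_integral.

(** * Mollification *)

Section prodfun_facts.
Context {R : realType} (n : nat).

Lemma prodfun_bounded (a : 'I_n -> R -> R) : (forall i, bump_fun (a i)) ->
  exists M, forall x, `|prodfun a x| <= M.
Proof.
move=> ba; have /choice[M hM] : forall i, exists M, forall t, `|a i t| <= M.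
  by move=> i; exact: bump_fun_bounded.
exists (\prod_i M i) => x; rewrite /prodfun normr_prod.
by apply: ler_prod => i _; rewrite normr_ge0/=.
Qed.

End prodfun_facts.

Section mollifier.
Context {R : realType} (n : nat) (eps : R) (eps0 : 0 < eps).
Local Notation mu := (@lebesgue_rV R n).
Local Notation L1 D f := (mu.-integrable D (EFin \o f)).
Implicit Types (g h : 'rV[R]_n -> R) (x y z : 'rV[R]_n) (t : R).

(** A product of two one-sided flat exponentials, positive exactly on []- eps, eps[]. It is not
    normalized; the division by its integral takes place in [smear]. *)
Definition mollifier1 t := flat_exp 1 (eps + t) * flat_exp 1 (eps - t).

Definition dmollifier1 t : R :=
  flat_exp (flat_deriv 1) (eps + t) * flat_exp 1 (eps - t) +
  flat_exp 1 (eps + t) * flat_exp (- flat_deriv 1) (eps - t).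

Definition mollifier z := @prodfun R n (fun _ => mollifier1) z.

Definition dmollifier i z :=
  @prodfun R n (fun j => if j == i then dmollifier1 else mollifier1) z.

Lemma bump_mollifier1 : bump_fun mollifier1.
Proof. exact: bump_base. Qed.

Lemma bump_dmollifier1 : bump_fun dmollifier1.
Proof. by apply: bump_add; exact: bump_base. Qed.

Lemma is_derive_mollifier1 (t : R) : is_derive t 1 mollifier1 (dmollifier1 t).
Proof. exact: is_derive_flat_exp_mul. Qed.

Lemma is_derive_mollifier i z :
  is_derive z (delta_mx 0 i) mollifier (dmollifier i z).
Proof. exact: is_derive_prodfun is_derive_mollifier1 z. Qed.

Lemma mollifier1_ge0 t : 0 <= mollifier1 t.
Proof.
rewrite /mollifier1 /flat_exp !hornerC !mul1r mulr_ge0//;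
by case: ifP => // _; rewrite expR_ge0.
Qed.

Lemma mollifier1_gt0 t : `|t| < eps -> 0 < mollifier1 t.
Proof.
rewrite ltr_norml => /andP[t1 t2]; rewrite /mollifier1 !flat_exp_gt0.
- by rewrite !hornerC !mul1r mulr_gt0 ?expR_gt0.
- by rewrite subr_gt0.
- by rewrite -ltrBlDl sub0r.
Qed.

Lemma mollifier1_eq0 t : ~~ (`|t| < eps) -> mollifier1 t = 0.
Proof.
rewrite -leNgt ler_normr; rewrite /mollifier1 => /orP[h|h].
  by rewrite (flat_exp_le0 _ (_ : eps - t <= 0)) ?mulr0//; lra.
by rewrite (flat_exp_le0 _ (_ : eps + t <= 0)) ?mul0r//; lra.
Qed.

Lemma dmollifier1_eq0 t : ~~ (`|t| < eps) -> dmollifier1 t = 0.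
Proof.
rewrite -leNgt ler_normr; rewrite /dmollifier1 => /orP[h|h].
  by rewrite !(flat_exp_le0 _ (_ : eps - t <= 0)) ?mulr0 ?addr0//; lra.
by rewrite !(flat_exp_le0 _ (_ : eps + t <= 0)) ?mul0r ?addr0//; lra.
Qed.

Lemma mollifier_ge0 z : 0 <= mollifier z.
Proof. by apply: prodr_ge0 => i _; exact: mollifier1_ge0. Qed.

Lemma mollifier_gt0 z : cube 0 eps z -> 0 < mollifier z.
Proof.
move=> hz; apply: prodr_gt0 => i _; apply: mollifier1_gt0.
by have := hz i; rewrite mxE sub0r normrN.
Qed.

Lemma not_cube z : ~ cube 0 eps z -> exists i, ~~ (`|z 0 i| < eps).
Proof.
move=> h; apply: contrapT => h'; apply: h => i; rewrite mxE sub0r normrN.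
by apply: contrapT => h; apply: h'; exists i; apply/negP.
Qed.

Lemma mollifier_eq0 z : ~ cube 0 eps z -> mollifier z = 0.
Proof.
move=> /not_cube[i hi]; rewrite /mollifier /prodfun (bigD1 i)//=.
by rewrite mollifier1_eq0// mul0r.
Qed.

Lemma dmollifier_eq0 i z : ~ cube 0 eps z -> dmollifier i z = 0.
Proof.
move=> /not_cube[j hj]; rewrite /dmollifier /prodfun (bigD1 j)//=.
by case: ifP => _; rewrite ?mollifier1_eq0 ?dmollifier1_eq0 ?mul0r.
Qed.

Lemma mollifierN z : mollifier (- z) = mollifier z.
Proof.
apply: eq_bigr => i _; rewrite mxE /mollifier1 mulrC opprK; congr (_ * _).
Qed.

Lemma normr_mollifierN z : `|mollifier (- z)| = `|mollifier z|.
Proof. by rewrite mollifierN. Qed.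

Lemma normr_dmollifierN i z : `|dmollifier i (- z)| = `|dmollifier i z|.
Proof.
rewrite !normr_prod; apply: eq_bigr => j _; rewrite mxE.
case: ifP => _; last by rewrite /mollifier1 mulrC opprK.
rewrite -normrN /dmollifier1 !flat_expN opprK; congr `|_|; ring.
Qed.

Lemma bump_dmollifier i (j : 'I_n) :
  bump_fun (if j == i then dmollifier1 else mollifier1).
Proof. by case: ifP => _; [exact: bump_dmollifier1|exact: bump_mollifier1]. Qed.

Lemma measurable_mollifier : measurable_fun setT mollifier.
Proof.
by apply: continuous_measurable_rV; apply: prodfun_continuous => i;
  exact: bump_mollifier1.
Qed.

Lemma measurable_dmollifier i : measurable_fun setT (dmollifier i).
Proof.
by apply: continuous_measurable_rV; apply: prodfun_continuous => j;
  exact: bump_dmollifier.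
Qed.

Lemma mollifier_bounded : exists M, forall z, `|mollifier z| <= M.
Proof. by apply: prodfun_bounded => i; exact: bump_mollifier1. Qed.

Lemma dmollifier_bounded i : exists M, forall z, `|dmollifier i z| <= M.
Proof. by apply: prodfun_bounded => j; exact: bump_dmollifier. Qed.

Lemma integrable_mollifier : L1 setT mollifier.
Proof.
have [M hM] := mollifier_bounded.
by apply: (integrable_compact_support measurable_mollifier hM) => x;
  exact: mollifier_eq0.
Qed.

Lemma integrable_dmollifier i : L1 setT (dmollifier i).
Proof.
have [M hM] := dmollifier_bounded i.
by apply: (integrable_compact_support (measurable_dmollifier i) hM) => x;
  exact: dmollifier_eq0.
Qed.

(** A zero integral would make the mollifier vanish almost everywhere, but it is positive on a cube
    of measure [(2 eps)^n]. *)
Lemma integral_mollifier_gt0 : 0 < \int[mu]_x mollifier x.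
Proof.
rewrite lt_neqAle Rintegral_ge0 ?andbT; last by move=> x _; exact: mollifier_ge0.
apply/negP => /eqP I0.
have mi := integrable_mollifier.
have : (\int[mu]_x `|(mollifier x)%:E| = 0)%E.
  rewrite (eq_integral (fun x => (mollifier x)%:E)); last first.
    by move=> x _; rewrite /= ger0_norm// mollifier_ge0.
  rewrite -[LHS]fineK; last exact: integrable_fin_num.
  by rewrite -[fine _]/(\int[mu]_x mollifier x) -I0.
move=> /(ae_eq_integral_abs _ measurableT (measurable_int _ mi)).
move=> [A [mA A0 sub]].
have : (mu (cube 0 eps) <= 0)%E.
  rewrite -A0; apply: le_measure; rewrite ?inE//; first exact: measurable_cube.
  move=> x cx; apply: sub => /= h; have := h I => -[].
  by move/eqP; rewrite gt_eqF// mollifier_gt0.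
by rewrite lebesgue_rV_cube// leNgt lte_fin exprn_gt0// mulr_gt0.
Qed.

Lemma mollifier_shiftE x : (fun y => mollifier (y - x)) =
  prodfun (fun i t => flat_exp 1 (eps - x 0 i + t) * flat_exp 1 (eps + x 0 i - t)).
Proof.
apply/funext => y; apply: eq_bigr => i _; rewrite /mollifier1 !mxE.
by congr (flat_exp 1 _ * flat_exp 1 _); ring.
Qed.

Lemma is_derive_mollifier_shift i x y :
  is_derive y (delta_mx 0 i) (fun y => mollifier (y - x)) (dmollifier i (y - x)).
Proof.
apply/is_derive_line0.
have /is_derive_line0 := is_derive_mollifier i (y - x).
by under eq_fun do rewrite addrA.
Qed.

Lemma partial_mollifier_shift i x :
  partial [:: i] (fun y => mollifier (y - x)) = (fun y => dmollifier i (y - x)).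
Proof. by apply/funext => y /=; have [_] := is_derive_mollifier_shift i x y. Qed.

(** The closed cube has to lie in [Om], since it is the compact set that carries the function. *)
Lemma test_function_mollifier (Om : set 'rV[R]_n) x :
  (forall y, (forall i, `|x 0 i - y 0 i| <= eps) -> Om y) ->
  test_function Om (fun y => mollifier (y - x)).
Proof.
move=> hOm; split.
  by rewrite mollifier_shiftE; apply: smooth_prodfun => i; exact: bump_base.
exists [set y | forall i, (`[x 0 i - eps, x 0 i + eps]%classic : set R) (y 0 i)].
split.
- apply: (@rV_compact _ n (fun i => `[x 0 i - eps, x 0 i + eps]%classic)) => i.
  exact: segment_compact.
- move=> y hy; apply: hOm => i; have /= := hy i; rewrite in_itv/= => /andP[h1 h2].
  by rewrite ler_norml; apply/andP; split; lra.
- move=> y hy; apply: mollifier_eq0 => h; apply: hy => i /=.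
  have := h i; rewrite !mxE sub0r normrN ltr_norml in_itv/= => /andP[h1 h2].
  by apply/andP; split; lra.
Qed.

Let k0 := \int[mu]_x mollifier x.

Definition smear g x := k0^-1 * kint mollifier g x.

(** The sign comes from differentiating [mollifier (y - x)] with respect to [x]. *)
Definition dsmear i g x := - (k0^-1 * kint (dmollifier i) g x).

Lemma integrable_smear g : L1 setT g -> L1 setT (smear g).
Proof.
move=> gi; have [M hM] := mollifier_bounded.
have := integrable_kint measurable_mollifier hM integrable_mollifier
  normr_mollifierN gi.
by move=> /(integrableZl measurableT k0^-1); apply: eq_integrable.
Qed.

Lemma measurable_smear g : L1 setT g ->
  measurable_fun setT (smear g).
Proof. by move=> /integrable_smear/integrable_measurable. Qed.

Lemma measurable_dsmear i g : L1 setT g ->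
  measurable_fun setT (dsmear i g).
Proof.
move=> gi; have [M hM] := dmollifier_bounded i.
apply: measurableT_comp => //; apply: measurable_funM => //.
exact (measurable_kint (measurable_dmollifier i) (integrable_dmollifier i)
  (normr_dmollifierN i) gi).
Qed.

Lemma smear_bounded g : L1 setT g ->
  exists M, forall x, `|smear g x| <= M /\ forall i, `|dsmear i g x| <= M.
Proof.
move=> gi; have [M hM] := mollifier_bounded.
have /choice[N hN] : forall i, exists N, forall z, `|dmollifier i z| <= N.
  by move=> i; exact: dmollifier_bounded.
have k0' : 0 <= k0^-1 by rewrite invr_ge0 ltW// integral_mollifier_gt0.
pose I := \int[mu]_y `|g y|.
have I0 : 0 <= I by apply: Rintegral_ge0 => y _.
have N0 i : 0 <= N i by apply: le_trans (hN i 0).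
have M0 : 0 <= M by apply: le_trans (hM 0).
exists (k0^-1 * ((M + \sum_i N i) * I)) => x.
split=> [|i]; rewrite ?normrN normrM (ger0_norm k0') ler_wpM2l//.
- apply: le_trans (normr_kint_le measurable_mollifier hM x gi) _.
  by rewrite ler_wpM2r// lerDl sumr_ge0.
- apply: le_trans (normr_kint_le (measurable_dmollifier i) (hN i) x gi) _.
  rewrite ler_wpM2r// (bigD1 i)//= addrCA lerDl addr_ge0// sumr_ge0//.
Qed.

Lemma is_derive_smear i g x : L1 setT g ->
  is_derive x (delta_mx 0 i) (smear g) (dsmear i g x).
Proof.
move=> gi; have [M hM] := mollifier_bounded; have [N hN] := dmollifier_bounded i.
pose e : 'rV[R]_n := delta_mx 0 i.
pose f (t : R) y := mollifier (y - (t *: e + x)) * g y.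
have df (t : R) y :
    is_derive t 1 (f ^~ y) (- dmollifier i (y - (t *: e + x)) * g y).
  have h1 : is_derive (- t) 1 (fun s : R => mollifier (s *: e + (y - x)))
      (dmollifier i (y - (t *: e + x))).
    apply/is_derive_line; rewrite scaleNr.
    rewrite (_ : - (t *: e) + (y - x) = y - (t *: e + x)).
      exact: is_derive_mollifier.
    by rewrite opprD addrCA.
  have h2 : is_derive t 1 (fun s : R => - s) (-1 : R).
    exact: is_deriveN (is_derive_id t 1).
  have h3 := @is_derive1_comp _ (fun s : R => mollifier (s *: e + (y - x)))
    (fun s : R => - s) _ _ _ h1 h2.
  rewrite (_ : f ^~ y = (fun s => mollifier (- s *: e + (y - x)) * g y)).
    apply: is_derive_eq (is_deriveM h3 (is_derive_cst (g y) t 1)) _.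
    by rewrite scaler0 add0r /GRing.scale/= mulrN1 mulrC.
  apply/funext => s; rewrite /f; congr (mollifier _ * _).
  by rewrite opprD addrCA scaleNr.
have I0 : (`]-1, 1[%classic : set R) 0.
  by rewrite /= in_itv/= ltrN10 ltr01.
have h1 t : (`]-1, 1[%classic : set R) t -> L1 setT (f t).
  by move=> _; exact: (integrable_kernel_mul measurable_mollifier hM).
have h2 t y : (`]-1, 1[%classic : set R) t -> [set: 'rV[R]_n] y ->
    derivable (f ^~ y) t 1 by move=> _ _; have [] := df t y.
pose G y := N * `|g y|.
have N0 : 0 <= N by apply: le_trans (hN 0).
have h3 y : 0 <= G y by rewrite mulr_ge0.
have h4 : L1 setT G.
  have := integrableZl measurableT N (integrable_normr gi).
  by apply: eq_integrable.
have h5 t y : (`]-1, 1[%classic : set R) t -> [set: 'rV[R]_n] y ->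
    `|partial1of2 f t y| <= G y.
  move=> _ _; rewrite partial1of2E; have [_ ->] := df t y.
  by rewrite normrM normrN /G ler_wpM2r.
have D1 := derivable_under_integral measurableT I0 h1 h2 h3 h4 h5.
have D2 := differentiation_under_integral measurableT I0 h1 h2 h3 h4 h5.
have dF : is_derive (0 : R) 1 (fun t : R => \int[mu]_y f t y)
    (- kint (dmollifier i) g x).
  split=> //; rewrite -derive1E D2.
  rewrite -mulN1r -RintegralZl//; last first.
    exact: (integrable_kernel_mul (measurable_dmollifier i) hN).
  apply: eq_Rintegral => y _; rewrite partial1of2E; have [_ ->] := df 0 y.
  by rewrite scale0r add0r mulN1r mulNr.
apply/is_derive_line0.
have h := is_deriveM (is_derive_cst k0^-1 (0 : R) (1 : R)) dF.
by rewrite scaler0 addr0 in h; rewrite /dsmear -mulrN; exact: h.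
Qed.

Lemma smear_le g x c : L1 setT g ->
  (forall y, cube x eps y -> g y <= c) -> smear g x <= c.
Proof.
move=> gi gc; have [M hM] := mollifier_bounded.
have k0' := integral_mollifier_gt0.
have mi : L1 setT (fun y => mollifier (y - x)).
  exact: integrable_translate_rV integrable_mollifier.
rewrite /smear mulrC ler_pdivrMr//.
rewrite -[X in _ <= _ * X](Rintegral_translate_rV (- x) integrable_mollifier).
rewrite -RintegralZl//; apply: le_Rintegral => //.
- exact: (integrable_kernel_mul measurable_mollifier hM).
- exact: integrable_scale.
move=> y _; have [xy|xy] := pselect (cube x eps y).
  by rewrite mulrC ler_wpM2r ?mollifier_ge0// gc.
rewrite mollifier_eq0 ?mul0r ?mulr0// => h; apply: xy => i.
by have := h i; rewrite !mxE sub0r normrN distrC.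
Qed.

Lemma smearN g x : L1 setT g ->
  smear (fun y => - g y) x = - smear g x.
Proof.
move=> gi; have [M hM] := mollifier_bounded.
have kgi := integrable_kernel_mul measurable_mollifier hM x gi.
rewrite /smear -mulrN; congr (_ * _); rewrite /kint -mulN1r -RintegralZl//.
by apply: eq_Rintegral => y _; rewrite mulN1r mulrN.
Qed.

Lemma integrable_opp g : L1 setT g -> L1 setT (fun y => - g y).
Proof. by move=> /integrableN; apply: eq_integrable. Qed.

Lemma smear_near g x c tau : L1 setT g ->
  (forall y, cube x eps y -> `|g y - c| <= tau) -> `|smear g x - c| <= tau.
Proof.
move=> gi gc; rewrite ler_distl; apply/andP; split.
  rewrite -lerN2 -smearN//; apply: smear_le; first exact: integrable_opp.
  by move=> y /gc; rewrite ler_distl lerN2 => /andP[].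
apply: smear_le => // y /gc; rewrite ler_distl => /andP[_].
by rewrite addrC.
Qed.

(** Jensen's inequality for the weighted mean [c = smear g x]: expand the nonnegative integral of
    [mollifier (y - x) * (g y - c)^2]. *)
Lemma smear_sqr_le g x : L1 setT g -> L1 setT (fun y => g y ^+ 2) ->
  smear g x ^+ 2 <= smear (fun y => g y ^+ 2) x.
Proof.
move=> gi g2i; have [M hM] := mollifier_bounded.
have k0' := integral_mollifier_gt0.
set c := smear g x.
have kg := integrable_kernel_mul measurable_mollifier hM x gi.
have kg2 := integrable_kernel_mul measurable_mollifier hM x g2i.
have mi : L1 setT (fun y => mollifier (y - x)).
  exact: integrable_translate_rV integrable_mollifier.
have i1 : L1 setT (fun y => (- (2 * c)) * (mollifier (y - x) * g y)).
  exact: integrable_scale.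
have i2 : L1 setT (fun y => c ^+ 2 * mollifier (y - x)).
  exact: integrable_scale.
have i3 : L1 setT (fun y => mollifier (y - x) * g y ^+ 2 +
    (- (2 * c)) * (mollifier (y - x) * g y)).
  exact: integrable_add.
have : 0 <= \int[mu]_y (mollifier (y - x) * g y ^+ 2 +
    (- (2 * c)) * (mollifier (y - x) * g y) + c ^+ 2 * mollifier (y - x)).
  apply: Rintegral_ge0 => y _.
  rewrite (_ : _ + _ = mollifier (y - x) * (g y - c) ^+ 2); last by ring.
  by rewrite mulr_ge0 ?sqr_ge0 ?mollifier_ge0.
rewrite RintegralD// RintegralD// !RintegralZl//.
rewrite (Rintegral_translate_rV (- x) integrable_mollifier) -/k0.
rewrite -[X in X + _ * _ + _]/(kint mollifier (fun y => g y ^+ 2) x).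
rewrite -[X in _ + _ * X + _]/(kint mollifier g x).
have -> : kint mollifier g x = k0 * c by rewrite /c /smear mulVKf ?gt_eqF.
rewrite (_ : _ + _ = kint mollifier (fun y => g y ^+ 2) x - c ^+ 2 * k0); last by ring.
by rewrite subr_ge0 /smear mulrC ler_pdivlMl// mulrC.
Qed.

(** Serves to move the mollification from a function that is merely integrable to one for which it
    is uniformly close to the identity. *)
Lemma smear_swap g (Psi : 'rV[R]_n -> R) (M : R) : L1 setT g ->
  measurable_fun setT Psi -> (forall x, `|Psi x| <= M) ->
  L1 setT Psi ->
  \int[mu]_x (smear g x * Psi x) = \int[mu]_y (g y * smear Psi y).
Proof.
move=> gi mP PM Pi; have [N hN] := mollifier_bounded.
have mN := normr_mollifierN.
have kgi := integrable_kint measurable_mollifier hN integrable_mollifier mN gi.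
have kPM y := normr_kint_le measurable_mollifier hN y Pi.
have mkP := measurable_kint measurable_mollifier integrable_mollifier mN Pi.
under eq_Rintegral do rewrite /smear -mulrA.
rewrite RintegralZl//; last first.
  have := integrable_bounded_mul kgi mP PM.
  by apply: eq_integrable => // x _; rewrite /= mulrC.
rewrite (kint_swap measurable_mollifier hN integrable_mollifier mN mollifierN gi mP PM).
rewrite -RintegralZl//; last first.
  have := integrable_bounded_mul gi mkP kPM.
  by apply: eq_integrable => // x _; rewrite /= mulrC.
by apply: eq_Rintegral => y _; rewrite /smear mulrCA.
Qed.

Lemma integral_smear g : L1 setT g ->
  \int[mu]_x smear g x = \int[mu]_x g x.
Proof.
move=> gi; have [N hN] := mollifier_bounded.
have mN := normr_mollifierN.
have kgi := integrable_kint measurable_mollifier hN integrable_mollifier mN gi.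
rewrite RintegralZl//.
rewrite (integral_kint measurable_mollifier hN integrable_mollifier mN mollifierN gi).
by rewrite mulKf// gt_eqF// integral_mollifier_gt0.
Qed.

End mollifier.

Section Rintegral_sum.
Context d (T : measurableType d) (R : realType) (mu : {measure set T -> \bar R}).
Local Notation L1 D f := (mu.-integrable D (EFin \o f)).

Lemma integrable_sum_seq I (s : seq I) (F : I -> T -> R) :
  (forall i, L1 setT (F i)) ->
  L1 setT (fun x => \sum_(i <- s) F i x).
Proof.
move=> Fi; elim: s => [|i s ih].
  apply: eq_integrable (integrable0 _ _) => // x _.
  by rewrite /= big_nil.
apply: eq_integrable (integrableD measurableT (Fi i) ih) => // x _.
by rewrite /= big_cons.
Qed.

Lemma Rintegral_sum I (s : seq I) (F : I -> T -> R) :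
  (forall i, L1 setT (F i)) ->
  \int[mu]_x \sum_(i <- s) F i x = \sum_(i <- s) \int[mu]_x F i x.
Proof.
move=> Fi; elim: s => [|i s ih].
  under eq_Rintegral do rewrite big_nil.
  by rewrite big_nil Rintegral_cst// mul0r.
under eq_Rintegral do rewrite big_cons.
by rewrite big_cons RintegralD// ?ih//; exact: integrable_sum_seq.
Qed.

End Rintegral_sum.

Section smear_extra.
Context {R : realType} (n : nat) (eps : R) (eps0 : 0 < eps).
Local Notation mu := (@lebesgue_rV R n).
Local Notation L1 D f := (mu.-integrable D (EFin \o f)).
Implicit Types (g h : 'rV[R]_n -> R) (x y z : 'rV[R]_n) (c : R).

(** Meant for the commutator of [smear] with [gam]: there [g] is [(gam - gam x) * v i], [h] is
    [v i], and [c] bounds the oscillation of [gam] on the cube. *)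
Lemma smear_normr_le g h x c : 0 <= c -> L1 setT g -> L1 setT h ->
  (forall y, cube x eps y -> `|g y| <= c * `|h y|) ->
  `|smear eps g x| <= c * smear eps (fun y => `|h y|) x.
Proof.
move=> c0 gi hi gh; have [M hM] := @mollifier_bounded R n eps.
have k0 : 0 <= (\int[mu]_x mollifier eps x)^-1.
  by rewrite invr_ge0 ltW// integral_mollifier_gt0.
rewrite /smear normrM (ger0_norm k0) mulrCA ler_wpM2l//.
have kg := integrable_kernel_mul (@measurable_mollifier R n eps) hM x gi.
have kh := integrable_kernel_mul (@measurable_mollifier R n eps) hM x (integrable_normr hi).
apply: le_trans (le_normr_Rintegral measurableT kg) _.
rewrite /kint -RintegralZl//; apply: le_Rintegral => //.
- exact: integrable_normr.
- exact: integrable_scale.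
move=> y _; rewrite normrM (ger0_norm (mollifier_ge0 _ _)).
have [xy|xy] := pselect (cube x eps y).
  by rewrite mulrCA ler_wpM2l ?mollifier_ge0// gh.
rewrite mollifier_eq0 ?mul0r ?mulr0// => h0; apply: xy => i.
by have := h0 i; rewrite !mxE sub0r normrN distrC.
Qed.

Lemma smearB g h x c : L1 setT g -> L1 setT h ->
  smear eps (fun y => g y - c * h y) x = smear eps g x - c * smear eps h x.
Proof.
move=> gi hi; have [M hM] := @mollifier_bounded R n eps.
have kg := integrable_kernel_mul (@measurable_mollifier R n eps) hM x gi.
have kh := integrable_kernel_mul (@measurable_mollifier R n eps) hM x hi.
rewrite /smear mulrCA -mulrBr; congr (_ * _).
rewrite /kint -RintegralZl// -RintegralB//; last first.
  exact: integrable_scale.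
by apply: eq_Rintegral => y _; ring.
Qed.

Lemma smear_normr g x : L1 setT g ->
  `|smear eps g x| <= smear eps (fun y => `|g y|) x.
Proof.
move=> gi; have := @smear_normr_le g g x 1 ler01 gi gi.
by rewrite mul1r; apply => y _; rewrite mul1r.
Qed.

End smear_extra.

Definition unif_cont_on {R : realType} n (A : set 'rV[R]_n) (f : 'rV[R]_n -> R) :=
  forall tau, 0 < tau -> exists2 eps, 0 < eps &
    forall x y, A x -> A y -> cube x eps y -> `|f x - f y| <= tau.

(** * Testing a weak equation with a nonlinear function of its solution *)

Section weak_inequality.
Context {R : realType} (n : nat).
Local Notation mu := (@lebesgue_rV R n).
Local Notation L1 D f := (mu.-integrable D (EFin \o f)).
Variables (Om : set 'rV[R]_n) (r : R).
Hypothesis Om_cube : Om `<=` cube 0 r.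

Variables (w f0 gam : 'rV[R]_n -> R) (v : 'I_n -> 'rV[R]_n -> R) (Mw Mg : R).
Hypotheses (mw : measurable_fun setT w) (wM : forall x, `|w x| <= Mw).
Hypothesis w0 : forall x, ~ Om x -> w x = 0.
(** Extended by zero, [w] may jump at the boundary, where it is only known to be nonpositive. Its
    positive part does not, so uniform continuity is asked of [wp] alone. *)
Let wp x := Num.max (w x) 0.
Hypothesis ucw : unif_cont_on setT wp.
Hypotheses (vi : forall i, L1 setT (v i)).
Hypotheses (v2i : forall i, L1 setT (fun x => v i x ^+ 2)).
Hypothesis f0i : L1 setT f0.
Hypothesis f00 : forall x, ~ Om x -> f0 x = 0.
Hypotheses (mgam : measurable_fun setT gam) (gamM : forall x, `|gam x| <= Mg).
Hypotheses (gam0 : forall x, Om x -> 0 <= gam x) (ucgam : unif_cont_on Om gam).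

Hypothesis weak_grad : forall phi, test_function Om phi -> forall i,
  \int[mu]_x (w x * partial [:: i] phi x) = - \int[mu]_x (v i x * phi x).
Hypothesis weak_div : forall phi, test_function Om phi ->
  \int[mu]_x (\sum_i gam x * v i x * partial [:: i] phi x) =
  \int[mu]_x (f0 x * phi x).

Variables (eta : 'rV[R]_n -> R) (deta h : 'I_n -> 'rV[R]_n -> R) (Me : R).
Hypothesis (meta : measurable_fun setT eta).
Hypothesis (mdeta : forall i, measurable_fun setT (deta i)).
Hypothesis (mh : forall i, measurable_fun setT (h i)).
Hypothesis deta_der : forall i x, is_derive x (delta_mx 0 i) eta (deta i x).
Hypothesis h_der : forall i x, Om x ->
  is_derive x (delta_mx 0 i) (fun y => gam y * deta i y) (h i x).
Hypothesis etaM : forall x, Om x -> 0 <= eta x <= Me.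
Hypothesis detaM : forall i x, Om x -> `|deta i x| <= Me.
Hypothesis hM : forall i x, Om x -> `|h i x| <= Me.
Hypothesis uceta : unif_cont_on Om eta.

Variables (B bt dbt : R -> R) (delta Mb : R).
Hypothesis delta0 : 0 < delta.
Hypothesis B_der : forall t : R, is_derive t 1 B (bt t).
Hypothesis bt_der : forall t : R, is_derive t 1 bt (dbt t).
Hypothesis mdbt : measurable_fun setT dbt.
Hypothesis dbt0 : forall t, 0 <= dbt t.
Hypothesis b0 : forall t, t <= delta -> [/\ B t = 0, bt t = 0 & dbt t = 0].
Hypothesis bM : forall t, t <= Mw -> [/\ `|B t| <= Mb, `|bt t| <= Mb & `|dbt t| <= Mb].
Hypothesis bL : forall s t, s <= Mw -> t <= Mw ->
  `|B s - B t| <= Mb * `|s - t| /\ `|bt s - bt t| <= Mb * `|s - t|.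

Let mB : measurable_fun setT B.
Proof.
apply: continuous_measurable_fun => t; apply: differentiable_continuous.
by apply/derivable1_diffP; have [] := B_der t.
Qed.

Let mbt : measurable_fun setT bt.
Proof.
apply: continuous_measurable_fun => t; apply: differentiable_continuous.
by apply/derivable1_diffP; have [] := bt_der t.
Qed.

Let Mw0 : 0 <= Mw. Proof. exact: le_trans (wM 0). Qed.
Let Mg0 : 0 <= Mg. Proof. exact: le_trans (gamM 0). Qed.
Let Mb0 : 0 <= Mb. Proof. by have [h1 _ _] := bM (lexx Mw); apply: le_trans h1. Qed.

Let wi : L1 setT w.
Proof.
apply: (integrable_compact_support mw wM) => x /= hx.
by apply: w0 => Ox; apply: hx; exact: Om_cube.
Qed.

Let gv i x := gam x * v i x.

Let gvi i : L1 setT (gv i).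
Proof. exact: integrable_bounded_mul gamM. Qed.

Let wp_pos x : 0 < wp x -> Om x /\ wp x = w x.
Proof.
rewrite /wp; have [Ox|Ox] := pselect (Om x); last by rewrite w0// maxxx ltxx.
by rewrite lt_max ltxx orbF => /ltW wx; rewrite max_l.
Qed.

(* If [x] is in [K], then the mollifier of radius [eps] centred at [x] is a test
   function in [Om]; otherwise [B], [bt] and [dbt] vanish at [we x]. *)
Section fixed_scale.
Variables (eps tau : R).
Hypotheses (eps0 : 0 < eps) (tau0 : 0 < tau) (tau_delta : tau <= delta / 4).
Hypothesis weps : forall x y : 'rV[R]_n, (forall i, `|x 0 i - y 0 i| <= eps) ->
  `|wp x - wp y| <= tau.
Hypothesis gameps : forall x y, Om x -> Om y -> cube x eps y ->
  `|gam x - gam y| <= tau.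

(** The oscillation of [wp] at scale [eps] is at most [delta / 4]. So on a cube centred in [K] one
    has [wp >= delta / 4 > 0], which forces it into [Om]; on a cube centred outside [K] one has
    [wp <= 3 delta / 4], hence [we <= delta] at its centre. *)
Let K x := delta / 2 <= wp x.
Let we := smear eps w.
Let W i := dsmear eps i w.
Let V i := smear eps (gv i).
Let DV i := dsmear eps i (gv i).
Let fe := smear eps f0.

Let cube_eps (x y : 'rV[R]_n) : cube x eps y -> forall i, `|x 0 i - y 0 i| <= eps.
Proof. by move=> h' i; exact: ltW. Qed.

Let K_cube (x y : 'rV[R]_n) : K x -> (forall i, `|x 0 i - y 0 i| <= eps) ->
  Om y /\ wp y = w y.
Proof.
move=> Kx /weps; rewrite ler_distl => /andP[_ h1]; apply: wp_pos.
have : delta / 2 <= wp x by [].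
move: delta0 tau_delta h1; lra.
Qed.

Let K_Om x : K x -> Om x /\ wp x = w x.
Proof. by move=> Kx; apply: (K_cube Kx) => i; rewrite subrr normr0 ltW. Qed.

Let we_le x : we x <= Mw.
Proof. by apply: smear_le => // y _; exact: le_trans (ler_norm _) (wM y). Qed.

Let we_notK x : ~ K x -> we x <= delta.
Proof.
move=> /negP; rewrite -ltNge => Kx; apply: smear_le => // y /cube_eps/weps.
rewrite ler_distl => /andP[h1 _].
have : w y <= wp y by rewrite /wp le_max lexx.
move: delta0 tau_delta h1 Kx; lra.
Qed.

Lemma smear_near_w x : K x -> `|we x - w x| <= tau.
Proof.
move=> Kx; apply: smear_near => // y /cube_eps xy.
have [_ <-] := K_cube Kx xy; have [_ <-] := K_Om Kx.
by rewrite distrC weps.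
Qed.

Let WE i x : K x -> W i x = smear eps (v i) x.
Proof.
move=> Kx.
have tf := @test_function_mollifier R n eps Om x (fun y xy => (K_cube Kx xy).1).
rewrite /W /dsmear /smear /kint -mulrN; congr (_ * _).
have := weak_grad tf i; rewrite partial_mollifier_shift => E.
under eq_Rintegral do rewrite mulrC.
rewrite E opprK; apply: eq_Rintegral => y _; exact: mulrC.
Qed.

Let DVE x : K x -> \sum_i DV i x = - fe x.
Proof.
move=> Kx.
have tf := @test_function_mollifier R n eps Om x (fun y xy => (K_cube Kx xy).1).
rewrite /DV /dsmear /fe /smear sumrN -mulr_sumr; congr (- (_ * _)).
have := weak_div tf => E; rewrite /kint.
under [RHS]eq_Rintegral do rewrite mulrC.
rewrite -E.
have kgi i : L1 setT (fun y => dmollifier eps i (y - x) * gv i y).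
  have [N hN] := @dmollifier_bounded R n eps i.
  exact: (integrable_kernel_mul (measurable_dmollifier eps i) hN).
transitivity (\int[mu]_y \sum_i (dmollifier eps i (y - x) * gv i y)); last first.
  apply: eq_Rintegral => y _; apply: eq_bigr => i _.
  by rewrite partial_mollifier_shift mulrC.
by rewrite Rintegral_sum.
Qed.

Let b_notK x : ~ K x -> [/\ B (we x) = 0, bt (we x) = 0 & dbt (we x) = 0].
Proof. by move=> /we_notK/b0. Qed.

Let bMe x : [/\ `|B (we x)| <= Mb, `|bt (we x)| <= Mb & `|dbt (we x)| <= Mb].
Proof. exact: bM. Qed.

Let mwe : measurable_fun setT we. Proof. exact: measurable_smear. Qed.

Let we_der i x : is_derive x (delta_mx 0 i) we (W i x).
Proof. exact: is_derive_smear. Qed.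

Let comp_der (f f' : R -> R) i x : (forall t : R, is_derive t 1 f (f' t)) ->
  is_derive x (delta_mx 0 i) (fun y => f (we y)) (f' (we x) * W i x).
Proof.
move=> df; apply/is_derive_line0.
have /is_derive_line0 h1 := we_der i x.
have := @is_derive1_comp _ f (fun s : R => we (s *: delta_mx 0 i + x)) 0
  (f' (we (0 *: delta_mx 0 i + x))) _ (df _) h1.
by rewrite scale0r add0r.
Qed.

(* [I1 i] is the i-th partial derivative of [V i * (eta * bt we)], and [I2 i]
   that of [gam * deta i * B we]. *)
Let I1 i x := DV i x * (eta x * bt (we x)) +
  V i x * (deta i x * bt (we x) + eta x * (dbt (we x) * W i x)).

Let I2 i x := h i x * B (we x) + gam x * deta i x * (bt (we x) * W i x).

Let notK_cube x : ~ cube 0 r x -> ~ K x.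
Proof. by move=> xr Kx; apply: xr; apply: Om_cube; have [] := K_Om Kx. Qed.

Let mI1 i : measurable_fun setT (I1 i).
Proof.
have mV : measurable_fun setT (V i) by exact: measurable_smear.
have mDV : measurable_fun setT (DV i) by exact: measurable_dsmear.
have mW : measurable_fun setT (W i) by exact: measurable_dsmear.
have mb1 : measurable_fun setT (bt \o we) by exact: measurableT_comp.
have mb2 : measurable_fun setT (dbt \o we) by exact: measurableT_comp.
apply: measurable_funD; apply: measurable_funM => //.
  exact: measurable_funM.
apply: measurable_funD; apply: measurable_funM => //.
exact: measurable_funM.
Qed.

Let mI2 i : measurable_fun setT (I2 i).
Proof.
have mW : measurable_fun setT (W i) by exact: measurable_dsmear.
have mb1 : measurable_fun setT (bt \o we) by exact: measurableT_comp.
have mb2 : measurable_fun setT (B \o we) by exact: measurableT_comp.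
apply: measurable_funD; apply: measurable_funM => //.
  exact: measurable_funM.
exact: measurable_funM.
Qed.

Let Me0 x : Om x -> 0 <= Me.
Proof. by move=> /etaM/andP[]; exact: le_trans. Qed.

Let normr_mul_le (a b A C : R) : `|a| <= A -> `|b| <= C -> `|a * b| <= A * C.
Proof. by move=> h1 h2; rewrite normrM ler_pM. Qed.

Let I1_spec i : L1 setT (I1 i) /\ \int[mu]_x I1 i x = 0.
Proof.
have [MV hV] := @smear_bounded R n eps eps0 _ (gvi i).
have [MW hW] := @smear_bounded R n eps eps0 _ wi.
have MV0 : 0 <= MV by apply: le_trans (hV 0).1.
have MW0 : 0 <= MW by apply: le_trans (hW 0).1.
pose Me' := Num.max Me 0.
pose M := MV * (Me' * Mb) + (MV * (Me' * Mb + Me' * (Mb * MW))).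
have MeM : Me <= Me' by rewrite le_max lexx.
have Me'0 : 0 <= Me' by rewrite le_max lexx orbT.
have bF x : `|V i x * (eta x * bt (we x))| <= M /\ `|I1 i x| <= M.
  have [Kx|Kx] := pselect (K x); last first.
    have [_ h1 h2] := b_notK Kx.
    by rewrite /I1 h1 h2 !(mulr0, mul0r, addr0) normr0; split; do ?[apply: addr_ge0 => //|apply: mulr_ge0 => //].
  have [Ox _] := K_Om Kx; have [B1 B2 B3] := bMe x.
  have e1 : `|eta x| <= Me'.
    by have /andP[h1 h2] := etaM Ox; rewrite ger0_norm// (le_trans h2).
  have e2 : `|deta i x| <= Me' by apply: le_trans (detaM i Ox) _.
  have [V1 V2] := hV x; have [_ W2] := hW x.
  have hE : `|V i x * (eta x * bt (we x))| <= MV * (Me' * Mb).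
    by do 2!apply: normr_mul_le => //.
  split.
    by apply: le_trans hE _; rewrite lerDl; do ?[apply: addr_ge0 => //|apply: mulr_ge0 => //].
  apply: le_trans (ler_normD _ _) _; apply: lerD.
    by apply: normr_mul_le; [exact: V2|exact: normr_mul_le].
  apply: normr_mul_le => //; apply: le_trans (ler_normD _ _) _; apply: lerD.
    exact: normr_mul_le.
  apply: normr_mul_le => //; apply: normr_mul_le => //; exact: W2.
have z x : ~ cube 0 r x -> V i x * (eta x * bt (we x)) = 0 /\ I1 i x = 0.
  move=> /notK_cube/b_notK[_ h1 h2].
  by rewrite /I1 h1 h2 !(mulr0, mul0r, addr0).
have mV : measurable_fun setT (V i) by exact: measurable_smear.
have mb1 : measurable_fun setT (bt \o we) by exact: measurableT_comp.
split.
  apply: (@integrable_compact_support _ _ (I1 i) M r) => //.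
    by move=> x; exact: (bF x).2.
  by move=> x xr; exact: (z x xr).2.
apply: (@integral_partial_eq0 _ _ i (fun x => V i x * (eta x * bt (we x))) _ M r).
- by do 2!apply: measurable_funM => //.
- by move=> x; exact: (bF x).1.
- by move=> x xr; exact: (z x xr).1.
- by move=> x xr; exact: (z x xr).2.
- move=> x.
  have d1 : is_derive x (delta_mx 0 i) (fun y => eta y * bt (we y))
      (eta x * (dbt (we x) * W i x) + bt (we x) * deta i x).
    exact: is_deriveM (deta_der i x) (comp_der i x bt_der).
  have d2 := is_deriveM (is_derive_smear eps i x (gvi i)) d1.
  apply: is_derive_eq d2 _; rewrite /GRing.scale/= /I1 /V /DV /W; ring.
- by move=> x; exact: (bF x).2.
Qed.

Let I2_spec i : L1 setT (I2 i) /\ \int[mu]_x I2 i x = 0.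
Proof.
have [MW hW] := @smear_bounded R n eps eps0 _ wi.
have MW0 : 0 <= MW by apply: le_trans (hW 0).1.
pose Me' := Num.max Me 0.
pose M := Mg * Me' * Mb + (Me' * Mb + Mg * Me' * (Mb * MW)).
have MeM : Me <= Me' by rewrite le_max lexx.
have Me'0 : 0 <= Me' by rewrite le_max lexx orbT.
have bF x : `|gam x * deta i x * B (we x)| <= M /\ `|I2 i x| <= M.
  have [Kx|Kx] := pselect (K x); last first.
    have [h0 h1 h2] := b_notK Kx.
    by rewrite /I2 h0 h1 !(mulr0, mul0r, addr0) normr0; split; do ?[apply: addr_ge0 => //|apply: mulr_ge0 => //].
  have [Ox _] := K_Om Kx; have [B1 B2 B3] := bMe x.
  have e2 : `|deta i x| <= Me' by apply: le_trans (detaM i Ox) _.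
  have e3 : `|h i x| <= Me' by apply: le_trans (hM i Ox) _.
  have [_ W2] := hW x.
  split.
    apply: (@le_trans _ _ (Mg * Me' * Mb)).
      by do 2!apply: normr_mul_le => //.
    by rewrite lerDl; do ?[apply: addr_ge0 => //|apply: mulr_ge0 => //].
  apply: (@le_trans _ _ (Me' * Mb + Mg * Me' * (Mb * MW))); last first.
    by rewrite lerDr; do ?[apply: addr_ge0 => //|apply: mulr_ge0 => //].
  apply: le_trans (ler_normD _ _) _; apply: lerD; first exact: normr_mul_le.
  apply: normr_mul_le; apply: normr_mul_le => //; exact: W2.
have z x : ~ cube 0 r x -> gam x * deta i x * B (we x) = 0 /\ I2 i x = 0.
  move=> /notK_cube/b_notK[h0 h1 h2].
  by rewrite /I2 h0 h1 !(mulr0, mul0r, addr0).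
have mb1 : measurable_fun setT (B \o we) by exact: measurableT_comp.
split.
  apply: (@integrable_compact_support _ _ (I2 i) M r) => //.
    by move=> x; exact: (bF x).2.
  by move=> x xr; exact: (z x xr).2.
apply: (@integral_partial_eq0 _ _ i (fun x => gam x * deta i x * B (we x)) _ M r).
- by do 2!apply: measurable_funM => //.
- by move=> x; exact: (bF x).1.
- by move=> x xr; exact: (z x xr).1.
- by move=> x xr; exact: (z x xr).2.
- move=> x; have [Ox|Ox] := pselect (Om x).
    have d2 := is_deriveM (h_der i Ox) (comp_der i x B_der).
    apply: is_derive_eq d2 _; rewrite /GRing.scale/= /I2 /W; ring.
  (* Outside [Om] nothing is known about derivatives of [gam]. But [wp x = 0], so nearby points are
     outside [K] too and the function vanishes identically around [x]. *)
  have Kx : ~ K x by move=> /K_Om[].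
  have [h0 h1 h2] := b_notK Kx.
  have -> : I2 i x = 0 by rewrite /I2 h0 h1 mul0r !mulr0 addr0.
  have dc : is_derive x (delta_mx 0 i) (fun _ : 'rV[R]_n => 0 : R) 0.
    exact: is_derive_cst.
  apply: near_eq_is_derive dc.
  have wx0 : wp x = 0 by rewrite /wp w0// maxxx.
  near=> y.
  have Ky : ~ K y.
    move=> Ky; suff /weps : forall i, `|x 0 i - y 0 i| <= eps.
      rewrite wx0 sub0r normrN ler_norml => /andP[_ h3].
      have h4 : delta / 2 <= wp y by [].
      move: delta0 tau_delta h3 h4; lra.
    apply: cube_eps; rewrite cube_ball//; near: y; exact: nbhsx_ballx.
  by have [-> _ _] := b_notK Ky; rewrite mulr0.
- by move=> x; exact: (bF x).2.
Unshelve. all: end_near. Qed.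

Hypothesis etaeps : forall x y, Om x -> Om y -> cube x eps y ->
  `|eta x - eta y| <= tau.

Let Me' := Num.max Me 0.
Let Me'0 : 0 <= Me'. Proof. by rewrite le_max lexx orbT. Qed.
Let MeM : Me <= Me'. Proof. by rewrite le_max lexx. Qed.
Let C1 i := Me' * Mb * (fine (mu (cube 0 r)) + 2 * \int[mu]_x v i x ^+ 2).
Let Hs x := \sum_i h i x.
(** The commutator error. With [N] the mollification of [|v i|], it is at most [tau N] times
    [Me' Mb (1 + N)]; then [N (1 + N) <= 1 + 2 N^2], and Jensen replaces [N^2] by the mollification
    of [v i ^ 2], whose integral does not depend on [eps]. *)
Let Ei i x := tau * (Me' * Mb * (\1_(cube 0 r) x + 2 * smear eps (fun y => v i y ^+ 2) x)).
Let P x := fe x * (eta x * bt (we x)).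

Let smear_v2_ge0 i x : 0 <= smear eps (fun y => v i y ^+ 2) x.
Proof.
have := smear_normr eps0 x (v2i i).
under [in X in _ <= X -> _]eq_fun do rewrite ger0_norm ?sqr_ge0//.
exact: le_trans.
Qed.

(** The right-hand side equals [(V - gam W) (deta bt + eta dbt W) + gam eta dbt W^2], with [bt] and
    [dbt] taken at [we x]. The last term is nonnegative and the first is the commutator error. *)
Let pointwise i x : K x -> - Ei i x <=
  I1 i x - I2 i x - (DV i x * (eta x * bt (we x)) - h i x * B (we x)).
Proof.
move=> Kx; have [Ox _] := K_Om Kx; have [B1 B2 B3] := bMe x.
set N := smear eps (fun y => `|v i y|) x.
have WN : `|W i x| <= N by rewrite WE//; exact: smear_normr.
have N2 : N ^+ 2 <= smear eps (fun y => v i y ^+ 2) x.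
  have ni := integrable_normr (vi i).
  have e2 : (fun y => `|v i y| ^+ 2) = (fun y => v i y ^+ 2).
    by apply/funext => y; rewrite real_normK// num_real.
  have := @smear_sqr_le R n eps eps0 _ x ni; rewrite e2; exact.
have dV : `|V i x - gam x * W i x| <= tau * N.
  rewrite WE// -smearB//; apply: smear_normr_le => //; first exact: ltW.
    have := integrableB measurableT (gvi i) (integrableZl measurableT (gam x) (vi i)).
    by apply: eq_integrable.
  move=> y xy; rewrite -mulrBl normrM ler_wpM2r// distrC; apply: gameps => //.
  by have [] := K_cube Kx (cube_eps xy).
have e1 : `|eta x| <= Me'.
  by have /andP[h1 h2] := etaM Ox; rewrite ger0_norm// (le_trans h2).
have e2 : `|deta i x| <= Me' by apply: le_trans (detaM i Ox) _.
have e3 : `|deta i x * bt (we x) + eta x * (dbt (we x) * W i x)| <= Me' * Mb * (1 + N).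
  apply: le_trans (ler_normD _ _) _; rewrite mulrDr mulr1; apply: lerD.
    exact: normr_mul_le.
  by rewrite -mulrA; do 2!apply: normr_mul_le => //.
have e4 := normr_mul_le dV e3.
rewrite (_ : _ - _ - _ = (V i x - gam x * W i x) *
  (deta i x * bt (we x) + eta x * (dbt (we x) * W i x)) +
  gam x * eta x * dbt (we x) * W i x ^+ 2); last by rewrite /I1 /I2; ring.
rewrite -[leLHS]addr0; apply: lerD; last first.
  have /andP[h1 h2] := etaM Ox.
  apply: mulr_ge0; last exact: sqr_ge0.
  by do ?apply: mulr_ge0 => //; exact: gam0.
move: e4; rewrite ler_norml => /andP[+ _]; apply: le_trans; rewrite lerN2.
rewrite /Ei indicE mem_set; last exact: Om_cube.
rewrite -mulrA ler_wpM2l//; first exact: ltW.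
rewrite mulrCA ler_wpM2l//; first exact: mulr_ge0.
apply: (@le_trans _ _ (1 + 2 * N ^+ 2)); last by rewrite lerD2l ler_wpM2l.
by have := sqr_ge0 (N - 1); rewrite sqrrB1; nra.
Qed.

Let mHs : measurable_fun setT Hs. Proof. exact: measurable_sum. Qed.

Let HsM x : Om x -> `|Hs x| <= \sum_(i < n) Me'.
Proof.
move=> Ox; apply: le_trans (ler_norm_sum _ _ _) _; apply: ler_sum => i _.
exact: le_trans (hM i Ox) _.
Qed.

Let integrable_on_K (F : 'rV[R]_n -> R) M : measurable_fun setT F ->
  (forall x, K x -> `|F x| <= M) -> (forall x, ~ K x -> F x = 0) -> 0 <= M ->
  L1 setT F.
Proof.
move=> mF FM F0 M0; apply: (@integrable_compact_support _ _ F M r) => //.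
  by move=> x; have [/FM//|/F0->] := pselect (K x); rewrite normr0.
by move=> x /notK_cube/F0.
Qed.

Let sM : 0 <= \sum_(i < n) Me'. Proof. exact: sumr_ge0. Qed.

Let HB_int : L1 setT (fun x => Hs x * B (we x)).
Proof.
apply: (@integrable_on_K _ ((\sum_(i < n) Me') * Mb)).
- by apply: measurable_funM => //; exact: measurableT_comp.
- move=> x /K_Om[Ox _]; apply: normr_mul_le; first exact: HsM.
  by have [] := bMe x.
- by move=> x /b_notK[-> _ _]; rewrite mulr0.
- exact: mulr_ge0.
Qed.

Let Psi x := eta x * bt (we x).

Let mPsi : measurable_fun setT Psi.
Proof. by apply: measurable_funM => //; exact: measurableT_comp. Qed.

Let PsiM x : `|Psi x| <= Me' * Mb.
Proof.
have [Kx|/b_notK[_ h0 _]] := pselect (K x); last first.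
  by rewrite /Psi h0 mulr0 normr0 mulr_ge0.
have [Ox _] := K_Om Kx; apply: normr_mul_le; last by have [] := bMe x.
by have /andP[h1 h2] := etaM Ox; rewrite ger0_norm// (le_trans h2).
Qed.

Let Psi_int : L1 setT Psi.
Proof.
apply: (@integrable_on_K _ (Me' * Mb)) => //; last exact: mulr_ge0.
by move=> x /b_notK[_ h0 _]; rewrite /Psi h0 mulr0.
Qed.

Let P_int : L1 setT P.
Proof.
have := integrable_bounded_mul (integrable_smear eps f0i) mPsi PsiM.
by apply: eq_integrable => // x _; rewrite /= mulrC.
Qed.

Let Ei_spec i : L1 setT (Ei i) /\
  \int[mu]_x Ei i x = tau * C1 i.
Proof.
have si := integrable_smear eps (v2i i).
have h1 : L1 setT (fun x => \1_(cube 0 r) x : R).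
  have := @integrable_indic_mul _ _ _ mu (cube 0 r) 1 (measurable_cube _ _)
    (lebesgue_rV_cube_lty _ _).
  by apply: eq_integrable => // x _; rewrite /= mul1r.
have h2 : L1 setT (fun x => 2 * smear eps (fun y => v i y ^+ 2) x).
  exact: integrable_scale.
have h3 : L1 setT (fun x => \1_(cube 0 r) x + 2 * smear eps (fun y => v i y ^+ 2) x).
  exact: integrable_add.
have h4 : L1 setT (fun x => Me' * Mb *
    (\1_(cube 0 r) x + 2 * smear eps (fun y => v i y ^+ 2) x)).
  exact: integrable_scale.
split; first exact: integrable_scale.
rewrite /Ei RintegralZl// RintegralZl// RintegralD// RintegralZl//.
rewrite integral_smear// /C1; congr (_ * (_ * (_ + _))).
rewrite /Rintegral integral_indic ?setIT//; exact: measurable_cube.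
Qed.

(** The functions [I1 i] and [I2 i] are partial derivatives of compactly supported functions, so
    they integrate to 0. Summing [pointwise] over [i] leaves the divergence of [V], which [DVE]
    identifies with [- fe] on [K]; off [K] every term except the error is 0. *)
Lemma smeared_inequality :
  - (\int[mu]_x (Hs x * B (we x))) <= \int[mu]_x P x + tau * \sum_i C1 i.
Proof.
pose S x := \sum_i (I1 i x - I2 i x); pose E x := \sum_i Ei i x.
have Idi i : L1 setT (fun x => I1 i x - I2 i x).
  exact: integrable_sub (I1_spec i).1 (I2_spec i).1.
have Si : L1 setT S by exact: integrable_sum_seq.
have S0 : \int[mu]_x S x = 0.
  rewrite /S Rintegral_sum// big1// => i _.
  by rewrite RintegralB// ?(I1_spec i).2 ?(I2_spec i).2 ?subrr//;
    [exact: (I1_spec i).1|exact: (I2_spec i).1].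
have Eint : L1 setT E.
  by apply: integrable_sum_seq => i; exact: (Ei_spec i).1.
have EE : \int[mu]_x E x = tau * \sum_i C1 i.
  rewrite /E Rintegral_sum; last by move=> i; exact: (Ei_spec i).1.
  by rewrite mulr_sumr; apply: eq_bigr => i _; exact: (Ei_spec i).2.
have PEi : L1 setT (fun x => P x + E x).
  exact: integrable_add.
have SPEi : L1 setT (fun x => S x + (P x + E x)).
  exact: integrable_add.
rewrite -EE -RintegralD// -[leRHS]add0r -S0 -RintegralD// -mulN1r -RintegralZl//.
apply: le_Rintegral => //.
  exact: integrable_scale.
move=> x _; rewrite mulN1r.
have E0 i : 0 <= Ei i x.
  by do ?[apply: addr_ge0 => //|apply: mulr_ge0 => //]; exact: ltW.
have [Kx|Kx] := pselect (K x); last first.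
  have [h0 h1 h2] := b_notK Kx.
  rewrite /S /P /I1 /I2 h0 h1 h2 !(mulr0, oppr0, add0r).
  rewrite big1; last by move=> i _; rewrite !(mulr0, mul0r, addr0, subrr).
  by rewrite add0r sumr_ge0.
have Sum : \sum_i - Ei i x <= \sum_i
    (I1 i x - I2 i x - (DV i x * (eta x * bt (we x)) - h i x * B (we x))).
  by apply: ler_sum => i _; exact: pointwise.
move: Sum; rewrite sumrN !sumrB -!mulr_suml DVE// -/(S x) -/(E x) -/(Hs x).
rewrite -sumrB -/(S x) /P; lra.
Qed.

Let wM' x : w x <= Mw. Proof. exact: le_trans (ler_norm _) (wM x). Qed.

Let w_notK x : ~ K x -> w x <= delta.
Proof.
move=> /negP; rewrite -ltNge => Kx.
have : w x <= wp x by rewrite /wp le_max lexx.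
by move: delta0 Kx; lra.
Qed.

(** On the left [we] is replaced by [w] thanks to the Lipschitz bound on [B]. On the right [f0] is
    only integrable, so its mollification is first transferred to the bounded factor [Psi], which is
    uniformly close to [Q] on [Om]. *)
Lemma smeared_limit :
  - (\int[mu]_x (Hs x * B (w x))) <= \int[mu]_x (f0 x * (eta x * bt (w x))) +
  tau * (\sum_i C1 i + (\sum_(i < n) Me') * Mb * fine (mu (cube 0 r)) +
    (Mb * (Me' * 2 + 1)) * \int[mu]_x `|f0 x|).
Proof.
pose Q x := eta x * bt (w x).
have mQ : measurable_fun setT Q.
  by apply: measurable_funM => //; exact: measurableT_comp.
have bQ x : `|bt (w x)| <= Mb by have [] := bM (wM' x).
have QM x : `|Q x| <= Me' * Mb.
  have [Kx|/w_notK/b0[_ h0 _]] := pselect (K x); last first.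
    by rewrite /Q h0 mulr0 normr0 mulr_ge0.
  have [Ox _] := K_Om Kx; apply: normr_mul_le => //.
  by have /andP[h1 h2] := etaM Ox; rewrite ger0_norm// (le_trans h2).
have Bdiff x : `|Hs x * B (we x) - Hs x * B (w x)| <=
    tau * ((\sum_(i < n) Me') * Mb * \1_(cube 0 r) x).
  have [Kx|Kx] := pselect (K x); last first.
    have [-> _ _] := b_notK Kx; have [-> _ _] := b0 (w_notK Kx).
    by rewrite !mulr0 subrr normr0 !mulr_ge0// ltW.
  have [Ox _] := K_Om Kx; rewrite -mulrBr normrM.
  rewrite indicE mem_set; last exact: Om_cube.
  rewrite mulr1 [leRHS]mulrC -mulrA; apply: ler_pM => //; first exact: HsM.
  have [+ _] := bL (we_le x) (wM' x); move/le_trans; apply.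
  by rewrite ler_wpM2l// smear_near_w.
have HBw_int : L1 setT (fun x => Hs x * B (w x)).
  apply: (@integrable_on_K _ ((\sum_(i < n) Me') * Mb)).
  - by apply: measurable_funM => //; exact: measurableT_comp.
  - move=> x /K_Om[Ox _]; apply: normr_mul_le; first exact: HsM.
    by have [] := bM (wM' x).
  - by move=> x /w_notK/b0[-> _ _]; rewrite mulr0.
  - exact: mulr_ge0.
have step1 : \int[mu]_x (Hs x * B (we x)) <= \int[mu]_x (Hs x * B (w x)) +
    tau * ((\sum_(i < n) Me') * Mb * fine (mu (cube 0 r))).
  have i1 := @integrable_indic_mul _ _ _ mu (cube 0 r)
    (tau * ((\sum_(i < n) Me') * Mb)) (measurable_cube _ _) (lebesgue_rV_cube_lty _ _).
  have -> : tau * ((\sum_(i < n) Me') * Mb * fine (mu (cube 0 r))) =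
      \int[mu]_x (tau * ((\sum_(i < n) Me') * Mb) * \1_(cube 0 r) x).
    rewrite RintegralZl//; last first.
      have := @integrable_indic_mul _ _ _ mu (cube 0 r) 1 (measurable_cube _ _)
        (lebesgue_rV_cube_lty _ _).
      by apply: eq_integrable => // x _; rewrite /= mul1r.
    rewrite mulrA; congr (_ * _).
    rewrite /Rintegral integral_indic ?setIT//; exact: measurable_cube.
  rewrite -RintegralD//; apply: le_Rintegral => //.
    exact: integrable_add.
  move=> x _; have := Bdiff x; rewrite ler_distl => /andP[_].
  by rewrite [X in _ <= _ + X -> _]mulrA.
have Pdiff y : Om y -> `|smear eps Psi y - Q y| <= tau * (Mb * (Me' * 2 + 1)).
  move=> Oy; apply: smear_near => // x yx.
  have xy : cube x eps y by move=> i; rewrite distrC; exact: yx.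
  have wxy : `|wp x - wp y| <= tau by apply: weps; exact: cube_eps.
  (* Since [bt] vanishes below [delta > 0], the negative part of [w], for which no modulus of
     continuity is available, is invisible to it. *)
  have btwp z : bt (w z) = bt (wp z).
    rewrite /wp; have [//|w0'] := leP 0 (w z).
    have [_ -> _] : [/\ B (w z) = 0, bt (w z) = 0 & dbt (w z) = 0].
      by apply: b0; rewrite (le_trans (ltW w0'))// ltW.
    by have [_ -> _] := b0 (ltW delta0).
  have wpM z : wp z <= Mw by rewrite /wp ge_max wM'.
  have [Kx|Kx] := pselect (K x); last first.
    have [_ h0 _] := b_notK Kx; rewrite /Psi /Q h0 btwp.
    have [_ -> _] : [/\ B (wp y) = 0, bt (wp y) = 0 & dbt (wp y) = 0].
      apply: b0; move/negP : Kx; rewrite -ltNge => Kx.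
      by move: wxy; rewrite ler_distl => /andP[]; move: delta0 tau_delta Kx; lra.
    by rewrite !mulr0 subrr normr0 !mulr_ge0 ?addr_ge0 ?mulr_ge0// ltW.
  have [Ox wpx] := K_Om Kx.
  rewrite /Psi /Q btwp.
  rewrite (_ : _ - _ = eta x * (bt (we x) - bt (wp y)) +
    (eta x - eta y) * bt (wp y)); last by ring.
  apply: le_trans (ler_normD _ _) _.
  (* The two [tau] in the first term are the distances from [we x] to [w x] and from [wp x] to
     [wp y]; the last term is the oscillation of [eta]. *)
  rewrite (_ : tau * _ = Me' * (Mb * (tau + tau)) + tau * Mb); last by ring.
  apply: lerD; last first.
    by apply: normr_mul_le; [exact: etaeps|have [] := bM (wpM y)].
  apply: normr_mul_le.
    by have /andP[h1 h2] := etaM Ox; rewrite ger0_norm// (le_trans h2).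
  have [_ +] := bL (we_le x) (wpM y); move/le_trans; apply.
  rewrite ler_wpM2l// (_ : _ - _ = (we x - w x) + (wp x - wp y)); last first.
    by rewrite wpx; ring.
  apply: le_trans (ler_normD _ _) _; apply: lerD => //; exact: smear_near_w.
have f0Q : L1 setT (fun x => f0 x * Q x).
  have := integrable_bounded_mul f0i mQ QM.
  by apply: eq_integrable => // x _; rewrite /= mulrC.
have msP : measurable_fun setT (smear eps Psi) by exact: measurable_smear.
have [N hN] := @smear_bounded R n eps eps0 _ Psi_int.
have f0s : L1 setT (fun x => f0 x * smear eps Psi x).
  have := integrable_bounded_mul f0i msP (fun x => (hN x).1).
  by apply: eq_integrable => // x _; rewrite /= mulrC.
have step2 : \int[mu]_x P x <= \int[mu]_x (f0 x * Q x) +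
    tau * (Mb * (Me' * 2 + 1)) * \int[mu]_x `|f0 x|.
  rewrite /P (smear_swap eps f0i mPsi PsiM Psi_int).
  have i2 : L1 setT (fun x => tau * (Mb * (Me' * 2 + 1)) * `|f0 x|).
    have := integrableZl measurableT (tau * (Mb * (Me' * 2 + 1))) (integrable_normr f0i).
    by apply: eq_integrable.
  rewrite -RintegralZl//; last exact: integrable_normr.
  rewrite -RintegralD//; apply: le_Rintegral => //.
    exact: integrable_add.
  move=> x _; rewrite -lerBlDl -mulrBr; apply: le_trans (ler_norm _) _.
  rewrite normrM mulrC; have [Ox|/f00->] := pselect (Om x).
    by rewrite ler_wpM2r// Pdiff.
  by rewrite normr0 !mulr0.
have := smeared_inequality; move: step1 step2; rewrite -/Q; lra.
Qed.

End fixed_scale.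

(** Formally, test with [eta * bt w] and use [bt w * grad w = grad (B w)]. This produces the
    nonnegative integral of [gam * eta * dbt w * |grad w|^2] and that of
    [gam * grad eta . grad (B w)], in which the gradient of [B w] is integrated by parts. The
    mollified version has an error [tau * C] with [C] independent of the scale, and [tau] tends to
    0. *)
Lemma weak_inequality :
  - (\int[mu]_x ((\sum_i h i x) * B (w x))) <=
  \int[mu]_x (f0 x * (eta x * bt (w x))).
Proof.
set L := leLHS; set Rr := leRHS.
pose Me' := Num.max Me 0.
pose C := \sum_i Me' * Mb * (fine (mu (cube 0 r)) + 2 * \int[mu]_x v i x ^+ 2)
  + (\sum_(i < n) Me') * Mb * fine (mu (cube 0 r)) +
    (Mb * (Me' * 2 + 1)) * \int[mu]_x `|f0 x|.
have main tau : 0 < tau -> tau <= delta / 4 -> L <= Rr + tau * C.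
  move=> tau0 tauD.
  have [e1 e10 h1] := ucw tau0; have [e2 e20 h2] := ucgam tau0.
  have [e3 e30 h3] := uceta tau0.
  pose eps := Num.min e1 (Num.min e2 e3) / 2.
  have m0 : 0 < Num.min e1 (Num.min e2 e3) by rewrite !lt_min e10 e20.
  have eps0 : 0 < eps by rewrite divr_gt0.
  have epsm : eps < Num.min e1 (Num.min e2 e3).
    by rewrite ltr_pdivrMr// ltr_pMr// ltr1n.
  have [l1 l2 l3] : [/\ eps < e1, eps < e2 & eps < e3].
    by move: epsm; rewrite !lt_min => /and3P[].
  apply: (@smeared_limit eps tau) => //.
  - by move=> x y xy; apply: h1 => // i; exact: le_lt_trans (xy i) l1.
  - by move=> x y Ox Oy xy; apply: h2 => // i; exact: lt_trans (xy i) l2.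
  - by move=> x y Ox Oy xy; apply: h3 => // i; exact: lt_trans (xy i) l3.
apply/ler_addgt0Pr => e e0.
have [C0|C0] := leP C 0.
  have := main (delta / 4); rewrite divr_gt0// lexx => /(_ isT isT).
  move/le_trans; apply; rewrite lerD2l (le_trans _ (ltW e0))//.
  by rewrite mulr_ge0_le0// ltW// divr_gt0.
have t0 : 0 < Num.min (delta / 4) (e / C) by rewrite lt_min !divr_gt0.
have := main _ t0; rewrite ge_min lexx => /(_ isT)/le_trans; apply.
rewrite lerD2l -ler_pdivlMr// ge_min lexx orbT//.
Qed.

End weak_inequality.

(** * The space L^p of a bounded domain *)

Section Lp.
Context {R : realType} (n : nat) (p : R) (Om : set 'rV[R]_n).
Hypotheses (p2 : 2 < p) (mOm : measurable Om).
Local Notation mu := (@lebesgue_rV R n).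
Local Notation L1 D f := (mu.-integrable D (EFin \o f)).
Hypothesis fOm : (mu Om < +oo)%E.
Implicit Types (f g h : 'rV[R]_n -> R).

Let p0 : 0 < p. Proof. exact: lt_trans p2. Qed.
Let pn0 : p != 0. Proof. by rewrite gt_eqF. Qed.

Lemma Lp_normE f : Lp_norm p Om f =
  ((\int[mu]_(x in Om) (`|f x| `^ p)%:E) `^ p^-1)%E.
Proof.
rewrite /Lp_norm unlock /= [in RHS]integral_mkcond; congr (_ `^ _)%E.
have h0 : (`|0 : R| `^ p)%:E = 0%E by rewrite normr0 powR0.
by apply: eq_integral => x _; rewrite /patch/=; case: ifP.
Qed.

Lemma measurable_normr_powR f : measurable_fun Om f ->
  measurable_fun Om (fun x => `|f x| `^ p).
Proof.
move=> mf; apply: (@measurableT_comp _ _ _ _ _ _ (fun t : R => t `^ p)).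
  exact: measurable_powR.
exact: measurableT_comp.
Qed.

Lemma Lp_norm_le f g M : 0 <= M -> measurable_fun Om f -> measurable_fun Om g ->
  {ae mu, forall x, Om x -> `|f x| <= M * `|g x|} ->
  (Lp_norm p Om f <= M%:E * Lp_norm p Om g)%E.
Proof.
move=> M0 mf mg fg; rewrite !Lp_normE.
have I0 h : (0 <= \int[mu]_(x in Om) (`|h x| `^ p)%:E)%E.
  by apply: integral_ge0 => x _; rewrite lee_fin powR_ge0.
have -> : M%:E = ((M `^ p)%:E `^ p^-1)%E.
  by rewrite poweR_EFin -powRrM mulfV// powRr1.
rewrite -poweRM ?lee_fin ?powR_ge0//.
apply: gt0_ler_poweR; rewrite ?invr_ge0 ?(ltW p0) ?in_itv/= ?leey ?andbT//.
  by rewrite mule_ge0// lee_fin powR_ge0.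
rewrite -ge0_integralZl//; last 2 first.
- by apply/measurable_EFinP; exact: measurable_normr_powR.
- by rewrite lee_fin powR_ge0.
apply: ae_ge0_le_integral => //.
- by apply/measurable_EFinP; exact: measurable_normr_powR.
- by move=> x _; rewrite mule_ge0// lee_fin powR_ge0.
- apply/measurable_EFinP; apply: measurable_funM => //.
  exact: measurable_normr_powR.
apply: filterS fg => x fgx Ox; rewrite -EFinM lee_fin -powRM//.
by rewrite ge0_ler_powR ?nnegrE ?mulr_ge0 ?fgx// ltW.
Qed.

Lemma Lp_normD f g : measurable_fun Om f -> measurable_fun Om g ->
  (Lp_norm p Om (fun x => f x + g x)%R <= Lp_norm p Om f + Lp_norm p Om g)%E.
Proof.
move=> mf mg; rewrite /Lp_norm.
have mr h : measurable_fun Om h -> measurable_fun setT (h \_ Om).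
  by move=> mh; apply/(measurable_restrictT _ _).1.
have -> : (fun x => f x + g x)%R \_ Om = ((f \_ Om) \+ (g \_ Om))%R.
  apply/funext => x; rewrite /= /patch; case: ifP => _ //.
  by rewrite addr0.
have p1 : (1 <= p%:E)%E by rewrite lee_fin ltW// (lt_trans _ p2)// ltr1n.
exact (eminkowski mu (mr _ mf) (mr _ mg) p1).
Qed.

Lemma in_Lp_measurable f : in_Lp p Om f -> measurable_fun Om f.
Proof. by case. Qed.

Lemma integrable_cst_fin (c : R) : L1 Om (fun _ => c).
Proof.
apply: measurable_bounded_integrable => //.
by exists `|c|; split=> [|N cN x _ /=]; [exact: num_real|exact: ltW].
Qed.

(** A real number, so that linear arithmetic applies. An infinite norm would become 0, which is why
    membership in [L^p] is carried along. *)
Definition Lp_nr f := fine (Lp_norm p Om f).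

Lemma Lp_nrE f : in_Lp p Om f -> (Lp_nr f)%:E = Lp_norm p Om f.
Proof. by move=> [_ fy]; rewrite fineK// ge0_fin_numE// Lnorm_ge0. Qed.

Lemma Lp_nr_ge0 f : 0 <= Lp_nr f.
Proof. by rewrite fine_ge0// Lnorm_ge0. Qed.

Lemma in_Lp_ae_le f g M : 0 <= M -> measurable_fun Om f -> in_Lp p Om g ->
  {ae mu, forall x, Om x -> `|f x| <= M * `|g x|} ->
  in_Lp p Om f /\ Lp_nr f <= M * Lp_nr g.
Proof.
move=> M0 mf gp fg; have le := Lp_norm_le M0 mf (in_Lp_measurable gp) fg.
have fp : in_Lp p Om f.
  by split=> //; apply: le_lt_trans le _; rewrite -Lp_nrE// -EFinM ltry.
by split=> //; rewrite -lee_fin EFinM !Lp_nrE.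
Qed.

Lemma in_Lp_le f g M : 0 <= M -> measurable_fun Om f -> in_Lp p Om g ->
  (forall x, Om x -> `|f x| <= M * `|g x|) ->
  in_Lp p Om f /\ Lp_nr f <= M * Lp_nr g.
Proof. by move=> M0 mf gp fg; apply: in_Lp_ae_le => //; apply: aeW. Qed.

Lemma in_LpD f g : in_Lp p Om f -> in_Lp p Om g ->
  in_Lp p Om (fun x => f x + g x).
Proof.
move=> fp gp; split; first exact: measurable_funD fp.1 gp.1.
apply: le_lt_trans (Lp_normD fp.1 gp.1) _.
by rewrite -!Lp_nrE// -EFinD ltry.
Qed.

Lemma Lp_nrD f g : in_Lp p Om f -> in_Lp p Om g ->
  Lp_nr (fun x => f x + g x) <= Lp_nr f + Lp_nr g.
Proof.
move=> fp gp; rewrite -lee_fin EFinD !Lp_nrE//; last exact: in_LpD.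
by apply: Lp_normD; [exact: fp.1|exact: gp.1].
Qed.

Lemma in_LpZ c f : in_Lp p Om f ->
  in_Lp p Om (fun x => c * f x) /\ Lp_nr (fun x => c * f x) <= `|c| * Lp_nr f.
Proof.
move=> fp; apply: in_Lp_le => //; first exact: measurable_funM fp.1.
by move=> x _; rewrite normrM.
Qed.

Lemma in_LpB f g : in_Lp p Om f -> in_Lp p Om g ->
  in_Lp p Om (fun x => f x - g x).
Proof.
move=> fp gp; apply: in_LpD => //.
have [h _] := in_LpZ (-1) gp; rewrite (_ : (fun _ => _) = (fun x => -1 * g x))//.
by apply/funext => x; rewrite mulN1r.
Qed.

Lemma in_Lp_lin c f g : in_Lp p Om f -> in_Lp p Om g ->
  in_Lp p Om (fun x => f x + c * g x).
Proof. by move=> fp gp; apply: in_LpD => //; have [] := in_LpZ c gp. Qed.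

Lemma in_Lp_max0 f : in_Lp p Om f -> in_Lp p Om (fun x => Num.max (f x) 0).
Proof.
move=> fp; apply: (in_Lp_le ler01 _ fp _).1; first exact: measurable_maxr fp.1 _.
move=> x _; rewrite mul1r ger0_norm ?le_max ?lexx ?orbT//.
by rewrite ge_max ler_norm normr_ge0.
Qed.

Lemma Lp_nrN f : in_Lp p Om f ->
  in_Lp p Om (fun x => - f x) /\ Lp_nr (fun x => - f x) <= Lp_nr f.
Proof.
move=> fp; rewrite -[X in _ <= X]mul1r; apply: in_Lp_le => //.
  exact: measurableT_comp fp.1.
by move=> x _; rewrite normrN mul1r.
Qed.

Lemma in_Lp_cst c : in_Lp p Om (cst c).
Proof.
split=> //; rewrite Lp_normE poweR_lty//.
rewrite [X in (X < _)%E](integral_cst _ mOm (`|c| `^ p)%:E).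
by rewrite lte_mul_pinfty// lee_fin powR_ge0.
Qed.

Lemma in_Lp_integrable_powR f : in_Lp p Om f ->
  L1 Om (fun x => `|f x| `^ p).
Proof.
move=> [mf fy]; apply/integrableP; split.
  by apply/measurable_EFinP; exact: measurable_normr_powR.
under eq_integral => x _ do rewrite /= ger0_norm ?powR_ge0//.
rewrite Lp_normE in fy.
rewrite ltey; apply/eqP => h; move: fy; rewrite h.
by rewrite poweRyr ?ltxx// invr_neq0.
Qed.

Lemma Lp_nr_powR f : in_Lp p Om f ->
  \int[mu]_(x in Om) (`|f x| `^ p) = Lp_nr f `^ p.
Proof.
move=> fp; apply: EFin_inj; rewrite -poweR_EFin Lp_nrE// Lp_normE.
rewrite -poweRrM mulVf// poweRe1; last first.
  by apply: integral_ge0 => x _; rewrite lee_fin powR_ge0.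
by rewrite /Rintegral fineK// integrable_fin_num//; exact: in_Lp_integrable_powR.
Qed.

Lemma Lp_nr_eq0 f : in_Lp p Om f -> Lp_nr f = 0 ->
  {ae mu, forall x, Om x -> f x = 0}.
Proof.
move=> fp f0; have Nf0 : Lp_norm p Om f = 0%E by rewrite -Lp_nrE// f0.
have mf : measurable_fun setT (EFin \o (f \_ Om)).
  by apply/measurable_EFinP; apply/(measurable_restrictT _ _).1 => //; exact: fp.1.
have p0' : (0 < p%:E)%E by rewrite lte_fin.
have := Lnorm_eq0_eq0 mf p0' Nf0; apply: filterS => x h Ox.
by have [] := h I; rewrite patchT ?inE.
Qed.

(* As [2 < p], this replaces Young's inequality without conjugate exponents. *)
Lemma mul_le_powR (x y : R) : 0 <= x -> 0 <= y -> x * y <= 2 + x `^ p + y `^ p.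
Proof.
have sq (t : R) : 0 <= t -> t ^+ 2 <= 1 + t `^ p.
  move=> t0; have [t1|t1] := leP t 1.
    by rewrite -[leLHS]addr0 lerD ?powR_ge0// expr_le1.
  rewrite -powR_mulrn// -[leLHS]add0r lerD// ler_powR//; exact: ltW.
move=> x0 y0; have h1 := sq x x0; have h2 := sq y y0.
by have := sqr_ge0 (x - y); nra.
Qed.

(** Apply [mul_le_powR] to [|f| / a] and [|g| / b] and integrate: the constant 2 contributes
    [2 mu(Om)] and each power at most 1. Positive bounds [a] and [b] stand in for the norms, which
    may vanish. *)
Lemma L1_mul f g (a b : R) : 0 < a -> 0 < b -> in_Lp p Om f -> in_Lp p Om g ->
  Lp_nr f <= a -> Lp_nr g <= b ->
  L1 Om (fun x => f x * g x) /\
  \int[mu]_(x in Om) `|f x * g x| <= (2 * fine (mu Om) + 2) * (a * b).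
Proof.
move=> a0 b0 fp gp fa gb.
pose D x := 2 + (a `^ p)^-1 * (`|f x| `^ p) + (b `^ p)^-1 * (`|g x| `^ p).
have If := in_Lp_integrable_powR fp; have Ig := in_Lp_integrable_powR gp.
have I1 : L1 Om (fun x => (a `^ p)^-1 * (`|f x| `^ p)).
  exact: integrable_scale.
have I2 : L1 Om (fun x => (b `^ p)^-1 * (`|g x| `^ p)).
  exact: integrable_scale.
have I0 : L1 Om (fun _ => 2 : R).
  exact: integrable_cst_fin.
have I01 : L1 Om (fun x => 2 + (a `^ p)^-1 * (`|f x| `^ p)).
  exact: integrable_add.
have ID : L1 Om D.
  exact: integrable_add.
have key x : `|f x * g x| <= a * b * D x.
  have fa' : 0 <= `|f x| / a by rewrite divr_ge0// ltW.
  have gb' : 0 <= `|g x| / b by rewrite divr_ge0// ltW.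
  have := mul_le_powR fa' gb'.
  have powV (c : R) : 0 < c -> c^-1 `^ p = (c `^ p)^-1.
    by move=> c0; rewrite -powR_inv1 ?ltW// powRAC powR_inv1 ?powR_ge0.
  rewrite !powRM ?invr_ge0 ?(ltW a0) ?(ltW b0)// !powV// => h.
  have e : `|f x * g x| = a * b * (`|f x| / a * (`|g x| / b)).
    by rewrite normrM; field; rewrite !gt_eqF.
  rewrite e ler_wpM2l ?mulr_ge0 ?(ltW a0) ?(ltW b0)//.
  by rewrite /D [(a `^ p)^-1 * _]mulrC [(b `^ p)^-1 * _]mulrC.
have IabD : L1 Om (fun x => a * b * D x).
  exact: integrable_scale.
have mfg : measurable_fun Om (fun x => f x * g x).
  by apply: measurable_funM; [exact: fp.1|exact: gp.1].
have Ifg : L1 Om (fun x => f x * g x).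
  apply: le_integrable IabD => //; first exact/measurable_EFinP.
  by move=> x _; rewrite /= lee_fin (le_trans (key x))// ler_norm.
split=> //.
have Ifg' : L1 Om (fun x => `|f x * g x|).
  by have := integrable_norm Ifg; apply: eq_integrable.
apply: (@le_trans _ _ (\int[mu]_(x in Om) (a * b * D x))).
  exact: le_Rintegral.
rewrite RintegralZl// [leRHS]mulrC ler_wpM2l ?mulr_ge0 ?(ltW a0) ?(ltW b0)//.
rewrite /D RintegralD// RintegralD// !RintegralZl// Rintegral_cst//.
rewrite !Lp_nr_powR//.
have le1 (c h : R) : 0 < c -> 0 <= h -> h <= c -> (c `^ p)^-1 * h `^ p <= 1.
  move=> c0 h0 hc; rewrite mulrC ler_pdivrMr ?powR_gt0// mul1r.
  by rewrite ge0_ler_powR ?nnegrE ?(ltW c0) ?(ltW p0).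
have := le1 _ _ a0 (Lp_nr_ge0 f) fa; have := le1 _ _ b0 (Lp_nr_ge0 g) gb; lra.
Qed.

Lemma in_Lp_integrable f : in_Lp p Om f -> L1 Om f.
Proof.
move=> fp; have a0 : 0 < Lp_nr f + 1 by rewrite ltr_wpDl// Lp_nr_ge0.
have b0 : 0 < Lp_nr (cst 1) + 1 by rewrite ltr_wpDl// Lp_nr_ge0.
have a1 : Lp_nr f <= Lp_nr f + 1 by rewrite lerDl.
have b1 : Lp_nr (cst 1) <= Lp_nr (cst 1) + 1 by rewrite lerDl.
have [+ _] := L1_mul a0 b0 fp (in_Lp_cst 1) a1 b1.
by apply: eq_integrable => // x _; rewrite /= mulr1.
Qed.

Lemma in_Lp_integrable_sqr f : in_Lp p Om f ->
  L1 Om (fun x => f x ^+ 2).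
Proof.
move=> fp; have a0 : 0 < Lp_nr f + 1 by rewrite ltr_wpDl// Lp_nr_ge0.
have a1 : Lp_nr f <= Lp_nr f + 1 by rewrite lerDl.
by have [] := L1_mul a0 a0 fp fp a1 a1.
Qed.

Definition L1_const : R := (2 * fine (mu Om) + 2) * (Lp_nr (cst 1) + 1).

Lemma L1_le f a : 0 < a -> in_Lp p Om f -> Lp_nr f <= a ->
  \int[mu]_(x in Om) `|f x| <= L1_const * a.
Proof.
move=> a0 fp fa; have b0 : 0 < Lp_nr (cst 1) + 1 by rewrite ltr_wpDl// Lp_nr_ge0.
have b1 : Lp_nr (cst 1) <= Lp_nr (cst 1) + 1 by rewrite lerDl.
have [_] := L1_mul a0 b0 fp (in_Lp_cst 1) fa b1.
under eq_Rintegral do rewrite mulr1.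
by rewrite /L1_const; move/le_trans; apply; rewrite -mulrA [a * _]mulrC.
Qed.

Lemma ae_le_Rintegral g h :
  L1 Om g -> L1 Om h ->
  {ae mu, forall x, Om x -> g x <= h x} ->
  \int[mu]_(x in Om) g x <= \int[mu]_(x in Om) h x.
Proof.
move=> gi hi gh; rewrite -subr_ge0 -RintegralB//.
have mg : measurable_fun Om g by exact/measurable_EFinP/measurable_int/gi.
have mh : measurable_fun Om h by exact/measurable_EFinP/measurable_int/hi.
have mhg : measurable_fun Om (fun x => h x - g x) by exact: measurable_funB.
have -> : \int[mu]_(x in Om) (h x - g x) = \int[mu]_(x in Om) `|h x - g x|.
  congr fine; apply: ae_eq_integral => //.
  - exact/measurable_EFinP.
  - by apply/measurable_EFinP; exact: measurableT_comp.
  by apply: filterS gh => x h1 Ox; rewrite /= ger0_norm// subr_ge0 h1.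
by apply: Rintegral_ge0 => x _; exact: normr_ge0.
Qed.

End Lp.

(** * Differentiation in L^p *)

Section Lp_derivative.
Context {R : realType} (n : nat) (p : R) (Om : set 'rV[R]_n).
Hypotheses (p2 : 2 < p) (mOm : measurable Om).
Local Notation mu := (@lebesgue_rV R n).
Local Notation L1 D f := (mu.-integrable D (EFin \o f)).
Hypothesis fOm : (mu Om < +oo)%E.
Implicit Types (f g h w v q : 'rV[R]_n -> R) (u : R -> 'rV[R]_n -> R).
Local Notation N := (Lp_nr p Om).

Lemma in_Lp_ae_leD f g h (a b : R) : 0 <= a -> 0 <= b -> measurable_fun Om h ->
  in_Lp p Om f -> in_Lp p Om g ->
  {ae mu, forall x, Om x -> `|h x| <= a * `|f x| + b * `|g x|} ->
  in_Lp p Om h /\ N h <= a * N f + b * N g.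
Proof.
move=> a0 b0 mh fp gp hfg.
have absL k (c : R) : 0 <= c -> in_Lp p Om k ->
    in_Lp p Om (fun x => c * `|k x|) /\ N (fun x => c * `|k x|) <= c * N k.
  move=> c0 kp; apply: in_Lp_le => //.
    apply: measurable_funM => //; apply: measurableT_comp => //; exact: kp.1.
  by move=> x _; rewrite normrM normr_id (ger0_norm c0).
have [fp1 fp2] := absL f a a0 fp; have [gp1 gp2] := absL g b b0 gp.
have hle : {ae mu, forall x, Om x ->
    `|h x| <= 1 * `|a * `|f x| + b * `|g x| | }.
  apply: filterS hfg => x hx Ox; rewrite mul1r.
  exact: le_trans (hx Ox) (ler_norm _).
have [hp] := in_Lp_ae_le p2 mOm ler01 mh (in_LpD p2 mOm fp1 gp1) hle.
rewrite mul1r => hN; split=> //; apply: le_trans hN _.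
by apply: le_trans (Lp_nrD p2 mOm fp1 gp1) _; exact: lerD.
Qed.

(** Keep only the term of order 0, indexed by the empty tuple, where [weak_partial] is [f]
    itself. *)
Lemma Lp_norm_le_Wkp k f : (Lp_norm p Om f <= Wkp_norm p k Om f)%E.
Proof.
have N0 g : (0 <= Lp_norm p Om g)%E by exact: Lnorm_ge0.
have p0 : 0 < p by exact: lt_trans p2.
have pw g : (0 <= Lp_norm p Om g `^ p)%E by exact: poweR_ge0.
have pn0 : p != 0 by rewrite gt_eqF.
have sum0 j : (0 <= \sum_(t : j.-tuple 'I_n) Lp_norm p Om (weak_partial p Om t f) `^ p)%E.
  by apply: sume_ge0 => t _; exact: pw.
rewrite /Wkp_norm -[leLHS](poweRe1 (N0 f)) -(mulfV pn0) poweRrM.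
have S0 : (0 <= \sum_(j < k.+1) \sum_(t : j.-tuple 'I_n)
    Lp_norm p Om (weak_partial p Om t f) `^ p)%E by exact: sume_ge0.
apply: gt0_ler_poweR; rewrite ?invr_ge0 ?(ltW p0) ?in_itv/= ?leey ?andbT ?pw//.
rewrite big_ord_recl -[leLHS]adde0; apply: leeD; last by apply: sume_ge0 => j _; exact: sum0.
rewrite (bigD1 (in_tuple [::]))//= -[leLHS]adde0; apply: leeD; first exact: lexx.
by apply: sume_ge0 => t _; exact: pw.
Qed.

(** Keeping only the [L^p] part of [is_Wkp_derive] avoids the representatives selected by
    [weak_partial], which depend linearly on the function only up to negligible sets. *)
Definition Lp_derive (e : R) u (t : R) v :=
  [/\ forall s, 0 <= s < e -> in_Lp p Om (u s), in_Lp p Om v &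
      forall k, 0 < k -> exists2 r, 0 < r &
        forall s, 0 <= s < e -> s != t -> `|s - t| < r ->
          N (fun x => (u s x - u t x) / (s - t) - v x) <= k].

Lemma Lp_derive_of_Wkp k e u t v : (forall s, 0 <= s < e -> in_Wkp p k Om (u s)) ->
  is_Wkp_derive p k Om `[0, e[ u t v -> 0 <= t < e -> Lp_derive e u t v.
Proof.
move=> uk [[vp _] cv] te; split=> // [s /uk[]//|a a0].
have nb : nbhs (0%E : \bar R) [set y | (y < a%:E)%E].
  apply: open_nbhs_nbhs; split; last by rewrite /= lte_fin.
  exact: open_ereal_lt_ereal.
have := cv _ nb; rewrite /within/= => /nbhs_ballP[r /= r0 hr].
exists r => // s se st sr.
have up s' : 0 <= s' < e -> in_Lp p Om (u s') by move=> /uk[].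
have quot : in_Lp p Om (fun x => (u s x - u t x) / (s - t)).
  have [h _] := in_LpZ p2 mOm (s - t)^-1 (in_LpB p2 mOm (up s se) (up t te)).
  by rewrite (_ : (fun _ => _) = (fun x => (s - t)^-1 * (u s x - u t x)))//;
    apply/funext => x; rewrite mulrC.
rewrite -lee_fin Lp_nrE; last exact: in_LpB.
apply: le_trans (Lp_norm_le_Wkp k _) _; apply: ltW; apply: hr.
  by rewrite /ball/= distrC.
by split; [rewrite /= in_itv|exact/eqP].
Qed.

Lemma Lp_derive_le e e' u t v : e' <= e -> Lp_derive e u t v -> Lp_derive e' u t v.
Proof.
move=> ee; have h s : 0 <= s < e' -> 0 <= s < e.
  by move=> /andP[-> /lt_le_trans]; exact.
move=> [up vp d]; split=> // [s /h/up//|k /d[r r0 hr]].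
by exists r => // s /h; exact: hr.
Qed.

Lemma in_Lp_quot e u t v s : 0 <= t < e -> 0 <= s < e -> Lp_derive e u t v ->
  in_Lp p Om (fun x => (u s x - u t x) / (s - t)) /\
  in_Lp p Om (fun x => (u s x - u t x) / (s - t) - v x).
Proof.
move=> te se [up vp _].
have h : in_Lp p Om (fun x => (u s x - u t x) / (s - t)).
  have [h _] := in_LpZ p2 mOm (s - t)^-1 (in_LpB p2 mOm (up s se) (up t te)).
  by rewrite (_ : (fun _ => _) = (fun x => (s - t)^-1 * (u s x - u t x)))//;
    apply/funext => x; rewrite mulrC.
by split=> //; exact: in_LpB.
Qed.

Lemma Lp_derive_lin (c e : R) u u' t v v' : 0 <= t < e ->
  Lp_derive e u t v -> Lp_derive e u' t v' ->
  Lp_derive e (fun s x => u s x + c * u' s x) t (fun x => v x + c * v' x).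
Proof.
move=> te du du'; have [up vp d] := du; have [up' vp' d'] := du'.
have lin := in_Lp_lin p2 mOm c.
split=> [s se||k k0]; [exact: lin (up s se) (up' s se)|exact: lin|].
have c1 : 0 < 1 + `|c| by rewrite ltr_wpDr.
have [r r0 hr] := d _ (divr_gt0 k0 c1); have [r' r0' hr'] := d' _ (divr_gt0 k0 c1).
exists (Num.min r r'); first by rewrite lt_min r0.
move=> s se st; rewrite lt_min => /andP[sr sr'].
have [_ q1] := in_Lp_quot te se du; have [_ q2] := in_Lp_quot te se du'.
have e1 x : (u s x + c * u' s x - (u t x + c * u' t x)) / (s - t) - (v x + c * v' x) =
    ((u s x - u t x) / (s - t) - v x) + c * ((u' s x - u' t x) / (s - t) - v' x).
  by field; rewrite subr_eq0.
rewrite (_ : (fun x => _) = (fun x => ((u s x - u t x) / (s - t) - v x) +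
  c * ((u' s x - u' t x) / (s - t) - v' x))); last by apply/funext.
have [q3 q3N] := in_LpZ p2 mOm c q2.
apply: le_trans (Lp_nrD p2 mOm q1 q3) _.
rewrite (_ : k = k / (1 + `|c|) + `|c| * (k / (1 + `|c|))); last first.
  by field; rewrite gt_eqF.
apply: lerD; first exact: hr.
by apply: le_trans q3N _; rewrite ler_wpM2l// hr'.
Qed.

Lemma Lp_derive_mul (a : 'rV[R]_n -> R) M e u t v : 0 <= t < e -> measurable_fun Om a ->
  (forall x, Om x -> `|a x| <= M) -> 0 < M -> Lp_derive e u t v ->
  Lp_derive e (fun s x => a x * u s x) t (fun x => a x * v x).
Proof.
move=> te ma aM M0 du; have [up vp d] := du.
have mul g : in_Lp p Om g ->
    in_Lp p Om (fun x => a x * g x) /\ N (fun x => a x * g x) <= M * N g.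
  move=> gp; apply: in_Lp_le => //; first exact: ltW.
    by apply: measurable_funM => //; exact: gp.1.
  by move=> x Ox; rewrite normrM ler_wpM2r// aM.
split=> [s /up/mul[]//||k k0]; first by have [] := mul _ vp.
have [r r0 hr] := d _ (divr_gt0 k0 M0); exists r => // s se st sr.
have [_ q1] := in_Lp_quot te se du.
rewrite (_ : (fun x => _) = (fun x => a x * ((u s x - u t x) / (s - t) - v x))).
  have [_ h] := mul _ q1; apply: le_trans h _.
  by rewrite mulrC -ler_pdivlMr// hr.
by apply/funext => x; field; rewrite subr_eq0.
Qed.

(** Products and equations relate several functions at the same parameter, so a single [s > t] must
    serve them all; with fewer than three functions an argument is repeated. *)
Lemma Lp_derive_near e u1 u2 u3 t v1 v2 v3 k : 0 <= t < e ->
  Lp_derive e u1 t v1 -> Lp_derive e u2 t v2 -> Lp_derive e u3 t v3 -> 0 < k ->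
  exists s, [/\ 0 <= s < e, 0 < s - t <= k,
    N (fun x => (u1 s x - u1 t x) / (s - t) - v1 x) <= k,
    N (fun x => (u2 s x - u2 t x) / (s - t) - v2 x) <= k &
    N (fun x => (u3 s x - u3 t x) / (s - t) - v3 x) <= k].
Proof.
move=> /andP[t0 te] [_ _ d1] [_ _ d2] [_ _ d3] k0.
have [r1 r10 h1] := d1 _ k0; have [r2 r20 h2] := d2 _ k0; have [r3 r30 h3] := d3 _ k0.
pose m := Num.min (Num.min r1 (Num.min r2 r3)) (Num.min k (e - t)).
have m0 : 0 < m by rewrite !lt_min r10 r20 r30 k0 subr_gt0.
have m2 : m / 2 < m by rewrite ltr_pdivrMr// ltr_pMr// ltr1n.
have m20 : 0 < m / 2 by rewrite divr_gt0.
have [mr1 mr2 mr3 [mk me]] : [/\ m / 2 < r1, m / 2 < r2, m / 2 < r3 &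
    m / 2 < k /\ m / 2 < e - t].
  by move: m2; rewrite {2}/m !lt_min => /andP[/and3P[-> -> ->] /andP[-> ->]].
have se : 0 <= t + m / 2 < e by rewrite addr_ge0 ?(ltW m20)//= -ltrBrDl.
have st : t + m / 2 != t by rewrite -subr_eq0 addrC addKr gt_eqF.
have sm : t + m / 2 - t = m / 2 by rewrite addrC addKr.
exists (t + m / 2); split=> //.
- by rewrite sm m20 ltW.
- by apply: h1 => //; rewrite sm gtr0_norm.
- by apply: h2 => //; rewrite sm gtr0_norm.
- by apply: h3 => //; rewrite sm gtr0_norm.
Qed.

(** The form in which limits are taken below; the restriction [k <= 1] allows bounds that hold only
    for small [k]. *)
Lemma le0_of_small (X K : R) : (forall k, 0 < k -> k <= 1 -> X <= k * K) -> X <= 0.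
Proof.
move=> h; apply/ler_addgt0Pr => e e0; rewrite add0r.
have k0 : 0 < Num.min 1 (e / (`|K| + 1)) by rewrite lt_min ltr01 divr_gt0.
apply: le_trans (h _ k0 _) _; first by rewrite ge_min lexx.
apply: (@le_trans _ _ (Num.min 1 (e / (`|K| + 1)) * (`|K| + 1))).
  by rewrite ler_wpM2l ?(ltW k0)// (le_trans (ler_norm K))// lerDl.
by rewrite -ler_pdivlMr// ge_min lexx orbT.
Qed.

Lemma Rintegral_abs_eq0 f : L1 Om f ->
  \int[mu]_(x in Om) `|f x| <= 0 -> {ae mu, forall x, Om x -> f x = 0}.
Proof.
move=> fi f0.
have mf : measurable_fun Om (EFin \o f) := measurable_int _ fi.
have fabs : L1 Om (fun x => `|f x|).
  by have := integrable_norm fi; apply: eq_integrable.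
have I0 : (\int[mu]_(x in Om) `|(EFin \o f) x| = 0)%E.
  rewrite -[LHS]fineK ?integrable_fin_num//; congr EFin; apply/eqP.
  rewrite eq_le; apply/andP; split; first exact: f0.
  by apply: fine_ge0; apply: integral_ge0.
have := (ae_eq_integral_abs mu mOm mf).1 I0.
by apply: filterS => x h Ox; have [] := h Ox.
Qed.

(* The remainder is [sig (E_u v_t + u_t E_v + (s - t) D_u D_v)], where D and E
   denote difference quotients and their distance to the derivative. *)
Lemma Lp_derive_prod (sig : 'rV[R]_n -> R) (S e : R) (u v q : R -> 'rV[R]_n -> R) (t : R)
    (u' v' q' : 'rV[R]_n -> R) : 0 <= t < e ->
  measurable_fun Om sig -> 0 < S -> (forall x, Om x -> `|sig x| <= S) ->
  Lp_derive e u t u' -> Lp_derive e v t v' -> Lp_derive e q t q' ->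
  (forall s, 0 <= s < e ->
    {ae mu, forall x, Om x -> q s x = sig x * (u s x * v s x)}) ->
  {ae mu, forall x, Om x -> q' x = sig x * (u' x * v t x + u t x * v' x)}.
Proof.
move=> te msig S0 sigS du dv dq qE.
have [up up' _] := du; have [vp vp' _] := dv; have [qp qp' _] := dq.
(* A common bound for all the factors of the remainder; the summand 1 absorbs the error [k <= 1] of
   the difference quotients. *)
pose a := N (u t) + N (v t) + N u' + N v' + 1.
have N0 f : 0 <= N f by exact: Lp_nr_ge0.
have a0 : 0 < a by rewrite ltr_wpDl// !addr_ge0.
have prodi f g : in_Lp p Om f -> in_Lp p Om g ->
    L1 Om (fun x => f x * g x).
  move=> fp gp; have f1 : 0 < N f + 1 by rewrite ltr_wpDl.
  have g1 : 0 < N g + 1 by rewrite ltr_wpDl.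
  have f2 : N f <= N f + 1 by rewrite lerDl.
  have g2 : N g <= N g + 1 by rewrite lerDl.
  by have [] := L1_mul p2 mOm fOm f1 g1 fp gp f2 g2.
have sigi f : L1 Om f ->
    L1 Om (fun x => sig x * f x).
  move=> fi; have Sf := integrableZl mOm S fi.
  apply: le_integrable Sf => //.
    apply/measurable_EFinP; apply: measurable_funM => //.
    exact/measurable_EFinP/measurable_int/fi.
  move=> x Ox; rewrite /= lee_fin !normrM (gtr0_norm S0) ler_wpM2r// sigS//.
have absi f : L1 Om f ->
    L1 Om (fun x => `|f x|).
  by move=> fi; have := integrable_norm fi; apply: eq_integrable.
pose G x := q' x - sig x * (u' x * v t x + u t x * v' x).
have Gi : L1 Om G.
  have i1 := integrableD mOm (prodi _ _ up' (vp t te)) (prodi _ _ (up t te) vp').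
  have i2 : L1 Om (fun x => u' x * v t x + u t x * v' x).
    by apply: eq_integrable i1.
  exact: integrable_sub (in_Lp_integrable p2 mOm fOm qp') (sigi _ i2).
suff : {ae mu, forall x, Om x -> G x = 0}.
  by apply: filterS => x h Ox; apply/eqP; rewrite -subr_eq0 -/(G x) h.
apply: Rintegral_abs_eq0 => //.
pose M := 2 * fine (mu Om) + 2.
(* The defect [G] does not depend on [s], so it suffices to bound its integral by a multiple of [k].
   The first constant stands for the error of [q], [2 a] for the two products with one error factor,
   and [a^2] for the product of the difference quotients, whose factor [s - t] is at most [k]. *)
apply: (@le0_of_small _ (L1_const p Om + S * (M * (2 * a + a ^+ 2)))) => k k0 k1.
have [s [se /andP[st0 stk] eu ev eq]] := Lp_derive_near te du dv dq k0.
have [qup qeup] := in_Lp_quot te se du; have [qvp qevp] := in_Lp_quot te se dv.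
have [_ qeqp] := in_Lp_quot te se dq.
set Eu := (fun x => _) in eu qeup; set Ev := (fun x => _) in ev qevp.
set Eq := (fun x => _) in eq qeqp.
set Du := (fun x => _) in qup; set Dv := (fun x => _) in qvp.
have Da f' (D E : 'rV[R]_n -> R) : in_Lp p Om f' -> in_Lp p Om E -> N E <= k ->
    N f' + 1 <= a -> D = (fun x => E x + f' x) -> N D <= a.
  move=> fp Ep Ek fa ->; apply: le_trans (Lp_nrD p2 mOm Ep fp) _.
  by rewrite addrC (le_trans _ fa)// lerD2l (le_trans Ek).
have Dua : N Du <= a.
  apply: (Da u' Du Eu) => //; last by apply/funext => x; rewrite /Eu subrK.
  by rewrite /a; have := N0 (u t); have := N0 (v t); have := N0 v'; lra.
have Dva : N Dv <= a.
  apply: (Da v' Dv Ev) => //; last by apply/funext => x; rewrite /Ev subrK.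
  by rewrite /a; have := N0 (u t); have := N0 (v t); have := N0 u'; lra.
have uta : N (u t) <= a.
  by rewrite /a; have := N0 v'; have := N0 (v t); have := N0 u'; lra.
have vta : N (v t) <= a.
  by rewrite /a; have := N0 v'; have := N0 (u t); have := N0 u'; lra.
have [i1 l1] := L1_mul p2 mOm fOm k0 a0 qeup (vp t te) eu vta.
have [i2 l2] := L1_mul p2 mOm fOm a0 k0 (up t te) qevp uta ev.
have [i3 l3] := L1_mul p2 mOm fOm a0 a0 qup qvp Dua Dva.
have l0 := L1_le p2 mOm fOm k0 qeqp eq.
have i0 := in_Lp_integrable p2 mOm fOm qeqp.
have {}i0 := absi _ i0; have {}i1 := absi _ i1; have {}i2 := absi _ i2.
have {}i3 := absi _ i3.
have i4 : L1 Om (fun x => `|Eu x * v t x| + `|u t x * Ev x|).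
  exact: integrable_add.
have i5 : L1 Om (fun x => k * `|Du x * Dv x|).
  exact: integrable_scale.
have i6 : L1 Om (fun x =>
    `|Eu x * v t x| + `|u t x * Ev x| + k * `|Du x * Dv x|).
  exact: integrable_add.
have i7 : L1 Om (fun x => S *
    (`|Eu x * v t x| + `|u t x * Ev x| + k * `|Du x * Dv x|)).
  exact: integrable_scale.
have i8 : L1 Om (fun x => `|Eq x| + S *
    (`|Eu x * v t x| + `|u t x * Ev x| + k * `|Du x * Dv x|)).
  exact: integrable_add.
apply: (@le_trans _ _ (\int[mu]_(x in Om) (`|Eq x| + S *
    (`|Eu x * v t x| + `|u t x * Ev x| + k * `|Du x * Dv x|)))).
  apply: ae_le_Rintegral => //; first exact: absi.
  apply: filterS2 (qE s se) (qE t te) => x qs qt Ox.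
  have GE : G x = - Eq x + sig x * (Eu x * v t x + u t x * Ev x +
      (s - t) * (Du x * Dv x)).
    rewrite /G /Eq /Eu /Ev /Du /Dv qs// qt//; field.
    by rewrite gt_eqF.
  rewrite GE; apply: le_trans (ler_normD _ _) _; rewrite normrN lerD2l normrM.
  apply: ler_pM => //; first exact: sigS.
  apply: le_trans (ler_normD _ _) _; apply: lerD; first exact: ler_normD.
  by rewrite normrM ler_wpM2r// gtr0_norm.
rewrite RintegralD// RintegralZl// RintegralD// RintegralD// RintegralZl//.
rewrite -/M in l1 l2 l3.
have l5 : k * \int[mu]_(x in Om) `|Du x * Dv x| <= k * (M * (a * a)).
  by rewrite ler_wpM2l// ltW.
rewrite (_ : k * _ = L1_const p Om * k + S * (M * (k * a) + M * (a * k) + k * (M * (a * a))));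
  last by ring.
apply: lerD => //; rewrite ler_wpM2l ?(ltW S0)//.
by apply: lerD => //; exact: lerD.
Qed.

(** As both families vanish at 0, their derivatives are the limits of [u s / s] and [w s / s], and
    the inequality can be divided by [s]. *)
Lemma Lp_derive0_le (e c : R) (u w : R -> 'rV[R]_n -> R) (u' w' : 'rV[R]_n -> R) :
  0 < e -> 0 <= c ->
  Lp_derive e u 0 u' -> Lp_derive e w 0 w' ->
  {ae mu, forall x, Om x -> u 0 x = 0} -> {ae mu, forall x, Om x -> w 0 x = 0} ->
  (forall s, 0 < s < e -> N (u s) <= c * N (w s)) -> N u' <= c * N w'.
Proof.
move=> e0 c0 du dw u0 w0 uw; rewrite -subr_le0.
have te : 0 <= (0 : R) < e by rewrite e0 andbT.
apply: (@le0_of_small _ (1 + c)) => k k0 _.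
have [s [se /andP[]]] := Lp_derive_near te du dw dw k0; rewrite !subr0 => s0 _ eu ew _.
have [up up' _] := du; have [wp wp' _] := dw.
have [_] := in_Lp_quot te se du; have [_] := in_Lp_quot te se dw; rewrite subr0.
set Ew := (fun x => _ : R) in ew *; set Eu := (fun x => _ : R) in eu *.
move=> Ewp Eup.
have sV0 : 0 <= s^-1 by rewrite invr_ge0 ltW.
have h1 : N u' <= s^-1 * N (u s) + 1 * N Eu.
  apply: (in_Lp_ae_leD sV0 ler01 up'.1 (up s se) Eup _).2.
  apply: filterS u0 => x h Ox.
  rewrite (_ : u' x = s^-1 * u s x - Eu x); last by rewrite /Eu h// subr0; ring.
  by apply: le_trans (ler_normB _ _) _; rewrite normrM (ger0_norm sV0) mul1r.
have h2 : s^-1 * N (w s) <= N w' + N Ew.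
  rewrite mulrC ler_pdivrMr// mulrC mulrDr.
  apply: (in_Lp_ae_leD (ltW s0) (ltW s0) (wp s se).1 wp' Ewp _).2.
  apply: filterS w0 => x h Ox.
  rewrite (_ : w s x = s * w' x + s * Ew x); last first.
    by rewrite /Ew h// subr0; field; rewrite gt_eqF.
  by apply: le_trans (ler_normD _ _) _; rewrite !normrM (gtr0_norm s0).
have s0e : 0 < s < e by rewrite s0; case/andP: se.
have h3 := ler_wpM2l sV0 (uw s s0e); rewrite mulrCA in h3.
have h4 := ler_wpM2l c0 h2; have h5 := ler_wpM2l c0 ew.
move: h1 h3 h4 h5 eu; rewrite mul1r !mulrDr !mulr1; lra.
Qed.

End Lp_derivative.

(** * The a priori estimate *)

Section pos_power.
Context {R : realType}.
Implicit Types (q t : R).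

Definition pos_powR q t : R := Num.max t 0 `^ q.

Lemma pos_powR_ge0 q t : 0 <= pos_powR q t.
Proof. exact: powR_ge0. Qed.

Lemma pos_powR_le0 q t : q != 0 -> t <= 0 -> pos_powR q t = 0.
Proof. by move=> q0 t0; rewrite /pos_powR max_r// powR0. Qed.

Lemma pos_powR_gt0 q t : 0 < t -> pos_powR q t = t `^ q.
Proof. by move=> t0; rewrite /pos_powR max_l// ltW. Qed.

Lemma le_pos_powR q s t : 0 <= q -> s <= t -> pos_powR q s <= pos_powR q t.
Proof.
move=> q0 st; rewrite /pos_powR ge0_ler_powR ?nnegrE ?le_max ?lexx ?orbT//.
by have [] := leP s 0; have [] := leP t 0; lra.
Qed.

Lemma cvg_pos_powR0 q : 0 < q -> pos_powR q t @[t --> 0^'] --> (0 : R).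
Proof.
move=> q0; apply/cvgrPdist_le => e e0; pose r := e `^ q^-1.
have r0 : 0 < r by exact: powR_gt0.
near=> t; rewrite sub0r normrN ger0_norm ?pos_powR_ge0//.
have tr : t <= r.
  by rewrite ltW//; near: t; apply: nbhs_dnbhs; exact: lt_nbhsl.
apply: le_trans (le_pos_powR (ltW q0) tr) _; rewrite pos_powR_gt0//.
by rewrite -powRrM mulVf ?gt_eqF// powRr1// ltW.
Unshelve. all: end_near. Qed.

(** At 0 the difference quotient is [pos_powR (q - 1)], which tends to 0 because [q > 1]. The lemma
    is applied with [q = p] and [q = p - 1]; the latter is where [p > 2] enters. *)
Lemma is_derive_pos_powR q t : 1 < q ->
  is_derive t 1 (pos_powR q) (q * pos_powR (q - 1) t).
Proof.
move=> q1; have q0 : q != 0 by rewrite gt_eqF// (lt_trans _ q1).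
have q10 : 0 < q - 1 by rewrite subr_gt0.
have [t0|t0|->] := ltgtP t 0.
- rewrite pos_powR_le0 ?(ltW t0) ?gt_eqF// mulr0.
  have dc : is_derive t 1 (fun _ : R => 0 : R) 0 by exact: is_derive_cst.
  apply: near_eq_is_derive dc.
  by near=> y; rewrite pos_powR_le0// ltW//; near: y; exact: lt_nbhsl.
- rewrite pos_powR_gt0//.
  have tin : t \in `]0, +oo[ by rewrite in_itv/= t0.
  apply: (@near_eq_is_derive _ _ _ (fun y : R => y `^ q) (pos_powR q)).
    by near=> y; rewrite pos_powR_gt0//; near: y; exact: lt_nbhsr.
  split; first exact: derivable_powR.
  by have := powR_derive1 q tin; rewrite derive1E.
- rewrite pos_powR_le0 ?gt_eqF// mulr0.
  suff h : (fun h => h^-1 *: ((pos_powR q \o shift 0) (h *: 1) - pos_powR q 0)) @ 0^'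
      --> (0 : R).
    by apply: DeriveDef; [apply/cvg_ex; exists 0 | exact/cvg_lim].
  apply: cvg_trans (cvg_pos_powR0 q10).
  apply: near_eq_cvg; near=> h.
  rewrite /= addr0 (pos_powR_le0 q0 (lexx 0)) subr0 /GRing.scale/= mulr1.
  have [h0|h0] := leP h 0.
    by rewrite (pos_powR_le0 (lt0r_neq0 q10) h0) (pos_powR_le0 q0 h0) mulr0.
  rewrite !pos_powR_gt0// powRB ?powRr1 ?ltW// 1?mulrC//.
  by rewrite (gt_eqF h0) implybT.
Unshelve. all: end_near. Qed.

Lemma measurable_pos_powR q : measurable_fun setT (pos_powR q).
Proof.
apply: (@measurableT_comp _ _ _ _ _ _ (fun t : R => t `^ q)).
  exact: measurable_powR.
exact: measurable_maxr.
Qed.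

(** The derivative is bounded only below the level [T], as for powers of a positive part, so the
    mean value theorem is applied on that half-line. *)
Lemma lipschitz_of_derive (f df : R -> R) (T M : R) :
  (forall t : R, is_derive t 1 f (df t)) ->
  (forall t, t <= T -> `|df t| <= M) ->
  forall s t, s <= T -> t <= T -> `|f s - f t| <= M * `|s - t|.
Proof.
move=> fdf dM.
have M1 s t : s < t -> t <= T -> `|f s - f t| <= M * `|s - t|.
  move=> st tT.
  have [] := @MVT _ f df s t st.
    by apply: derivable_within_continuous => x _; have [] := fdf x.
  move=> c; rewrite in_itv/= => /andP[_ ct] h.
  rewrite distrC h normrM distrC ler_wpM2r// dM//.
  exact: le_trans (ltW ct) tT.
move=> s t sT tT; have [st|ts|->] := ltgtP s t.
- exact: M1.
- by rewrite distrC [X in _ <= _ * X]distrC; exact: M1.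
- by rewrite !subrr normr0 mulr0.
Qed.

End pos_power.

(** * Uniform continuity and extension by zero *)

Section uniform_continuity.
Context {R : realType} (n : nat).
Implicit Types (A Om : set 'rV[R]_n) (f w : 'rV[R]_n -> R).

Lemma unif_cont_onS A1 A2 f : A1 `<=` A2 -> unif_cont_on A2 f -> unif_cont_on A1 f.
Proof.
move=> sub uc tau /uc[e e0 h]; exists e => // x y Ax Ay; apply: h; exact: sub.
Qed.

(** Heine-Cantor, by the covering form of compactness: around each point a radius works for a whole
    neighbourhood, and compactness makes it uniform. *)
Lemma compact_unif_cont A f : compact A -> {within A, continuous f} ->
  unif_cont_on A f.
Proof.
move=> cA /subspace_continuousP fA tau tau0.
pose P (e : R) (x : 'rV[R]_n) := A x -> forall y, A y -> cube x e y ->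
  `|f x - f y| <= tau.
have t20 : 0 < tau / 2 by rewrite divr_gt0.
have cov x : A x -> \forall z \near x & e \near 0^'+, P e z.
  move=> Ax; have /cvgrPdist_le/(_ _ t20) := fA _ Ax.
  rewrite /prop_near1 /within/= => /nbhs_ballP[r /= r0 hr].
  have r20 : 0 < r / 2 by rewrite divr_gt0.
  have key z y : A z -> ball x r z -> A y -> ball x r y -> `|f z - f y| <= tau.
    move=> Az xz Ay xy; have h1 := hr _ xz Az; have h2 := hr _ xy Ay.
    rewrite (_ : f z - f y = (f x - f y) - (f x - f z)); last by ring.
    by apply: le_trans (ler_normB _ _) _; rewrite (splitr tau) lerD.
  near=> z e => Az y Ay zy.
  have xz : ball x (r / 2) z by near: z; exact: nbhsx_ballx.
  have er : e < r / 2 by near: e; exact: nbhs_right_lt.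
  apply: key => //; first by apply: le_ball xz; lra.
  rewrite -cube_ball// => i; rewrite -cube_ball// in xz.
  rewrite (_ : _ - _ = (x 0 i - z 0 i) + (z 0 i - y 0 i)); last by ring.
  apply: le_lt_trans (ler_normD _ _) _; rewrite (splitr r) ltrD//.
  exact: lt_trans (zy i) er.
have h : \forall e \near (0 : R)^'+, A `<=` P e.
  by apply: ((compact_near_coveringP A).1 cA R 0^'+ P).
have [e [e0 he]] := filter_ex (filterI (nbhs_right_gt 0) h).
by exists e => // x y Ax Ay; exact: he.
Unshelve. all: end_near. Qed.

(** Two points at distance less than 1 either both lie in the compact cube of radius [r + 1], or
    both give the value 0. *)
Lemma unif_cont_bounded_ext f (r : R) : continuous f ->
  (forall x, ~ cube 0 r x -> f x = 0) -> unif_cont_on setT f.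
Proof.
move=> cf f0.
have cA : compact [set x : 'rV[R]_n | forall i, (`[- (r + 1), r + 1]%classic : set R) (x 0 i)].
  by apply: (@rV_compact _ n (fun i => `[- (r + 1), r + 1]%classic)) => i;
    exact: segment_compact.
have wcf : {within [set x : 'rV[R]_n | forall i,
    (`[- (r + 1), r + 1]%classic : set R) (x 0 i)], continuous f}.
  exact: continuous_subspaceT.
move=> tau tau0; have [e e0 h] := compact_unif_cont cA wcf tau0.
have e1 : 0 < Num.min e 1 by rewrite lt_min e0 ltr01.
exists (Num.min e 1) => // x y _ _ xy.
have [xr|xr] := pselect (cube 0 r x \/ cube 0 r y); last first.
  move/not_orP : xr => -[xr yr]; rewrite !f0// subrr normr0; exact: ltW.
have K (z z' : 'rV[R]_n) : cube 0 r z -> cube z 1 z' ->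
    (forall i, (`[- (r + 1), r + 1]%classic : set R) (z 0 i)) /\
    (forall i, (`[- (r + 1), r + 1]%classic : set R) (z' 0 i)).
  move=> zr zz'; split=> i /=; rewrite in_itv/=; have := zr i; have := zz' i;
  rewrite mxE sub0r normrN !ltr_norml => /andP[h1 h2] /andP[h3 h4];
  by apply/andP; split; lra.
have xy1 : cube x 1 y by move=> i; have := xy i; rewrite lt_min => /andP[].
have xye : cube x e y by move=> i; have := xy i; rewrite lt_min => /andP[].
have yx1 : cube y 1 x by move=> i; rewrite distrC; exact: xy1.
by case: xr => [xr|yr]; apply: h => //; [case: (K _ _ xr xy1)|case: (K _ _ xr xy1)
 |case: (K _ _ yr yx1)|case: (K _ _ yr yx1)].
Qed.

(** The two definitions agree on the boundary: there [w <= 0], so its positive part already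
    vanishes. *)
Lemma continuous_pos_ext Om w : open Om -> {within closure Om, continuous w} ->
  (forall x, bdry Om x -> w x <= 0) ->
  continuous (fun x => Num.max ((w \_ Om) x) 0).
Proof.
move=> oOm /subspace_continuousP wc wb x.
pose f y := Num.max ((w \_ Om) y) 0.
suff : forall e, 0 < e -> \forall y \near x, `|f x - f y| <= e.
  by move=> /cvgrPdist_le.
have maxL (a b : R) : `|Num.max a 0 - Num.max b 0| <= `|a - b|.
  have := ler_norm (a - b); have := ler_norm (b - a); rewrite distrC ler_norml.
  by have [] := leP a 0; have [] := leP b 0 => ? ? ? ?; apply/andP; split; lra.
rewrite /f => e e0.
have [cx|/existsNP[U /not_implyP[Ux UO]]] := pselect (closure Om x); last first.
  have Ox : ~ Om x.
    by move=> Ox; apply: UO; exists x; split=> //; exact: nbhs_singleton.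
  near=> y; rewrite !patchN ?subrr ?normr0 ?(ltW e0)// ?notin_setE//.
  by move=> Oy; apply: UO; exists y; split=> //; near: y.
have wpx : Num.max ((w \_ Om) x) 0 = Num.max (w x) 0.
  have [Ox|Ox] := pselect (Om x); first by rewrite patchT ?inE.
  rewrite patchN ?notin_setE// maxxx max_r// wb//; split=> //.
  by move=> /interior_subset.
rewrite wpx; have /cvgrPdist_le/(_ _ e0) := wc _ cx.
rewrite /prop_near1 /within/= => wnear.
have inside y : Om y -> (closure Om y -> `|w x - w y| <= e) ->
    `|Num.max (w x) 0 - Num.max ((w \_ Om) y) 0| <= e.
  move=> Oy wy; rewrite patchT ?inE//; apply: le_trans (maxL _ _) _.
  exact: wy (subset_closure Oy).
have [Ox|Ox] := pselect (Om x).
  have nO : nbhs x Om := open_nbhs_nbhs (conj oOm Ox).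
  near=> y; have Oy : Om y by near: y.
  by apply: inside => //; near: y.
near=> y; have [Oy|Oy] := pselect (Om y); first by apply: inside => //; near: y.
rewrite patchN ?notin_setE// maxxx -wpx patchN ?notin_setE// maxxx subrr normr0.
exact: ltW.
Unshelve. all: end_near. Qed.

End uniform_continuity.

(** * Test functions and classical derivatives on an open set *)

Section on_domain.
Context {R : realType} (n : nat) (Om : set 'rV[R]_n).
Hypothesis oOm : open Om.
Local Notation mu := (@lebesgue_rV R n).
Local Notation L1 D f := (mu.-integrable D (EFin \o f)).
Implicit Types (f g psi : 'rV[R]_n -> R).

Lemma bounded_sub_cube (A : set 'rV[R]_n) : bounded_set A ->
  exists2 r, 0 < r & A `<=` cube 0 r.
Proof.
move=> [M [_ hM]]; exists (`|M| + 2); first by rewrite ltr_wpDl.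
move=> x Ax i; rewrite mxE sub0r normrN.
have : `|x| <= `|M| + 1.
  by apply: hM => //; rewrite (le_lt_trans (ler_norm _))// ltrDl.
move=> h; apply: (@le_lt_trans _ _ (`|M| + 1)); last by rewrite ltrD2l ltr1n.
apply: le_trans h; rewrite [leRHS]/Num.norm/= mx_normrE.
by apply: (le_bigmax _ (fun ij => `|x ij.1 ij.2|) (0, i)).
Qed.

Lemma compact_continuous_bounded (A : set 'rV[R]_n) f : compact A ->
  {within A, continuous f} -> exists M, forall x, A x -> `|f x| <= M.
Proof.
move=> cA fA; have /compact_bounded[M [_ hM]] := continuous_compact fA cA.
exists (M + 1) => x Ax; apply: (hM (M + 1)); first by rewrite ltrDl.
by exists x.
Qed.

Lemma Rintegral_restrict_mul f g : \int[mu]_x ((f \_ Om) x * g x) =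
  \int[mu]_(x in Om) (f x * g x).
Proof.
rewrite [RHS]Rintegral_mkcond; apply: eq_Rintegral => x _.
by rewrite /patch; case: ifP => // _; rewrite mul0r.
Qed.

Lemma ae_eq_Rintegral f g : measurable_fun Om f -> measurable_fun Om g ->
  {ae mu, forall x, Om x -> f x = g x} ->
  \int[mu]_(x in Om) f x = \int[mu]_(x in Om) g x.
Proof.
move=> mf mg fg; congr fine; apply: ae_eq_integral.
- exact: open_measurable_rV.
- exact/measurable_EFinP.
- exact/measurable_EFinP.
by apply: filterS fg => x h Ox; rewrite h.
Qed.

Lemma integrable_restrict f : L1 Om f -> L1 setT (f \_ Om).
Proof.
move=> h; have := (integrable_mkcond _ (open_measurable_rV oOm)).1 h.
by apply: eq_integrable => // x _; rewrite /= /patch; case: ifP.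
Qed.

Lemma test_function_facts psi i : test_function Om psi ->
  exists M, [/\ measurable_fun setT psi, measurable_fun setT (partial [:: i] psi),
    forall x, `|psi x| <= M, forall x, `|partial [:: i] psi x| <= M &
    [/\ forall x, is_derive x (delta_mx 0 i) psi (partial [:: i] psi x),
    forall x, ~ Om x -> psi x = 0 /\ partial [:: i] psi x = 0 &
    forall x, ~ Om x -> \near x, psi x = 0]].
Proof.
move=> [smp [K [cK KO K0]]].
have c0 : continuous psi by move=> x; have [h _] := smp 1%N [::] isT; apply: h; rewrite inE.
have c1 : continuous (partial [:: i] psi).
  by move=> x; have [h _] := smp 1%N [:: i] isT; apply: h; rewrite inE.
have dpsi x : is_derive x (delta_mx 0 i) psi (partial [:: i] psi x).
  by have [_ h] := smp 1%N [::] isT; split=> //; apply: h => //; rewrite inE.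
have clK : closed K by apply: compact_closed => //; exact: norm_hausdorff.
have nK x : ~ K x -> \near x, psi x = 0.
  move=> Kx; have : \near x, (~` K) x.
    by apply: open_nbhs_nbhs; split=> //; exact: closed_openC.
  by apply: filterS => y; exact: K0.
have K1 x : ~ K x -> partial [:: i] psi x = 0.
  move=> /nK h; rewrite /= (near_eq_derive _ (g := cst 0)) ?derive_cst//.
have [M0 hM0] := compact_continuous_bounded cK (continuous_subspaceT c0).
have [M1 hM1] := compact_continuous_bounded cK (continuous_subspaceT c1).
exists (Num.max (Num.max M0 M1) 0).
have bd f M : (forall x, K x -> `|f x| <= M) -> (forall x, ~ K x -> f x = 0) ->
    M <= Num.max M0 M1 -> forall x, `|f x| <= Num.max (Num.max M0 M1) 0.
  move=> fM f0 MM x; rewrite le_max; have [/fM h|/f0->] := pselect (K x).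
    by rewrite (le_trans h MM).
  by rewrite normr0 lexx orbT.
split.
- exact: continuous_measurable_rV.
- exact: continuous_measurable_rV.
- by apply: (bd _ M0) => //; rewrite le_max lexx.
- by apply: (bd _ M1) => //; rewrite le_max lexx orbT.
split=> //.
- by move=> x Ox; rewrite K0 ?K1// => /KO.
- by move=> x Ox; apply: nK => /KO.
Qed.

(** The product of [psi] with the extension of [a] by zero is derivable everywhere, since [psi]
    vanishes in a neighbourhood of every point outside [Om]. Its derivative then integrates to 0. *)
Lemma classical_weak_partial (a a' : 'rV[R]_n -> R) (i : 'I_n) r M :
  Om `<=` cube 0 r -> measurable_fun Om a -> measurable_fun Om a' ->
  (forall x, Om x -> `|a x| <= M) -> (forall x, Om x -> `|a' x| <= M) ->
  (forall x, Om x -> is_derive x (delta_mx 0 i) a (a' x)) ->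
  forall psi, test_function Om psi ->
  \int[mu]_(x in Om) (a x * partial [:: i] psi x) =
  - \int[mu]_(x in Om) (a' x * psi x).
Proof.
move=> Or ma ma' aM a'M da psi tpsi.
have [N [mp mdp pN dpN [dp p0 np0]]] := test_function_facts i tpsi.
have mOm := open_measurable_rV oOm.
pose M' := Num.max M 0.
have M'0 : 0 <= M' by rewrite le_max lexx orbT.
have N0 : 0 <= N by apply: le_trans (pN 0).
have mr f : measurable_fun Om f -> measurable_fun setT (f \_ Om).
  by move=> mf; apply/(measurable_restrictT _ _).1.
have br f : (forall x, Om x -> `|f x| <= M) -> forall x, `|(f \_ Om) x| <= M'.
  move=> fM x; rewrite /patch; case: ifP => [|_]; last by rewrite normr0.
  by rewrite inE => /fM h; rewrite (le_trans h)// le_max lexx.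
have z (f g : 'rV[R]_n -> R) x : ~ cube 0 r x -> (f \_ Om) x * g x = 0.
  by move=> xr; rewrite patchN ?mul0r// notin_setE => /Or.
have i1 : L1 setT (fun x => (a \_ Om) x * partial [:: i] psi x).
  apply: (@integrable_compact_support _ _ _ (M' * N) r).
  - by apply: measurable_funM => //; exact: mr.
  - by move=> x; rewrite normrM ler_pM// br.
  - by move=> x; exact: z.
have i2 : L1 setT (fun x => (a' \_ Om) x * psi x).
  apply: (@integrable_compact_support _ _ _ (M' * N) r).
  - by apply: measurable_funM => //; exact: mr.
  - by move=> x; rewrite normrM ler_pM// br.
  - by move=> x; exact: z.
apply/eqP; rewrite -subr_eq0 opprK -!Rintegral_restrict_mul -RintegralD//; apply/eqP.
apply: (@integral_partial_eq0 _ _ i (fun x => (a \_ Om) x * psi x) _ (M' * N + M' * N) r).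
- by apply: measurable_funM => //; exact: mr.
- move=> x; rewrite normrM (@le_trans _ _ (M' * N)) ?lerDl ?mulr_ge0//.
  by rewrite ler_pM// br.
- by move=> x; exact: z.
- by move=> x xr; rewrite !z// addr0.
- move=> x; have [Ox|Ox] := pselect (Om x).
    have d1 : is_derive x (delta_mx 0 i) (a \_ Om) (a' x).
      apply: near_eq_is_derive (da x Ox); near=> y.
      by rewrite patchT// inE; near: y; exact: open_nbhs_nbhs.
    apply: is_derive_eq (is_deriveM d1 (dp x)) _.
    by rewrite /GRing.scale/= !patchT ?inE//; ring.
  have [h1 h2] := p0 x Ox; rewrite h1 h2 !mulr0 addr0.
  have dc : is_derive x (delta_mx 0 i) (fun _ : 'rV[R]_n => 0 : R) 0.
    exact: is_derive_cst.
  apply: near_eq_is_derive dc; near=> y.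
  suff -> : psi y = 0 by rewrite mulr0.
  by near: y; exact: np0.
- move=> x; apply: le_trans (ler_normD _ _) _.
  by rewrite !normrM lerD// ler_pM// br.
Unshelve. all: end_near. Qed.

End on_domain.

(** * Weak solutions of the divergence-form equation *)

Section elliptic.
Context {R : realType} (n : nat).
Local Notation dim := n.+1.
Variables (Om : set 'rV[R]_dim) (p c0 C0 : R) (gam : 'rV[R]_dim -> R).
Local Notation mu := (@lebesgue_rV R dim).
Local Notation L1 D f := (mu.-integrable D (EFin \o f)).
Implicit Types (w f b F psi : 'rV[R]_dim -> R) (v : 'I_dim -> 'rV[R]_dim -> R).

(** The gradient is quantified existentially instead of being [weak_partial], whose values are
    chosen representatives; linear combinations of solutions are then immediate. *)
Definition weak_sol w f b := exists v : 'I_dim -> 'rV[R]_dim -> R,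
  [/\ (in_Lp p Om w /\ in_Lp p Om f),
      (forall i, in_Lp p Om (v i) /\ is_weak_partial Om [:: i] w (v i)),
      is_weak_div Om (fun i x => gam x * v i x) f & has_trace Om w b].

Hypotheses (p2 : 2 < p) (oOm : open Om) (Om0 : Om !=set0) (bOm : bounded_set Om).
Hypotheses (c00 : 0 < c0) (cgam : coefficient Om c0 C0 gam).

Lemma bounded_measure_lty : (mu Om < +oo)%E.
Proof.
have [r r0 sub] := bounded_sub_cube bOm.
apply: le_lt_trans (le_measure mu _ _ sub) (lebesgue_rV_cube_lty _ _); rewrite inE.
  exact: open_measurable_rV.
exact: measurable_cube.
Qed.

Lemma compact_closure : compact (closure Om).
Proof.
apply: bounded_closed_compact; last exact: closed_closure.
have [r r0 sub] := bounded_sub_cube bOm.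
have cK : compact [set x : 'rV[R]_dim | forall i, (`[- r, r]%classic : set R) (x 0 i)].
  by apply: (@rV_compact _ dim (fun i => `[- r, r]%classic)) => i; exact: segment_compact.
have clK := compact_closed (@norm_hausdorff _ _) cK.
have sub2 : closure Om `<=`
    [set x : 'rV[R]_dim | forall i, (`[- r, r]%classic : set R) (x 0 i)].
  rewrite [X in _ `<=` X](closure_id _).1//; apply: closure_subset => x Ox i /=.
  have := sub _ Ox i; rewrite mxE sub0r normrN ltr_norml in_itv/= => /andP[h1 h2].
  by rewrite !ltW.
have [M [Mr hM]] := compact_bounded cK.
by exists M; split=> // N MN x /sub2; exact: hM.
Qed.

Lemma coefficient_partial_le (a : 'rV[R]_dim -> R) s x : coefficient Om c0 C0 a ->
  (size s <= 2)%N -> Om x -> `|partial s a x| <= C0.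
Proof.
move=> [_ _ nC] s2 Ox; rewrite -lee_fin; apply: le_trans nC.
by apply: ereal_sup_ubound; exists s, x.
Qed.

Lemma coefficient_bounds (a : 'rV[R]_dim -> R) x : coefficient Om c0 C0 a ->
  Om x -> c0 <= a x <= C0.
Proof.
move=> ca Ox; have [_ h _] := ca; rewrite h/=; last exact: subset_closure.
apply: le_trans (ler_norm _) _.
exact: (@coefficient_partial_le a [::] x ca isT Ox).
Qed.

Lemma coefficient_continuous (a : 'rV[R]_dim -> R) : coefficient Om c0 C0 a ->
  {in Om, continuous a}.
Proof.
by move=> [[ck _ _] _ _] x Ox; have [h _] := ck [::] isT; exact: h.
Qed.

Lemma coefficient_measurable (a : 'rV[R]_dim -> R) : coefficient Om c0 C0 a ->
  measurable_fun Om a.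
Proof.
by move=> /coefficient_continuous; exact: within_continuous_measurable_rV.
Qed.

Lemma coefficient_derive (a : 'rV[R]_dim -> R) i x : coefficient Om c0 C0 a ->
  Om x -> is_derive x (delta_mx 0 i) a (partial [:: i] a x).
Proof.
move=> [[ck _ _] _ _] Ox; have [_ h] := ck [::] isT.
by split=> //; apply: h => //; rewrite inE.
Qed.

Lemma coefficient_partial_measurable (a : 'rV[R]_dim -> R) i :
  coefficient Om c0 C0 a -> measurable_fun Om (partial [:: i] a).
Proof.
move=> [[ck _ _] _ _]; apply: within_continuous_measurable_rV => // x Ox.
by have [h _] := ck [:: i] isT; exact: h.
Qed.

Lemma C0_gt0 : 0 < C0.
Proof.
have [x Ox] := Om0; have /andP[h1 h2] := coefficient_bounds cgam Ox.
exact: lt_le_trans c00 (le_trans h1 h2).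
Qed.

Let mOm : measurable Om := open_measurable_rV oOm.
Let fOm : (mu Om < +oo)%E := bounded_measure_lty.
Let C00 : 0 < C0 := C0_gt0.

Section exponential.
Variable lam : R.

Definition expx (x : 'rV[R]_dim) : R := expR (lam * x 0 0).

Definition dexpx (i : 'I_dim) (x : 'rV[R]_dim) : R := if i == 0 then lam * expx x else 0.

(** This is [d_i (gam * d_i exp(lam x_0))]; the sum over [i] is [div (gam grad exp(lam x_0))]. *)
Definition ddexpx (i : 'I_dim) (x : 'rV[R]_dim) : R := if i == 0
  then lam * expx x * (partial [:: i] gam x + lam * gam x) else 0.

Lemma is_derive_expx i x : is_derive x (delta_mx 0 i) expx (dexpx i x).
Proof.
apply/is_derive_line0; rewrite /dexpx.
have dl : is_derive (0 : R) 1
    (fun s : R => lam * (s *: (delta_mx 0 i : 'rV[R]_dim) + x) 0 0)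
    (lam * (i == 0)%:R).
  rewrite (_ : (fun s : R => _) = (fun s : R => lam * (s * (i == 0)%:R + x 0 0))).
    have d1 := is_deriveM (is_derive_id (0 : R) (1 : R))
      (is_derive_cst ((i == 0)%:R : R) (0 : R) (1 : R)).
    have d2 := is_deriveD d1 (is_derive_cst (x 0 0) (0 : R) (1 : R)).
    have d3 := is_deriveM (is_derive_cst lam (0 : R) (1 : R)) d2.
    apply: is_derive_eq d3 _.
    by rewrite /GRing.scale/= !(mulr0, mul0r, addr0, add0r, mulr1).
  by apply/funext => s; rewrite !mxE eqxx /= [0 == i]eq_sym.
have h := @is_derive1_comp _ expR _ _ _ _ (is_derive_expR _) dl.
rewrite (_ : (if _ then _ else _) =
  expR (lam * (0 *: delta_mx 0 i + x) 0 0) * (lam * (i == 0)%:R)); first exact: h.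
rewrite scale0r add0r -/(expx x).
by case: ifP => _; rewrite ?mulr1 ?mulr0 1?mulrC ?mulr0.
Qed.

Lemma is_derive_gam_dexpx i x : Om x ->
  is_derive x (delta_mx 0 i) (fun y => gam y * dexpx i y) (ddexpx i x).
Proof.
move=> Ox; rewrite /dexpx /ddexpx; case: eqP => [->|_]; last first.
  under eq_fun do rewrite mulr0.
  exact: is_derive_cst.
have d1 : is_derive x (delta_mx 0 0) (fun y => lam * expx y)
    (lam * dexpx 0 x + expx x * 0).
  exact: is_deriveM (is_derive_cst lam x (delta_mx 0 0)) (is_derive_expx 0 x).
have d2 := is_deriveM (coefficient_derive 0 cgam Ox) d1.
apply: is_derive_eq d2 _.
by rewrite /GRing.scale/= /dexpx eqxx; ring.
Qed.

Lemma continuous_expx : continuous expx.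
Proof.
move=> x; apply: (@continuous_comp _ _ _ (fun x : 'rV[R]_dim => lam * x 0 0) expR).
  apply: continuousM; first exact: cst_continuous.
  exact: coord_continuous.
exact: continuous_expR.
Qed.

Lemma measurable_expx : measurable_fun Om expx.
Proof. by apply: measurable_funTS; apply: continuous_measurable_rV; exact: continuous_expx. Qed.

Lemma measurable_dexpx i : measurable_fun Om (dexpx i).
Proof.
rewrite /dexpx; case: (i == 0); last exact: measurable_cst.
by apply: measurable_funM => //; exact: measurable_expx.
Qed.

Lemma measurable_ddexpx i : measurable_fun Om (ddexpx i).
Proof.
rewrite /ddexpx; case: (i == 0); last exact: measurable_cst.
apply: measurable_funM; first by apply: measurable_funM => //; exact: measurable_expx.
apply: measurable_funD; first exact: coefficient_partial_measurable cgam.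
by apply: measurable_funM => //; exact: coefficient_measurable cgam.
Qed.

Variable r : R.
Hypotheses (lam0 : 0 < lam) (Omr : Om `<=` cube 0 r).
Let A := expR (lam * r).

Lemma expx_bounds x : Om x -> expR (- (lam * r)) <= expx x <= A.
Proof.
move=> /Omr/(_ 0); rewrite mxE sub0r normrN ltr_norml => /andP[h1 h2].
by rewrite /expx !ler_expR -mulrN !ler_pM2l// !ltW.
Qed.

Let l1 : 0 <= lam := ltW lam0.
Let A0 : 0 <= A := expR_ge0 _.

Let normr_expx x : Om x -> `|expx x| <= A.
Proof. by move=> Ox; rewrite ger0_norm ?expR_ge0//; have /andP[] := expx_bounds Ox. Qed.

Lemma dexpx_le i x : Om x -> `|dexpx i x| <= lam * A.
Proof.
move=> Ox; rewrite /dexpx; case: ifP => _; last by rewrite normr0 mulr_ge0.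
by rewrite normrM (ger0_norm l1) ler_wpM2l// normr_expx.
Qed.

Lemma ddexpx_le i x : Om x -> `|ddexpx i x| <= lam * A * (C0 + lam * C0).
Proof.
have C1 : 0 <= C0 := ltW C00.
move=> Ox; rewrite /ddexpx; case: ifP => _.
  rewrite !normrM (ger0_norm l1) ler_pM ?mulr_ge0 ?ler_wpM2l ?normr_expx//.
  apply: le_trans (ler_normD _ _) _; apply: lerD.
    exact: (coefficient_partial_le (s := [:: i]) cgam).
  rewrite normrM (ger0_norm l1) ler_wpM2l//.
  exact: (coefficient_partial_le (s := [::]) cgam).
by rewrite normr0 !mulr_ge0 ?addr_ge0 ?mulr_ge0.
Qed.

End exponential.

Section energy_estimate.
Variable lam : R.
Hypotheses (lam0 : 0 < lam) (lamP : C0 + 1 <= lam * (lam * c0 - C0)).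

Let p0 : 0 < p. Proof. exact: lt_trans p2. Qed.
Let p10 : 0 < p - 1. Proof. by rewrite subr_gt0 (lt_trans _ p2)// ltr1n. Qed.

Lemma sum_ddexpx x : \sum_i ddexpx lam i x = ddexpx lam 0 x.
Proof.
rewrite (bigD1 0)//= big1 ?addr0// => i i0.
by rewrite /ddexpx (negbTE i0).
Qed.

(** In the worst case the derivative of [gam] is [- C0] and [gam] is [c0], which is the situation
    described by [lamP]. In [C0 + 1], the part [C0] later compensates the term [sigma_a u] in the
    barrier argument; the 1 is enough for the energy estimate. *)
Lemma ddexpx_ge x : Om x -> (C0 + 1) * expx lam x <= ddexpx lam 0 x.
Proof.
move=> Ox; rewrite /ddexpx eqxx.
have /andP[g1 _] := coefficient_bounds cgam Ox.
have := coefficient_partial_le cgam (s := [:: 0]) isT Ox.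
rewrite ler_norml => /andP[d1 _].
have e0 : 0 < expx lam x by exact: expR_gt0.
rewrite mulrAC mulrC [leRHS]mulrC ler_pM2l//; apply: le_trans lamP _.
rewrite ler_wpM2l ?(ltW lam0)//.
have : lam * c0 <= lam * gam x by rewrite ler_wpM2l// ltW.
by move: d1; lra.
Qed.

(** If [K x <= y], the first term on the right dominates the product; otherwise the second one
    does. *)
Lemma young_powR (x y K : R) : 0 <= x -> 0 <= y -> 0 < K ->
  x * y `^ (p - 1) <= K^-1 * y `^ p + K `^ (p - 1) * x `^ p.
Proof.
move=> x0 y0 K0.
have pE (t : R) : 0 <= t -> t * t `^ (p - 1) = t `^ p.
  by move=> t0; rewrite mulr_powRB1.
have q0 : 0 <= p - 1 by exact: ltW.
have [xy|yx] := leP (K * x) y.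
  rewrite -[leLHS]addr0 lerD//; last by rewrite mulr_ge0// powR_ge0.
  rewrite -(pE y y0) mulrA ler_wpM2r ?powR_ge0//.
  by rewrite mulrC ler_pdivlMr// mulrC.
rewrite -[leLHS]add0r lerD//; first by rewrite mulr_ge0 ?powR_ge0// invr_ge0 ltW.
rewrite -(pE x x0) mulrCA ler_wpM2l// -powRM ?(ltW K0)//.
by rewrite ge0_ler_powR ?nnegrE ?mulr_ge0 ?(ltW K0)// ltW.
Qed.

Section level.
Variables (w f b F : 'rV[R]_dim -> R) (v : 'I_dim -> 'rV[R]_dim -> R)
  (wc : 'rV[R]_dim -> R) (delta r : R).
Hypotheses (r0 : 0 < r) (Omr : Om `<=` cube 0 r) (delta0 : 0 < delta).
Hypotheses (wp : in_Lp p Om w) (fp : in_Lp p Om f) (Fp : in_Lp p Om F).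
Hypothesis vp : forall i, in_Lp p Om (v i) /\ is_weak_partial Om [:: i] w (v i).
Hypothesis divv : is_weak_div Om (fun i x => gam x * v i x) f.
Hypothesis wcc : {within closure Om, continuous wc}.
Hypothesis wcw : {ae mu, forall x, Om x -> wc x = w x}.
Hypothesis wcb : forall x, bdry Om x -> wc x <= 0.
Hypothesis fF : {ae mu, forall x, Om x -> 0 < w x -> - f x <= `|F x|}.

Let m := expR (- (lam * r)).
Let A := expR (lam * r).
Let z x := Num.max (wc x - delta) 0.

Let expx_bd x (Ox : Om x) : m <= expx lam x <= A := expx_bounds lam0 Omr Ox.

Let mwc : measurable_fun Om wc.
Proof.
apply: within_continuous_measurable_rV => //.
have : {within Om, continuous wc} by exact: continuous_subspaceW (@subset_closure _ _) wcc.
by rewrite continuous_open_subspace.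
Qed.

Let mrestr (g : 'rV[R]_dim -> R) : measurable_fun Om g -> measurable_fun setT (g \_ Om).
Proof. by move=> mg; apply/(measurable_restrictT _ _).1. Qed.

Let restr_bd (g : 'rV[R]_dim -> R) M : 0 <= M -> (forall x, Om x -> `|g x| <= M) ->
  forall x, `|(g \_ Om) x| <= M.
Proof.
move=> M0 gM x; rewrite /patch; case: ifP => [|_]; last by rewrite normr0.
by rewrite inE => /gM.
Qed.

(** Instance of [weak_inequality] with [eta = A - expx lam], nonnegative because [expx lam <= A] on
    the domain, and with [B] and [bt] the powers [p] (divided by [p]) and [p - 1] of the positive
    part of [t - delta]. The minus sign in [eta] turns [h] into [- ddexpx], which makes the
    left-hand side positive. *)
Let level_inequality : exists2 Mw, 0 <= Mw & (forall x, Om x -> `|wc x| <= Mw) /\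
  \int[mu]_(x in Om) (ddexpx lam 0 x * (p^-1 * pos_powR p (wc x - delta))) <=
  \int[mu]_(x in Om) (- f x * ((A - expx lam x) * pos_powR (p - 1) (wc x - delta))).
Proof.
have [Mw hMw] := compact_continuous_bounded compact_closure wcc.
have Mw0 : 0 <= Mw.
  by have [x Ox] := Om0; apply: le_trans (hMw x (subset_closure Ox)).
have wcM x : Om x -> `|wc x| <= Mw by move=> Ox; apply: hMw; exact: subset_closure.
exists Mw; first exact: Mw0.
split; first exact: wcM.
have m0 : 0 < m by exact: expR_gt0.
have A0 : 0 < A by exact: expR_gt0.
(* One constant for [eta], its gradient and [h]: the sum of their individual bounds. *)
pose Me := A + lam * A + lam * A * (C0 + lam * C0).
have Me1 : A <= Me.
  by rewrite /Me -addrA lerDl addr_ge0 ?mulr_ge0 ?addr_ge0 ?mulr_ge0// ltW.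
have Me2 : lam * A <= Me.
  rewrite /Me -addrA addrCA lerDl addr_ge0 ?mulr_ge0 ?addr_ge0 ?mulr_ge0//; exact: ltW.
have Me3 : lam * A * (C0 + lam * C0) <= Me.
  rewrite /Me lerDr addr_ge0 ?mulr_ge0//; exact: ltW.
(* The three powers are nondecreasing, so their values at the maximal level [Mw] bound them; the sum
   serves for all three. *)
pose Mb := (p - 1) * pos_powR (p - 1 - 1) (Mw - delta) +
  pos_powR (p - 1) (Mw - delta) + p^-1 * pos_powR p (Mw - delta).
have q0 : 0 < p - 1 - 1 by move: p2; lra.
have Mb1 t : t <= Mw -> [/\ `|p^-1 * pos_powR p (t - delta)| <= Mb,
    `|pos_powR (p - 1) (t - delta)| <= Mb &
    `|(p - 1) * pos_powR (p - 1 - 1) (t - delta)| <= Mb].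
  move=> tM.
  have h q : 0 < q -> 0 <= pos_powR q (t - delta) <= pos_powR q (Mw - delta).
    by move=> q0'; rewrite pos_powR_ge0/= le_pos_powR ?(ltW q0')// lerD2r.
  have /andP[a1 a2] := h _ p0; have /andP[b1 b2] := h _ p10; have /andP[d1 d2] := h _ q0.
  have e1 : 0 <= p^-1 by rewrite invr_ge0 ltW.
  have e2 : 0 <= p - 1 by exact: ltW.
  have f1 : 0 <= p^-1 * pos_powR p (Mw - delta) by rewrite mulr_ge0// pos_powR_ge0.
  have f2 : 0 <= (p - 1) * pos_powR (p - 1 - 1) (Mw - delta).
    by rewrite mulr_ge0// pos_powR_ge0.
  have f3 := pos_powR_ge0 (p - 1) (Mw - delta).
  have g1 : p^-1 * pos_powR p (t - delta) <= p^-1 * pos_powR p (Mw - delta).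
    exact: ler_wpM2l.
  have g2 : (p - 1) * pos_powR (p - 1 - 1) (t - delta) <=
      (p - 1) * pos_powR (p - 1 - 1) (Mw - delta) by exact: ler_wpM2l.
  have f4 := mulr_ge0 e1 a1; have f5 := mulr_ge0 e2 d1.
  rewrite (ger0_norm f4) (ger0_norm b1) (ger0_norm f5) /Mb.
  split.
  - by apply: le_trans g1 _; rewrite lerDr addr_ge0.
  - by apply: le_trans b2 _; rewrite -[leRHS]addrA addrCA lerDl addr_ge0.
  - by apply: le_trans g2 _; rewrite -[leRHS]addrA lerDl addr_ge0.
have shift_der (g g' : R -> R) : (forall t : R, is_derive t 1 g (g' t)) ->
    forall t : R, is_derive t 1 (fun t => g (t - delta)) (g' (t - delta)).
  move=> dg t.
  have dt : is_derive t 1 (fun t : R => t - delta) 1.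
    apply: is_derive_eq (is_deriveB (is_derive_id t 1) (is_derive_cst delta t 1)) _.
    by rewrite subr0.
  have := @is_derive1_comp _ g (fun t => t - delta) _ _ _ (dg (t - delta)) dt.
  by rewrite mulr1.
have dB (t : R) : is_derive t 1 (fun t => p^-1 * pos_powR p (t - delta))
    (pos_powR (p - 1) (t - delta)).
  have p1 : 1 < p by rewrite (lt_trans _ p2)// ltr1n.
  have d1 := shift_der _ _ (fun t => is_derive_pos_powR t p1) t.
  apply: is_derive_eq (is_deriveM (is_derive_cst p^-1 t 1) d1) _.
  by rewrite scaler0 addr0 /GRing.scale/= mulKf// gt_eqF.
have db (t : R) : is_derive t 1 (fun t => pos_powR (p - 1) (t - delta))
    ((p - 1) * pos_powR (p - 1 - 1) (t - delta)).
  have p1 : 1 < p - 1 by move: p2; lra.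
  exact: shift_der (fun t => is_derive_pos_powR t p1) t.
have fOm' (g : 'rV[R]_dim -> R) x : ~ Om x -> (g \_ Om) x = 0.
  by move=> Ox; rewrite patchN// notin_setE.
have ucw : unif_cont_on setT (fun x => Num.max ((wc \_ Om) x) 0).
  apply: (@unif_cont_bounded_ext _ _ _ r); first exact: continuous_pos_ext.
  by move=> x xr; rewrite fOm' ?maxxx// => /Omr.
have vi i : L1 setT (v i \_ Om).
  exact (integrable_restrict oOm (in_Lp_integrable p2 mOm fOm (vp i).1)).
have v2i i : L1 setT (fun x => (v i \_ Om) x ^+ 2).
  have := integrable_restrict oOm (in_Lp_integrable_sqr p2 mOm fOm (vp i).1).
  apply: eq_integrable => // x _ /=; rewrite /patch; case: ifP => // _.
  by rewrite expr0n.
have f0i : L1 setT ((fun x => - f x) \_ Om).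
  exact (integrable_restrict oOm (in_Lp_integrable p2 mOm fOm (Lp_nrN p2 mOm fp).1)).
have gamb x : Om x -> `|gam x| <= C0.
  exact: (coefficient_partial_le (s := [::]) cgam).
have gamp x : Om x -> 0 <= (gam \_ Om) x.
  move=> Ox; rewrite patchT ?inE//; have /andP[h _] := coefficient_bounds cgam Ox.
  exact: le_trans (ltW c00) h.
have ucgam : unif_cont_on Om (gam \_ Om).
  have cg : {within closure Om, continuous gam} by case: cgam => -[].
  have := unif_cont_onS (@subset_closure _ Om) (compact_unif_cont compact_closure cg).
  move=> uc tau /uc[e e0 h]; exists e => // x y Ox Oy.
  by rewrite !patchT ?inE//; exact: h.
have wg phi : test_function Om phi -> forall i,
    \int[mu]_x ((wc \_ Om) x * partial [:: i] phi x) =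
    - \int[mu]_x ((v i \_ Om) x * phi x).
  move=> tphi i; have [N [_ mdp _ _ _]] := test_function_facts i tphi.
  have [_ /(_ _ tphi)] := vp i; rewrite expr1 mulN1r => h.
  rewrite !Rintegral_restrict_mul//.
  rewrite -h; apply: ae_eq_Rintegral => //.
  - by apply: measurable_funM => //; exact: measurable_funTS.
  - by apply: measurable_funM; [exact: wp.1|exact: measurable_funTS].
  by apply: filterS wcw => x hx Ox; rewrite hx.
have wd phi : test_function Om phi ->
    \int[mu]_x (\sum_i (gam \_ Om) x * (v i \_ Om) x * partial [:: i] phi x) =
    \int[mu]_x (((fun x => - f x) \_ Om) x * phi x).
  move=> tphi; have := divv tphi; rewrite Rintegral_restrict_mul//.
  have [N [mph _ phM _ _]] := test_function_facts 0 tphi.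
  under [in X in _ -> _ = X]eq_Rintegral do rewrite mulNr -mulN1r.
  rewrite RintegralZl ?mulN1r//; last first.
    have := integrable_bounded_mul (integrable_restrict oOm
      (in_Lp_integrable p2 mOm fOm fp)) mph phM.
    move=> h; apply/(integrable_mkcond _ mOm); apply: eq_integrable h => // x _.
    rewrite /= /patch; case: ifP => _; last by rewrite mulr0.
    by rewrite /= mulrC.
  move=> <-; rewrite [RHS]Rintegral_mkcond; apply: eq_Rintegral => x _.
  rewrite /patch; case: ifP => // _.
  by rewrite big1// => i _; rewrite !mul0r.
have meta : measurable_fun setT (fun x : 'rV[R]_dim => A - expx lam x).
  apply: measurable_funB => //; apply: continuous_measurable_rV.
  exact: continuous_expx.
have mdeta i : measurable_fun setT (fun x : 'rV[R]_dim => - dexpx lam i x).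
  apply: measurableT_comp => //; case: (eqVneq i 0) => [->|i0]; last first.
    rewrite (_ : dexpx lam i = cst 0); first exact: measurable_cst.
    by apply/funext => x; rewrite /dexpx (negbTE i0).
  apply: measurable_funM => //; apply: continuous_measurable_rV.
  exact: continuous_expx.
have mh i : measurable_fun setT ((fun x => - ddexpx lam i x) \_ Om).
  by apply: mrestr; apply: measurableT_comp => //; exact: measurable_ddexpx.
have deta_der i x : is_derive x (delta_mx 0 i) (fun x : 'rV[R]_dim => A - expx lam x)
    (- dexpx lam i x).
  apply: is_derive_eq (is_deriveB (is_derive_cst A x (delta_mx 0 i))
    (is_derive_expx lam i x)) _.
  by rewrite sub0r.
have h_der i x : Om x -> is_derive x (delta_mx 0 i)
    (fun y => (gam \_ Om) y * - dexpx lam i y)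
    (((fun x => - ddexpx lam i x) \_ Om) x).
  move=> Ox; rewrite patchT ?inE//.
  have d0 := is_deriveN (is_derive_gam_dexpx lam i Ox).
  apply: near_eq_is_derive d0; near=> y.
  rewrite patchT ?mulrN// inE; near: y.
  exact: open_nbhs_nbhs.
have etaM x : Om x -> 0 <= A - expx lam x <= Me.
  move=> Ox; have /andP[e1 e2] := expx_bd Ox.
  by rewrite subr_ge0 e2/= (le_trans _ Me1)// gerBl expR_ge0.
have detaM i x : Om x -> `|- dexpx lam i x| <= Me.
  by move=> Ox; rewrite normrN (le_trans (dexpx_le lam0 Omr i Ox)).
have hM i x : Om x -> `|((fun x => - ddexpx lam i x) \_ Om) x| <= Me.
  by move=> Ox; rewrite patchT ?inE// normrN (le_trans (ddexpx_le lam0 Omr i Ox)).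
have uceta : unif_cont_on Om (fun x : 'rV[R]_dim => A - expx lam x).
  have cg : {within closure Om, continuous (fun x : 'rV[R]_dim => A - expx lam x)}.
    apply: continuous_subspaceT.
    have ce : continuous (fun x : 'rV[R]_dim => A - expx lam x).
      move=> x; apply: (@continuousB _ _ _ (cst A) (expx lam)).
        exact: cst_continuous.
      exact: continuous_expx.
    exact: ce.
  exact: unif_cont_onS (@subset_closure _ Om) (compact_unif_cont compact_closure cg).
have mdbt : measurable_fun setT (fun t : R => (p - 1) * pos_powR (p - 1 - 1) (t - delta)).
  apply: measurable_funM => //.
  apply: (@measurableT_comp _ _ _ _ _ _ (pos_powR (p - 1 - 1))).
    exact: measurable_pos_powR.
  exact: measurable_funB.
have dbt0 t : 0 <= (p - 1) * pos_powR (p - 1 - 1) (t - delta).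
  by rewrite mulr_ge0 ?(ltW p10)// pos_powR_ge0.
have b0 t : t <= delta -> [/\ p^-1 * pos_powR p (t - delta) = 0,
    pos_powR (p - 1) (t - delta) = 0 & (p - 1) * pos_powR (p - 1 - 1) (t - delta) = 0].
  rewrite -subr_le0 => td.
  by rewrite !pos_powR_le0 ?mulr0// gt_eqF.
have bL s t : s <= Mw -> t <= Mw ->
    `|p^-1 * pos_powR p (s - delta) - p^-1 * pos_powR p (t - delta)| <= Mb * `|s - t| /\
    `|pos_powR (p - 1) (s - delta) - pos_powR (p - 1) (t - delta)| <= Mb * `|s - t|.
  move=> sM tM; split.
    by apply: (lipschitz_of_derive dB) sM tM => x /Mb1[].
  by apply: (lipschitz_of_derive db) sM tM => x /Mb1[].
have := @weak_inequality R dim Om r Omr _ _ _ _ Mw C0 (mrestr mwc) (restr_bd Mw0 wcM)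
  (fOm' wc) ucw vi v2i f0i (fOm' _) (mrestr (coefficient_measurable cgam))
  (restr_bd (ltW C00) gamb) gamp ucgam wg wd _ _ _ Me meta mdeta mh deta_der h_der
  etaM detaM hM uceta _ _ _ delta Mb delta0 dB db mdbt dbt0 b0 Mb1 bL.
have sumh x : \sum_i ((fun x => - ddexpx lam i x) \_ Om) x =
    ((fun x => - ddexpx lam 0 x) \_ Om) x.
  have [Ox|Ox] := pselect (Om x); last first.
    by rewrite [RHS](fOm' _ _ Ox); apply: big1 => i _; exact: fOm'.
  rewrite [RHS]patchT ?inE// -(sum_ddexpx x) -sumrN.
  by apply: eq_bigr => i _; rewrite patchT ?inE.
under [in X in - X <= _ -> _]eq_Rintegral do rewrite sumh.
rewrite (_ : - _ = \int[mu]_(x in Om)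
    (ddexpx lam 0 x * (p^-1 * pos_powR p (wc x - delta)))); last first.
  rewrite -[LHS]mulN1r -RintegralZl//; last first.
    apply: (@integrable_compact_support _ _ _ (Me * Mb) r).
    - apply: measurable_funM; first exact: mh.
      apply: measurable_funM => //.
      apply: (@measurableT_comp _ _ _ _ _ _ (pos_powR p)).
        exact: measurable_pos_powR.
      by apply: measurable_funB => //; exact: mrestr.
    - move=> x; have wx := restr_bd Mw0 wcM x.
      have [b1 _ _] := Mb1 _ (le_trans (ler_norm _) wx).
      rewrite normrM ler_pM//; apply: restr_bd => //; first exact: le_trans (ltW A0) Me1.
      by move=> y Oy; have := hM 0 y Oy; rewrite patchT ?inE.
    - move=> x xr; have Ox : ~ Om x by move=> /Omr.
      by rewrite [X in X * _](fOm' _ _ Ox) mul0r.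
  rewrite [RHS]Rintegral_mkcond; apply: eq_Rintegral => x _.
  have [Ox|Ox] := pselect (Om x); last first.
    by rewrite [RHS](fOm' _ _ Ox) [X in -1 * (X * _)](fOm' _ _ Ox) mul0r mulr0.
  by rewrite [RHS]patchT ?inE// mulN1r !patchT ?inE// mulNr opprK.
rewrite (Rintegral_restrict_mul Om (fun x => - f x)).
move/le_trans; apply; rewrite le_eqVlt; apply/orP; left; apply/eqP.
apply: eq_Rintegral => x.
by rewrite inE => Ox; rewrite patchT ?inE.
Unshelve. all: end_near. Qed.

(* The parameter in Young's inequality for which half of the left-hand side is
   absorbed. *)
Definition energy_const := 2 * p * A / m.
Let K := energy_const.

Lemma level_estimate : in_Lp p Om z /\ Lp_nr p Om z <= K * Lp_nr p Om F.
Proof.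
have [Mw Mw0 [wcM ineq]] := level_inequality.
have m0 : 0 < m by exact: expR_gt0.
have A0 : 0 < A by exact: expR_gt0.
have K0 : 0 < K by rewrite divr_gt0// !mulr_gt0.
have z0 x : 0 <= z x by rewrite le_max lexx orbT.
have mz : measurable_fun Om z.
  by apply: measurable_maxr => //; exact: measurable_funB.
have zM x : Om x -> `|z x| <= Mw * `|cst (1 : R) x|.
  move=> /wcM; rewrite normr1 mulr1 (ger0_norm (z0 x)) /z ler_norml => /andP[_ h].
  by rewrite ge_max Mw0 andbT (le_trans _ h)// gerBl ltW.
have [zp _] := in_Lp_le p2 mOm Mw0 mz (in_Lp_cst p2 mOm fOm 1) zM.
split=> //.
have young x : Om x -> (0 < w x -> - f x <= `|F x|) -> wc x = w x ->
    - f x * ((A - expx lam x) * pos_powR (p - 1) (wc x - delta)) <=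
    (m / (2 * p)) * (`|z x| `^ p) + A * K `^ (p - 1) * (`|F x| `^ p).
  move=> Ox wfx wcx.
  have AK : m / (2 * p) = A * K^-1.
    by rewrite /K /energy_const; field; rewrite !gt_eqF.
  have r0' : 0 <= A * (K^-1 * `|z x| `^ p + K `^ (p - 1) * `|F x| `^ p).
    by rewrite mulr_ge0 ?(ltW A0)// addr_ge0// mulr_ge0 ?powR_ge0// invr_ge0 ltW.
  rewrite AK -!mulrA -mulrDr.
  (* The bound on [- f] is available only where [w > 0]; elsewhere the test function vanishes. *)
  have [wx|wx] := leP (w x) 0.
    rewrite pos_powR_le0 ?gt_eqF// ?mulr0// wcx.
    by rewrite subr_le0 (le_trans wx)// ltW.
  have := young_powR (normr_ge0 (F x)) (normr_ge0 (z x)) K0.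
  move=> /(ler_wpM2l (ltW A0)); apply: le_trans.
  rewrite mulrA mulrCA (ger0_norm (z0 x)) -/(pos_powR (p - 1) (wc x - delta)).
  rewrite mulrCA [leRHS]mulrCA -mulrA.
  have /andP[e1 e2] := expx_bd Ox.
  have e3 : 0 <= A - expx lam x by rewrite subr_ge0.
  apply: (@le_trans _ _ (`|F x| * ((A - expx lam x) * pos_powR (p - 1) (wc x - delta)))).
    by rewrite ler_wpM2r ?wfx// mulr_ge0// pos_powR_ge0.
  rewrite ler_wpM2l// ler_wpM2r ?pos_powR_ge0//.
  by rewrite gerBl expR_ge0.
have mzq q : measurable_fun Om (fun x => pos_powR q (wc x - delta)).
  apply: (@measurableT_comp _ _ _ _ _ _ (pos_powR q)).
    exact: measurable_pos_powR.
  exact: measurable_funB.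
have zq q x : 0 < q -> Om x -> `|pos_powR q (wc x - delta)| <= Mw `^ q.
  move=> q0 Ox; rewrite ger0_norm ?pos_powR_ge0// ge0_ler_powR ?nnegrE ?(ltW q0)//.
  exact: z0.
  by have := zM x Ox; rewrite normr1 mulr1 (ger0_norm (z0 x)).
have I1 : L1 Om (fun x =>
    ddexpx lam 0 x * (p^-1 * pos_powR p (wc x - delta))).
  pose D := lam * A * (C0 + lam * C0).
  have D0 : 0 <= D * (p^-1 * Mw `^ p).
    by rewrite !mulr_ge0 ?addr_ge0 ?mulr_ge0 ?powR_ge0 ?invr_ge0 ?ltW.
  have m1 : measurable_fun Om (fun x =>
      ddexpx lam 0 x * (p^-1 * pos_powR p (wc x - delta))).
    by apply: measurable_funM; [exact: measurable_ddexpx|exact: measurable_funM].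
  have b1 x : Om x -> `|ddexpx lam 0 x * (p^-1 * pos_powR p (wc x - delta))| <=
      D * (p^-1 * Mw `^ p) * `|cst (1 : R) x|.
    move=> Ox; rewrite normr1 mulr1 normrM ler_pM// ?(ddexpx_le lam0 Omr)//.
    rewrite normrM gtr0_norm ?invr_gt0// ler_wpM2l ?invr_ge0 ?(ltW p0)//.
    exact: zq.
  have [h _] := in_Lp_le p2 mOm D0 m1 (in_Lp_cst p2 mOm fOm 1) b1.
  exact (in_Lp_integrable p2 mOm fOm h).
have I2 : L1 Om (fun x =>
    - f x * ((A - expx lam x) * pos_powR (p - 1) (wc x - delta))).
  have D0 : 0 <= A * Mw `^ (p - 1) by rewrite mulr_ge0 ?powR_ge0 ?ltW.
  have m1 : measurable_fun Om (fun x =>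
      - f x * ((A - expx lam x) * pos_powR (p - 1) (wc x - delta))).
    apply: measurable_funM; first exact: measurableT_comp fp.1.
    by apply: measurable_funM => //; apply: measurable_funB => //; exact: measurable_expx.
  have b1 x : Om x ->
      `|- f x * ((A - expx lam x) * pos_powR (p - 1) (wc x - delta))| <=
      A * Mw `^ (p - 1) * `|f x|.
    move=> Ox; rewrite normrM normrN mulrC ler_wpM2r// normrM ler_pM// ?zq//.
    have /andP[e1 e2] := expx_bd Ox.
    by rewrite ger0_norm ?subr_ge0// gerBl expR_ge0.
  have [h _] := in_Lp_le p2 mOm D0 m1 fp b1.
  exact (in_Lp_integrable p2 mOm fOm h).
have I3 (c : R) g : in_Lp p Om g ->
    L1 Om (fun x => c * (`|g x| `^ p)).
  move=> /(in_Lp_integrable_powR p2) gi.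
  exact: integrable_scale.
have I4 := integrableD mOm (I3 (m / (2 * p)) z zp) (I3 (A * K `^ (p - 1)) F Fp).
(* Coercivity: [ddexpx lam 0] is at least [expx lam], hence at least [m]. *)
have le1 : \int[mu]_(x in Om) (m / p * (`|z x| `^ p)) <=
    \int[mu]_(x in Om) (ddexpx lam 0 x * (p^-1 * pos_powR p (wc x - delta))).
  apply: le_Rintegral => //; first exact: I3.
  move=> x Ox; rewrite (ger0_norm (z0 x)) -/(pos_powR p (wc x - delta)) -mulrA.
  rewrite ler_wpM2r//; first by rewrite mulr_ge0 ?pos_powR_ge0// invr_ge0 ltW.
  apply: le_trans (ddexpx_ge Ox); have /andP[e1 _] := expx_bd Ox.
  by apply: le_trans e1 _; rewrite ler_peMl ?expR_ge0// lerDr ltW.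
have le2 : \int[mu]_(x in Om)
      (- f x * ((A - expx lam x) * pos_powR (p - 1) (wc x - delta))) <=
    \int[mu]_(x in Om)
      ((m / (2 * p)) * (`|z x| `^ p) + A * K `^ (p - 1) * (`|F x| `^ p)).
  apply: ae_le_Rintegral => //.
  by apply: filterS2 fF wcw => x h1 h2 Ox; apply: young => //; [exact: h1|exact: h2].
have := le_trans le1 (le_trans ineq le2).
rewrite RintegralD//; [|exact: I3|exact: I3].
rewrite !RintegralZl//; try exact: in_Lp_integrable_powR.
rewrite !(Lp_nr_powR p2)// => main.
have z1 : Lp_nr p Om z `^ p <= (K * Lp_nr p Om F) `^ p.
  rewrite powRM ?(ltW K0) ?Lp_nr_ge0// -(mulr_powRB1 (ltW K0) p0) /=.
  move: main; rewrite -lerBlDl -mulrBl.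
  rewrite (_ : m / p - m / (2 * p) = m / (2 * p)); last by field; rewrite gt_eqF.
  (* After absorption the coefficient on the left is [m / (2 p)]. By the choice of [K], that on the
     right is [A K^(p-1) = (m / (2 p)) K^p], so the common factor cancels. *)
  have AK : A = m / (2 * p) * K by rewrite /K /energy_const; field; rewrite !gt_eqF.
  rewrite [X in _ <= X * _ * _ -> _]AK -!mulrA ler_pM2l//.
  by rewrite ler_pM2l// invr_gt0 mulr_gt0.
rewrite leNgt; apply/negP => lt; move: z1; rewrite leNgt => /negP; apply.
apply: (gt0_ltr_powR p0) => //; rewrite nnegrE ?Lp_nr_ge0//.
by rewrite mulr_ge0 ?Lp_nr_ge0 ?(ltW K0).
Qed.

End level.

(** The constant of [level_estimate] does not involve [delta], and [max(w, 0)] exceeds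
    [max(w - delta, 0)] by at most [delta]; so [delta] can tend to 0. *)
Lemma energy_estimate : exists2 C, 0 < C & forall w f b F,
  weak_sol w f b -> (forall x, bdry Om x -> b x <= 0) -> in_Lp p Om F ->
  {ae mu, forall x, Om x -> 0 < w x -> - f x <= `|F x|} ->
  Lp_nr p Om (fun x => Num.max (w x) 0) <= C * Lp_nr p Om F.
Proof.
have [r r0 Omr] := bounded_sub_cube bOm.
have K0 : 0 < energy_const r by rewrite divr_gt0 ?expR_gt0// !mulr_gt0// expR_gt0.
exists (energy_const r) => // w f b F [v [[wp fp] vp divv [wc [wcc wcw wcb]]]] b0 Fp fF.
have mwp : measurable_fun Om (fun x => Num.max (w x) 0).
  by apply: measurable_maxr => //; exact: wp.1.
have wcb0 x : bdry Om x -> wc x <= 0 by move=> bx; rewrite wcb// b0.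
have est delta : 0 < delta -> Lp_nr p Om (fun x => Num.max (w x) 0) <=
    energy_const r * Lp_nr p Om F + delta * Lp_nr p Om (cst 1).
  move=> delta0.
  have [zp le1] := @level_estimate w f F v wc delta r Omr delta0 wp fp Fp vp divv wcc wcw wcb0 fF.
  have [dp le2] := in_LpZ p2 mOm delta (in_Lp_cst p2 mOm fOm 1).
  have zdp := in_LpD p2 mOm zp dp.
  have h : {ae mu, forall x, Om x -> `|Num.max (w x) 0| <=
      1 * `|Num.max (wc x - delta) 0 + delta * cst 1 x| }.
    apply: filterS wcw => x /[apply] ->; rewrite mul1r mulr1.
    have m0 (t : R) : 0 <= Num.max t 0 by rewrite le_max lexx orbT.
    rewrite !ger0_norm ?addr_ge0 ?(ltW delta0)//.
    rewrite ge_max addr_ge0 ?(ltW delta0)// andbT -lerBlDr.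
    by rewrite le_max lexx.
  have [_ le3] := in_Lp_ae_le p2 mOm ler01 mwp zdp h.
  rewrite mul1r in le3; apply: le_trans le3 _.
  apply: le_trans (Lp_nrD p2 mOm zp dp) _; apply: lerD => //.
  by rewrite (gtr0_norm delta0) in le2.
apply/ler_addgt0Pr => e e0; pose N := Lp_nr p Om (cst 1).
have N0 : 0 <= N by exact: Lp_nr_ge0.
have N1 : 0 < N + 1 by rewrite ltr_wpDl.
have := est (e / (N + 1)) (divr_gt0 e0 N1); move/le_trans; apply.
rewrite lerD2l -/N -mulrA ler_piMr ?(ltW e0)// mulrC ler_pdivrMr// mul1r.
by rewrite lerDl.
Qed.

End energy_estimate.

(** * Linearity and [L^p] limits of weak solutions *)

Section weak_closure.
Local Notation N := (Lp_nr p Om).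

Lemma in_Lp_bounded_mul (a : 'rV[R]_dim -> R) M w : 0 <= M -> measurable_fun Om a ->
  (forall x, Om x -> `|a x| <= M) -> in_Lp p Om w ->
  in_Lp p Om (fun x => a x * w x) /\ N (fun x => a x * w x) <= M * N w.
Proof.
move=> M0 ma aM wp; apply: in_Lp_le => //.
  by apply: measurable_funM => //; exact: wp.1.
by move=> x Ox; rewrite normrM ler_wpM2r// aM.
Qed.

Lemma in_Lp_sum (I : Type) (s : seq I) (F : I -> 'rV[R]_dim -> R) :
  (forall i, in_Lp p Om (F i)) -> in_Lp p Om (fun x => \sum_(i <- s) F i x).
Proof.
move=> Fp; elim: s => [|i s ih].
  rewrite (_ : (fun _ => _) = cst 0); first exact: in_Lp_cst.
  by apply/funext => x; rewrite big_nil.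
rewrite (_ : (fun _ => _) = (fun x => F i x + \sum_(j <- s) F j x)).
  exact: in_LpD.
by apply/funext => x; rewrite big_cons.
Qed.

Lemma weak_sol_lin c w f b w' f' b' : weak_sol w f b -> weak_sol w' f' b' ->
  weak_sol (fun x => w x + c * w' x) (fun x => f x + c * f' x)
    (fun x => b x + c * b' x).
Proof.
move=> [v [[wp fp] vp vd [tw [tc tae tb]]]].
move=> [v' [[wp' fp'] vp' vd' [tw' [tc' tae' tb']]]].
have lin := in_Lp_lin p2 mOm c.
have linI g g' (psi : 'rV[R]_dim -> R) M : measurable_fun setT psi -> (forall x, `|psi x| <= M) ->
    in_Lp p Om g -> in_Lp p Om g' ->
    \int[mu]_(x in Om) ((g x + c * g' x) * psi x) =
    \int[mu]_(x in Om) (g x * psi x) + c * \int[mu]_(x in Om) (g' x * psi x).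
  move=> mpsi psiM gp gp'.
  have int k : in_Lp p Om k -> L1 Om (fun x => k x * psi x).
    move=> kp; suff h : in_Lp p Om (fun x => k x * psi x).
      exact: (in_Lp_integrable p2 mOm fOm h).
    rewrite (_ : (fun _ => _) = (fun x => psi x * k x)); last first.
      by apply/funext => x; rewrite mulrC.
    have M0 : 0 <= M := le_trans (normr_ge0 _) (psiM 0).
    have mps : measurable_fun Om psi by exact: measurable_funTS.
    by have [] := in_Lp_bounded_mul M0 mps (fun x _ => psiM x) kp.
  have i1 := int g gp; have i2 := int g' gp'.
  have i3 : L1 Om (fun x => c * (g' x * psi x)).
    exact: integrable_scale.
  rewrite -RintegralZl// -RintegralD//.
  by apply: eq_Rintegral => x _; ring.
exists (fun i x => v i x + c * v' i x); split.
- by split; exact: lin.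
- move=> i; have [vi hi] := vp i; have [vi' hi'] := vp' i.
  split=> [|psi tpsi]; first exact: lin.
  have [M [mp mdp pM dpM _]] := test_function_facts i tpsi.
  rewrite (linI _ _ _ M)// (linI _ _ _ M)//.
  by rewrite (hi psi tpsi) (hi' psi tpsi); ring.
- move=> psi tpsi.
  have [M0 [mp _ pM _ _]] := test_function_facts 0 tpsi.
  rewrite (linI _ _ _ M0)//.
  have gvd (z : 'I_dim -> 'rV[R]_dim -> R) : (forall i, in_Lp p Om (z i)) ->
      in_Lp p Om (fun x => \sum_i gam x * z i x * partial [:: i] psi x).
    move=> zp; apply: in_Lp_sum => i.
    have [M [_ mdp _ dpM _]] := test_function_facts i tpsi.
    have M1 : 0 <= M := le_trans (normr_ge0 _) (dpM 0).
    have mdp' : measurable_fun Om (partial [:: i] psi) by exact: measurable_funTS.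
    have [h1 _] := in_Lp_bounded_mul M1 mdp' (fun x _ => dpM x) (zp i).
    have [h2 _] := in_Lp_bounded_mul (ltW C00) (coefficient_measurable cgam)
      (fun x Ox => coefficient_partial_le (s := [::]) cgam isT Ox) h1.
    rewrite (_ : (fun _ => _) = (fun x => gam x * (partial [:: i] psi x * z i x)))//.
    by apply/funext => x; ring.
  have i1 := in_Lp_integrable p2 mOm fOm (gvd v (fun i => (vp i).1)).
  have i2 := in_Lp_integrable p2 mOm fOm (gvd v' (fun i => (vp' i).1)).
  have i3 : L1 Om (fun x => c *
      (\sum_i gam x * v' i x * partial [:: i] psi x)).
    exact: integrable_scale.
  transitivity (\int[mu]_(x in Om) (\sum_i gam x * v i x * partial [:: i] psi x +
      c * (\sum_i gam x * v' i x * partial [:: i] psi x))).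
    apply: eq_Rintegral => x _; rewrite mulr_sumr -big_split/=.
    by apply: eq_bigr => i _; ring.
  rewrite RintegralD// RintegralZl// vd// vd'//; ring.
- exists (fun x => tw x + c * tw' x); split.
  + move/subspace_continuousP : tc => tc; move/subspace_continuousP : tc' => tc'.
    apply/subspace_continuousP => x cx; apply: cvgD; first exact: tc.
    by apply: cvgM; [exact: cvg_cst|exact: tc'].
  + by apply: filterS2 tae tae' => x h h' Ox; rewrite h// h'.
  + by move=> x bx; rewrite tb// tb'.
Qed.

Lemma weak_solZ c w f b : weak_sol w f b ->
  weak_sol (fun x => c * w x) (fun x => c * f x) (fun x => c * b x).
Proof.
move=> ws; have := weak_sol_lin (c - 1) ws ws.
have e (g : 'rV[R]_dim -> R) : (fun x => g x + (c - 1) * g x) = (fun x => c * g x).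
  by apply/funext => x; ring.
by rewrite !e.
Qed.

Lemma weak_solB w f b w' f' b' : weak_sol w f b -> weak_sol w' f' b' ->
  weak_sol (fun x => w x - w' x) (fun x => f x - f' x) (fun x => b x - b' x).
Proof.
move=> ws ws'; have := weak_sol_lin (-1) ws ws'.
have e (g g' : 'rV[R]_dim -> R) : (fun x => g x + -1 * g' x) = (fun x => g x - g' x).
  by apply/funext => x; ring.
by rewrite !e.
Qed.

Definition energy_bound C := forall w f b F,
  weak_sol w f b -> (forall x, bdry Om x -> b x <= 0) -> in_Lp p Om F ->
  {ae mu, forall x, Om x -> 0 < w x -> - f x <= `|F x|} ->
  N (fun x => Num.max (w x) 0) <= C * N F.

Variable C : R.
Hypotheses (Cpos : 0 < C) (CE : energy_bound C).

(** Apply the estimate to [w] and to [- w]. One-sided conditions are used because [f] will be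
    [sigma_a w + F]: the term [sigma_a w] is not dominated by [F], but it has the right sign on each
    of the sets [w > 0] and [w < 0]. *)
Lemma energy_two_sided w f b F : weak_sol w f b -> (forall x, bdry Om x -> b x = 0) ->
  in_Lp p Om F -> {ae mu, forall x, Om x -> 0 < w x -> - f x <= `|F x|} ->
  {ae mu, forall x, Om x -> w x < 0 -> f x <= `|F x|} ->
  N w <= 2 * C * N F.
Proof.
move=> ws b0 Fp F1 F2.
have b1 x : bdry Om x -> b x <= 0 by move=> /b0 ->.
have b2 x : bdry Om x -> -1 * b x <= 0 by move=> /b0 ->; rewrite mulr0.
have ws' := weak_solZ (-1) ws.
have h1 := CE ws b1 Fp F1.
have F2' : {ae mu, forall x, Om x -> 0 < -1 * w x -> - (-1 * f x) <= `|F x|}.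
  apply: filterS F2 => x h Ox; rewrite !mulN1r opprK oppr_gt0; exact: h.
have h2 := CE ws' b2 Fp F2'.
have [_ [[wp _] _ _ _]] := ws.
have pos := in_Lp_max0 p2 mOm.
have [np _] := in_LpZ p2 mOm (-1) wp.
have wpm : {ae mu, forall x, Om x -> `|w x| <=
    1 * `|Num.max (w x) 0| + 1 * `|Num.max (-1 * w x) 0| }.
  apply: aeW => x Ox; rewrite !mul1r mulN1r.
  have m0 (t : R) : 0 <= Num.max t 0 by rewrite le_max lexx orbT.
  rewrite (ger0_norm (m0 _)) (ger0_norm (m0 _)) ler_norml.
  have [m1 m2] : w x <= Num.max (w x) 0 /\ - w x <= Num.max (- w x) 0.
    by rewrite !le_max !lexx.
  have := m0 (w x); have := m0 (- w x).
  by move: m1 m2 => *; apply/andP; split; lra.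
have [_] := in_Lp_ae_leD p2 mOm ler01 ler01 wp.1 (pos _ wp) (pos _ np) wpm.
rewrite !mul1r; move: h1 h2; rewrite -mulrA; lra.
Qed.

(* Stability under [L^p] limits, hence under differentiation with respect to a
   parameter, holds by construction. *)
Definition weak_closure w f := [/\ in_Lp p Om w, in_Lp p Om f &
  forall k, 0 < k -> exists w' f' b, [/\ weak_sol w' f' b,
    forall x, bdry Om x -> b x = 0, N (fun x => w x - w' x) <= k &
    N (fun x => f x - f' x) <= k]].

Lemma Lp_nr_ae_eq (f g : 'rV[R]_dim -> R) : measurable_fun Om f -> in_Lp p Om g ->
  {ae mu, forall x, Om x -> f x = g x} ->
  in_Lp p Om f /\ N (fun x => f x - g x) = 0.
Proof.
move=> mf gp fg.
have e1 : {ae mu, forall x, Om x -> `|f x| <= 1 * `|g x| }.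
  by apply: filterS fg => x /[apply] ->; rewrite mul1r.
have [fp _] := in_Lp_ae_le p2 mOm ler01 mf gp e1; split=> //.
have mfg : measurable_fun Om (fun x => f x - g x).
  by apply: measurable_funB => //; exact: gp.1.
have e2 : {ae mu, forall x, Om x -> `|f x - g x| <= 0 * `|g x| }.
  by apply: filterS fg => x /[apply] ->; rewrite subrr normr0 mul0r.
have [_] := in_Lp_ae_le p2 mOm (lexx 0) mfg gp e2; rewrite mul0r => h.
by apply/eqP; rewrite eq_le h/=; exact: Lp_nr_ge0.
Qed.

Lemma weak_closure_ae w f w' f' b : weak_sol w' f' b ->
  (forall x, bdry Om x -> b x = 0) -> measurable_fun Om w -> measurable_fun Om f ->
  {ae mu, forall x, Om x -> w x = w' x} -> {ae mu, forall x, Om x -> f x = f' x} ->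
  weak_closure w f.
Proof.
move=> ws b0 mw mf ww ff; have [_ [[wp fp] _ _ _]] := ws.
have [wp' w0] := Lp_nr_ae_eq mw wp ww; have [fp' f0] := Lp_nr_ae_eq mf fp ff.
split=> // k k0; exists w', f', b; split=> //; rewrite ?w0 ?f0; exact: ltW.
Qed.

Lemma weak_closure_lin c w f w' f' : weak_closure w f -> weak_closure w' f' ->
  weak_closure (fun x => w x + c * w' x) (fun x => f x + c * f' x).
Proof.
move=> [wp fp cl] [wp' fp' cl'].
have lin := in_Lp_lin p2 mOm c.
have linN g g' h h' k : in_Lp p Om g -> in_Lp p Om g' -> in_Lp p Om h -> in_Lp p Om h' ->
    N (fun x => g x - h x) <= k -> N (fun x => g' x - h' x) <= k ->
    N (fun x => (g x + c * g' x) - (h x + c * h' x)) <= (1 + `|c|) * k.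
  move=> gp gp' hp hp' k1 k2.
  have d1 := in_LpB p2 mOm gp hp; have d2 := in_LpB p2 mOm gp' hp'.
  have ae1 : {ae mu, forall x, Om x -> `|(g x + c * g' x) - (h x + c * h' x)| <=
      1 * `|g x - h x| + `|c| * `|g' x - h' x| }.
    apply: aeW => x Ox; rewrite mul1r -normrM.
    by apply: le_trans (ler_normD _ _); rewrite le_eqVlt; apply/orP; left;
      apply/eqP; congr (`|_|); ring.
  have [_] := in_Lp_ae_leD p2 mOm ler01 (normr_ge0 c)
    (in_LpB p2 mOm (lin _ _ gp gp') (lin _ _ hp hp')).1 d1 d2 ae1.
  move/le_trans; apply; rewrite mul1r mulrDl mul1r; apply: lerD => //.
  by rewrite ler_wpM2l.
split; [exact: lin|exact: lin|move=> k k0].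
have c1 : 0 < 1 + `|c| by rewrite ltr_wpDr.
have [w1 [f1 [b1 [ws1 b10 w1k f1k]]]] := cl _ (divr_gt0 k0 c1).
have [w2 [f2 [b2 [ws2 b20 w2k f2k]]]] := cl' _ (divr_gt0 k0 c1).
have [_ [[w1p f1p] _ _ _]] := ws1; have [_ [[w2p f2p] _ _ _]] := ws2.
have kE : k = (1 + `|c|) * (k / (1 + `|c|)) by field; rewrite gt_eqF.
exists (fun x => w1 x + c * w2 x), (fun x => f1 x + c * f2 x), (fun x => b1 x + c * b2 x).
split.
- exact: weak_sol_lin.
- by move=> x bx; rewrite b10// b20// mulr0 addr0.
- by rewrite kE; exact: linN.
- by rewrite kE; exact: linN.
Qed.

Lemma Lp_nr_trans (f g h : 'rV[R]_dim -> R) (k k' : R) : in_Lp p Om f -> in_Lp p Om g -> in_Lp p Om h ->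
  N (fun x => f x - g x) <= k -> N (fun x => g x - h x) <= k' ->
  N (fun x => f x - h x) <= k + k'.
Proof.
move=> fp gp hp fg gh.
have d1 := in_LpB p2 mOm fp gp; have d2 := in_LpB p2 mOm gp hp.
have e : (fun x => f x - h x) = (fun x => (f x - g x) + (g x - h x)).
  by apply/funext => x; ring.
by rewrite e; apply: le_trans (Lp_nrD p2 mOm d1 d2) _; exact: lerD.
Qed.

Lemma weak_closure_closed w f : in_Lp p Om w -> in_Lp p Om f ->
  (forall k, 0 < k -> exists w' f', [/\ weak_closure w' f',
    N (fun x => w x - w' x) <= k & N (fun x => f x - f' x) <= k]) ->
  weak_closure w f.
Proof.
move=> wp fp cl; split=> // k k0; have k2 : 0 < k / 2 by rewrite divr_gt0.
have [w1 [f1 [[w1p f1p cl1] w1k f1k]]] := cl _ k2.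
have [w2 [f2 [b [ws b0 w2k f2k]]]] := cl1 _ k2.
have [_ [[w2p f2p] _ _ _]] := ws.
exists w2, f2, b; split=> //; rewrite (splitr k).
  exact: Lp_nr_trans w1k w2k.
exact: Lp_nr_trans f1k f2k.
Qed.

(** Difference quotients stay in the closure by linearity, and they converge in [L^p]. *)
Lemma weak_closure_derive e (u h : R -> 'rV[R]_dim -> R) t (u' h' : 'rV[R]_dim -> R) :
  0 <= t < e -> (forall s, 0 <= s < e -> weak_closure (u s) (h s)) ->
  Lp_derive p Om e u t u' -> Lp_derive p Om e h t h' -> weak_closure u' h'.
Proof.
move=> te cl du dh; have [_ up' _] := du; have [_ hp' _] := dh.
apply: weak_closure_closed => // k k0.
have [s [se /andP[st0 _] eu eh _]] := Lp_derive_near te du dh dh k0.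
have cl1 := weak_closure_lin (-1) (cl s se) (cl t te).
(* Division by [s - t] in the form [X + ((s - t)^-1 - 1) X], the shape of combination available. *)
have cl2 := weak_closure_lin ((s - t)^-1 - 1) cl1 cl1.
have [_ qu] := in_Lp_quot p2 mOm te se du; have [_ qh] := in_Lp_quot p2 mOm te se dh.
have N1 (g g' : 'rV[R]_dim -> R) : in_Lp p Om (fun x => g' x - g x) ->
    N (fun x => g' x - g x) <= k -> N (fun x => g x - g' x) <= k.
  move=> gp gk; have [_ h1] := Lp_nrN p2 mOm gp; apply: le_trans gk.
  apply: le_trans h1; rewrite le_eqVlt; apply/orP; left; apply/eqP; congr N.
  by apply/funext => x; ring.
exists (fun x => (u s x - u t x) / (s - t)), (fun x => (h s x - h t x) / (s - t)).
split; [|exact: N1|exact: N1].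
have ext (g : R -> 'rV[R]_dim -> R) : (fun x => (g s x - g t x) / (s - t)) =
    (fun x => (g s x + -1 * g t x) + ((s - t)^-1 - 1) * (g s x + -1 * g t x)).
  by apply/funext => x; ring.
by rewrite !ext.
Qed.

(** Here [F] is [f] itself, so no sign condition has to survive the limit. *)
Lemma weak_closure_estimate w f : weak_closure w f -> N w <= 2 * C * N f.
Proof.
move=> [wp fp cl]; rewrite -subr_le0.
apply: (@le0_of_small _ _ (1 + 2 * C)) => k k0 _.
have [w' [f' [b [ws b0 wk fk]]]] := cl k k0.
have [_ [[wp' fp'] _ _ _]] := ws.
have F1 : {ae mu, forall x, Om x -> 0 < w' x -> - f' x <= `|f' x|}.
  by apply: aeW => x _ _; rewrite -normrN ler_norm.
have F2 : {ae mu, forall x, Om x -> w' x < 0 -> f' x <= `|f' x|}.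
  by apply: aeW => x _ _; rewrite ler_norm.
have h1 := energy_two_sided ws b0 fp' F1 F2.
have tri g g' : in_Lp p Om g -> in_Lp p Om g' ->
    N g <= N g' + N (fun x => g x - g' x) /\ N g' <= N g + N (fun x => g x - g' x).
  move=> gp gp'; have dp := in_LpB p2 mOm gp gp'.
  have [ndp ndN] := Lp_nrN p2 mOm dp; split.
    have := Lp_nrD p2 mOm gp' dp; apply: le_trans; rewrite le_eqVlt; apply/orP; left.
    by apply/eqP; congr N; apply/funext => x; ring.
  have := Lp_nrD p2 mOm gp ndp; move/le_trans => /(_ _ (lerD (lexx _) ndN)).
  apply: le_trans; rewrite le_eqVlt; apply/orP; left.
  by apply/eqP; congr N; apply/funext => x; ring.
have [t1 _] := tri _ _ wp wp'; have [_ t2] := tri _ _ fp fp'.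
have C2 : 0 <= 2 * C by rewrite mulr_ge0// ltW.
have := ler_wpM2l C2 (le_trans t2 (lerD (lexx _) fk)); move: h1 t1 wk.
rewrite mulrDr; lra.
Qed.

End weak_closure.

(** * The two branches of solutions *)

Section branches.
Variables (Xi sa : 'rV[R]_dim -> R).
Local Notation N := (Lp_nr p Om).
Local Notation Lp_derive := (Lp_derive p Om).
Local Notation coef := (coefficient Om c0 C0).
Hypotheses (cXi : coef Xi) (csa : coef sa).

Let coef_bd a x : coef a -> Om x -> `|a x| <= C0.
Proof. by move=> ca Ox; exact: (coefficient_partial_le (s := [::]) ca). Qed.

Let coef_gt0 a x : coef a -> Om x -> 0 < a x.
Proof. by move=> ca Ox; have /andP[/(lt_le_trans c00)] := coefficient_bounds ca Ox. Qed.

Let mXiV : measurable_fun Om (fun x => (Xi x)^-1).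
Proof.
apply: within_continuous_measurable_rV => // x Ox.
apply: (@continuous_comp _ _ _ Xi (fun t : R => t^-1)).
  by apply: (coefficient_continuous cXi).
by apply: inv_continuous; rewrite gt_eqF// coef_gt0//; rewrite inE in Ox.
Qed.

Let XiV_bd x : Om x -> `|(Xi x)^-1| <= c0^-1.
Proof.
move=> Ox; have X0 := coef_gt0 cXi Ox; rewrite gtr0_norm ?invr_gt0//.
by rewrite lef_pV2 ?posrE//; have /andP[] := coefficient_bounds cXi Ox.
Qed.

(* [h] is the internal datum divided by [Xi]; [u'], [h'] and [u2], [h2] are
   derivatives in eps. *)
Record branch (sb g : 'rV[R]_dim -> R) (e : R) (u u' h h' : R -> 'rV[R]_dim -> R)
    (u2 h2 : 'rV[R]_dim -> R) : Prop := Branch {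
  branch_gt0 : 0 < e;
  branch_0 : {ae mu, forall x, Om x -> u 0 x = 0};
  branch_sol : forall s, 0 < s < e -> weak_sol (u s) (h s) (fun x => s * g x);
  branch_eq : forall s x, Om x -> h s x = sa x * u s x + sb x * u s x ^+ 2;
  branch_du : forall t, 0 <= t < e -> Lp_derive e u t (u' t);
  branch_dh : forall t, 0 <= t < e -> Lp_derive e h t (h' t);
  branch_ddu : Lp_derive e u' 0 u2;
  branch_ddh : Lp_derive e h' 0 h2 }.

Lemma branch_le sb g e e' u u' h h' u2 h2 : 0 < e' -> e' <= e ->
  branch sb g e u u' h h' u2 h2 -> branch sb g e' u u' h h' u2 h2.
Proof.
move=> e'0 ee [e0 u0 sol eq du dh ddu ddh]; split=> //.
- by move=> s /andP[s0 se]; apply: sol; rewrite s0 (lt_le_trans se).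
- move=> t /andP[t0 te]; apply: (Lp_derive_le ee); apply: du.
  by rewrite t0/= (lt_le_trans te ee).
- move=> t /andP[t0 te]; apply: (Lp_derive_le ee); apply: dh.
  by rewrite t0/= (lt_le_trans te ee).
- exact: (Lp_derive_le ee).
- exact: (Lp_derive_le ee).
Qed.

(** Multiplication by the fixed bounded function [1 / Xi] preserves differentiability, and [Xi] then
    disappears from the data: [h] is the right-hand side of the equation for [u]. *)
Lemma linearized_branch sb g u1 H2 : coef sb ->
  linearized_data p Om Xi gam sa sb g u1 H2 ->
  in_Lp p Om H2 /\ exists e u u' h h' u2,
    branch sb g e u u' h h' u2 (fun x => (Xi x)^-1 * H2 x) /\ u' 0 = u1.
Proof.
move=> csb [e [u [u2 [H1 [e0 u0 sol [u' [uk u'0 ddu]] [H' [Hk H'0 ddH]]]]]]].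
have te : 0 <= (0 : R) < e by rewrite e0 andbT.
have uW s : 0 <= s < e -> in_Wkp p 2 Om (u s) by move=> /uk[].
pose H s := internal_datum Xi sa sb (u s).
have HW s : 0 <= s < e -> in_Wkp p 2 Om (H s) by move=> /Hk[].
have u'W s : 0 <= s < e -> in_Wkp p 2 Om (u' s) by move=> /uk[_ []].
have H'W s : 0 <= s < e -> in_Wkp p 2 Om (H' s) by move=> /Hk[_ []].
have cV : 0 < c0^-1 by rewrite invr_gt0.
have HE s x : Om x -> (Xi x)^-1 * H s x = sa x * u s x + sb x * u s x ^+ 2.
  by move=> Ox; rewrite /H /internal_datum mulKf// gt_eqF// coef_gt0.
split; first by case: ddH => -[].
exists e, u, u', (fun s x => (Xi x)^-1 * H s x), (fun s x => (Xi x)^-1 * H' s x), u2.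
split=> //; split=> //.
- move=> s s0e; have [uWs div tr] := sol s s0e; have /andP[s0 se] := s0e.
  have se' : 0 <= s < e by rewrite se (ltW s0).
  have [Hp _] := HW s se'.
  exists (fun i => weak_partial p Om [:: i] (u s)); split.
  + split; first by case: (uW s se').
    by have [] := in_Lp_bounded_mul (ltW cV) mXiV XiV_bd Hp.
  + move=> i; have [_ ex] := uW s se'.
    (* Membership in [W^{2,p}] provides a weak derivative, so the one selected by [weak_partial] is
       a genuine one and not the default value. *)
    exact: (getPex (ex [:: i] isT)).
  + move=> psi tpsi; rewrite (div psi tpsi); congr (- _).
    by apply: eq_Rintegral => x; rewrite inE => Ox; rewrite HE.
  + by [].
- by move=> t te'; have [_ d] := uk t te'; exact (Lp_derive_of_Wkp p2 mOm uW d te').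
- move=> t te'; apply: (Lp_derive_mul p2 mOm te' mXiV XiV_bd cV).
  by have [_ d] := Hk t te'; exact (Lp_derive_of_Wkp p2 mOm HW d te').
- exact (Lp_derive_of_Wkp p2 mOm u'W ddu te).
- apply: (Lp_derive_mul p2 mOm te mXiV XiV_bd cV).
  exact (Lp_derive_of_Wkp p2 mOm H'W ddH te).
Qed.

Section one_branch.
Variables (sb g : 'rV[R]_dim -> R) (e : R) (u u' h h' : R -> 'rV[R]_dim -> R)
  (u2 h2 : 'rV[R]_dim -> R).
Hypotheses (csb : coef sb) (B : branch sb g e u u' h h' u2 h2).

Let te : 0 <= (0 : R) < e. Proof. by rewrite (branch_gt0 B) andbT. Qed.

(** The quadratic term [sigma_b u^2] is [h - sigma_a u], a combination of families known to be
    differentiable in [L^p]. Differentiability is thus free, and the product rule only has to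
    identify the derivative. *)
Lemma branch_dq t : 0 <= t < e ->
  Lp_derive e (fun s x => h s x + -1 * (sa x * u s x)) t
    (fun x => h' t x + -1 * (sa x * u' t x)).
Proof.
move=> te'; apply: (Lp_derive_lin p2 mOm (-1) te' (branch_dh B te')).
apply: (Lp_derive_mul p2 mOm te' (coefficient_measurable csa) _ C00 (branch_du B te')).
by move=> x; exact: coef_bd.
Qed.

Lemma branch_qE s x : Om x ->
  h s x + -1 * (sa x * u s x) = sb x * (u s x * u s x).
Proof. by move=> Ox; rewrite (branch_eq B s Ox); ring. Qed.

(** Stated at every [t], since it is differentiated once more at 0. *)
Lemma branch_dqE t : 0 <= t < e -> {ae mu, forall x, Om x ->
  h' t x + -1 * (sa x * u' t x) = (2 * sb x) * (u t x * u' t x)}.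
Proof.
move=> te'; have du := branch_du B te'.
have := Lp_derive_prod p2 mOm fOm te' (coefficient_measurable csb) C00
  (fun x Ox => coef_bd csb Ox) du du (branch_dq te')
  (fun s _ => aeW _ (fun x Ox => branch_qE s Ox)).
by apply: filterS => x hx Ox; rewrite hx//; ring.
Qed.

Lemma branch_dq0 : {ae mu, forall x, Om x -> h' 0 x + -1 * (sa x * u' 0 x) = 0}.
Proof.
by apply: filterS2 (branch_0 B) (branch_dqE te) => x h0 h1 Ox; rewrite h1// h0//; ring.
Qed.

(** The second derivative of [sigma_b u^2] is [2 sigma_b (u'^2 + u u'')], and [u] vanishes at 0. *)
Lemma branch_ddqE : {ae mu, forall x, Om x ->
  h2 x + -1 * (sa x * u2 x) = 2 * sb x * u' 0 x ^+ 2}.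
Proof.
have ddq : Lp_derive e (fun s x => h' s x + -1 * (sa x * u' s x)) 0
    (fun x => h2 x + -1 * (sa x * u2 x)).
  apply: (Lp_derive_lin p2 mOm (-1) te (branch_ddh B)).
  apply: (Lp_derive_mul p2 mOm te (coefficient_measurable csa) _ C00 (branch_ddu B)).
  by move=> x; exact: coef_bd.
have ms : measurable_fun Om (fun x => 2 * sb x).
  by apply: measurable_funM => //; exact: coefficient_measurable csb.
have C20 : 0 < 2 * C0 by rewrite mulr_gt0.
have sB x : Om x -> `|2 * sb x| <= 2 * C0.
  by move=> Ox; rewrite normrM ger0_norm// ler_wpM2l// coef_bd.
have := Lp_derive_prod p2 mOm fOm te ms C20 sB (branch_du B te) (branch_ddu B) ddq
  branch_dqE.
apply: filterS2 (branch_0 B) => x h0 h1 Ox; rewrite h1// h0//; ring.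
Qed.

End one_branch.

Variable C : R.
Hypotheses (Cpos : 0 < C) (CE : energy_bound C).

Section two_branches.
Variables (sb sb' g : 'rV[R]_dim -> R) (e : R) (u du h dh : R -> 'rV[R]_dim -> R)
  (u2 h2 : 'rV[R]_dim -> R) (v dv k dk : R -> 'rV[R]_dim -> R) (v2 k2 : 'rV[R]_dim -> R).
Hypotheses (csb : coef sb) (B : branch sb g e u du h dh u2 h2).
Hypotheses (csb' : coef sb') (B' : branch sb' g e v dv k dk v2 k2).

Let te : 0 <= (0 : R) < e. Proof. by rewrite (branch_gt0 B) andbT. Qed.

Lemma branch_sol_diff s : 0 < s < e ->
  weak_sol (fun x => u s x + -1 * v s x) (fun x => h s x + -1 * k s x)
    (fun x => s * g x + -1 * (s * g x)).
Proof.
move=> se; exact: weak_sol_lin (-1) _ _ _ _ _ _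
  (branch_sol B se) (branch_sol B' se).
Qed.

(* [w = u_s - v_s] solves [div (gamma grad w) = sigma_a w + F] with
   [F = sigma_b u_s^2 - sigma_b' v_s^2], which vanishes to first order at 0. *)
Lemma branch_first_derivative_unique : {ae mu, forall x, Om x -> du 0 x = dv 0 x}.
Proof.
have dw := Lp_derive_lin p2 mOm (-1) te (branch_du B te) (branch_du B' te).
have dq := Lp_derive_lin p2 mOm (-1) te (branch_dq B te) (branch_dq B' te).
have C2 : 0 <= 2 * C by rewrite mulr_ge0// ltW.
have w0 : {ae mu, forall x, Om x -> u 0 x + -1 * v 0 x = 0}.
  apply: filterS2 (branch_0 B) (branch_0 B') => x h1 h1' Ox.
  by rewrite h1// h1'// mulr0 addr0.
have q0 : {ae mu, forall x, Om x -> h 0 x + -1 * (sa x * u 0 x) +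
    -1 * (k 0 x + -1 * (sa x * v 0 x)) = 0}.
  apply: filterS2 (branch_0 B) (branch_0 B') => x h1 h1' Ox.
  rewrite (branch_qE B 0 Ox) (branch_qE B' 0 Ox) h1// h1'//; ring.
have le1 := Lp_derive0_le p2 mOm (branch_gt0 B) C2 dw dq w0 q0.
have [_ wp _] := dw; have [qp qp' _] := dq.
have q'0 : N (fun x => dh 0 x + -1 * (sa x * du 0 x) +
    -1 * (dk 0 x + -1 * (sa x * dv 0 x))) = 0.
  have ae0 : {ae mu, forall x, Om x -> dh 0 x + -1 * (sa x * du 0 x) +
      -1 * (dk 0 x + -1 * (sa x * dv 0 x)) = (fun=> 0) x}.
    apply: filterS2 (branch_dq0 csb B) (branch_dq0 csb' B') => x h1 h1' Ox.
    by rewrite h1// h1'// mulr0 addr0.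
  have [_] := Lp_nr_ae_eq qp'.1 (in_Lp_cst p2 mOm fOm 0) ae0.
  by move=> N0; rewrite -[RHS]N0; congr N; apply/funext => x; rewrite subr0.
have N0 : N (fun x => du 0 x + -1 * dv 0 x) = 0.
  apply/eqP; rewrite eq_le Lp_nr_ge0 andbT; rewrite q'0 mulr0 in le1.
  apply: le1 => s se; have /andP[s0 se'] := se.
  have se0 : 0 <= s < e by rewrite (ltW s0).
  have b0 x : bdry Om x -> s * g x + -1 * (s * g x) = 0 by rewrite mulN1r subrr.
  have Fp : in_Lp p Om (fun x => h s x + -1 * (sa x * u s x) +
    -1 * (k s x + -1 * (sa x * v s x))) := qp s se0.
  have ets := energy_two_sided CE (branch_sol_diff se) b0 Fp.
  apply: ets.
  - apply: aeW => x Ox w1; rewrite -normrN; apply: le_trans _ (ler_norm _).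
    have := mulr_ge0 (ltW (coef_gt0 csa Ox)) (ltW w1); rewrite -subr_ge0 => h1.
    rewrite -subr_ge0; apply: le_trans h1 _; rewrite le_eqVlt; apply/orP; left.
    by apply/eqP; ring.
  - apply: aeW => x Ox w1; apply: le_trans _ (ler_norm _).
    have := mulr_ge0_le0 (ltW (coef_gt0 csa Ox)) (ltW w1) => h1.
    by move: h1; rewrite mulrDr; lra.
have := Lp_nr_eq0 p2 mOm wp N0; apply: filterS => x h1 Ox.
by apply/eqP; rewrite -subr_eq0 -mulN1r h1.
Qed.

(** The closure is passed to the derivative twice: at every parameter, then at 0. This requires the
    equation on the whole of [[0, e[], including the endpoint. *)
Lemma branch_second_closure :
  weak_closure (fun x => u2 x + -1 * v2 x) (fun x => h2 x + -1 * k2 x).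
Proof.
have e0 := branch_gt0 B.
have dwt t (t0 : 0 <= t < e) := Lp_derive_lin p2 mOm (-1) t0 (branch_du B t0) (branch_du B' t0).
have dht t (t0 : 0 <= t < e) := Lp_derive_lin p2 mOm (-1) t0 (branch_dh B t0) (branch_dh B' t0).
have ddw := Lp_derive_lin p2 mOm (-1) te (branch_ddu B) (branch_ddu B').
have ddh := Lp_derive_lin p2 mOm (-1) te (branch_ddh B) (branch_ddh B').
have b0 s x : bdry Om x -> s * g x + -1 * (s * g x) = 0 by rewrite mulN1r subrr.
have base s : 0 <= s < e ->
    weak_closure (fun x => u s x + -1 * v s x) (fun x => h s x + -1 * k s x).
  move=> /andP[]; rewrite le_eqVlt => /predU1P[<- _|s0 se]; last first.
    have sol : 0 < s < e by rewrite s0.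
    have ws := branch_sol_diff sol; have [_ [[wp fp] _ _ _]] := ws.
    by apply: (weak_closure_ae ws (b0 s) wp.1 fp.1); apply: aeW.
  (* The equation is given only for positive parameters. At 0 the functions vanish almost
     everywhere, and the zero solution is obtained as 0 times a solution at [e / 2]. *)
  have e2 : 0 < e / 2 < e by rewrite divr_gt0//= ltr_pdivrMr// ltr_pMr// ltr1n.
  have ws := weak_solZ 0 (branch_sol_diff e2).
  have [wp _ _] := dwt _ te; have [hp _ _] := dht _ te.
  apply: (weak_closure_ae ws _ (wp 0 te).1 (hp 0 te).1).
  - by move=> x _; rewrite mul0r.
  - apply: filterS2 (branch_0 B) (branch_0 B') => x h1 h1' Ox.
    by rewrite h1// h1'// mulr0 addr0 mul0r.
  - apply: filterS2 (branch_0 B) (branch_0 B') => x h1 h1' Ox.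
    by rewrite (branch_eq B 0 Ox) (branch_eq B' 0 Ox) h1// h1'//; ring.
apply: (weak_closure_derive te _ ddw ddh) => s se.
exact: (weak_closure_derive se base (dwt s se) (dht s se)).
Qed.

(** Subtracting the two formulas of [branch_ddqE], which share [du 0] by uniqueness, gives [2 (sb -
    sb') (du 0)^2 = (h2 - k2) - sa (u2 - v2)]. The last difference is at most [2 C] times the norm
    of [h2 - k2], whence the constant. *)
Lemma branch_stability : N (fun x => (sb x - sb' x) * du 0 x ^+ 2) <=
    (1 + C0 * (2 * C)) * N (fun x => h2 x + -1 * k2 x) /\
  in_Lp p Om (fun x => (sb x - sb' x) * du 0 x ^+ 2).
Proof.
have cl := branch_second_closure; have [wp hp _] := cl.
have est := weak_closure_estimate Cpos CE cl.
have [_ up _] := branch_du B te.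
have ms : measurable_fun Om (fun x => (sb x - sb' x) * du 0 x ^+ 2).
  apply: measurable_funM.
    by apply: measurable_funB; [exact: coefficient_measurable csb|
      exact: coefficient_measurable csb'].
  by apply: measurable_funX; exact: up.1.
have ae1 : {ae mu, forall x, Om x -> `|(sb x - sb' x) * du 0 x ^+ 2| <=
    1 * `|h2 x + -1 * k2 x| + C0 * `|u2 x + -1 * v2 x| }.
  have d1 := branch_first_derivative_unique.
  have d2 := branch_ddqE csb B; have d3 := branch_ddqE csb' B'.
  apply: filterS2 d1 (filterI d2 d3) => x h1 [h2' h3] Ox.
  have := h2' Ox; have := h3 Ox; rewrite -(h1 Ox) => e3 e2.
  have -> : (sb x - sb' x) * du 0 x ^+ 2 =
      2^-1 * ((h2 x + -1 * k2 x) + - sa x * (u2 x + -1 * v2 x)).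
    rewrite (_ : _ + - sa x * _ = (h2 x + -1 * (sa x * u2 x)) -
      (k2 x + -1 * (sa x * v2 x))); last by ring.
    by rewrite e2 e3; field.
  rewrite normrM ger0_norm// mul1r.
  pose a := `|h2 x + -1 * k2 x|; pose b := C0 * `|u2 x + -1 * v2 x|; rewrite -/a -/b.
  apply: (@le_trans _ _ (2^-1 * (a + b))).
    rewrite ler_wpM2l//; apply: le_trans (ler_normD _ _) _; rewrite lerD2l normrM normrN.
    by rewrite ler_wpM2r// coef_bd.
  rewrite ler_piMl//; last by rewrite invf_le1// ler1n.
  by rewrite /a /b addr_ge0// mulr_ge0// ltW.
have [sp sN] := in_Lp_ae_leD p2 mOm ler01 (ltW C00) ms hp wp ae1.
split=> //; apply: le_trans sN _; rewrite mul1r mulrDl mul1r lerD2l -mulrA.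
by rewrite ler_wpM2l// ltW.
Qed.

End two_branches.

(** * A lower barrier for the first derivative *)

Section barrier.
Variable lam : R.
Hypotheses (lam0 : 0 < lam) (lamP : C0 + 1 <= lam * (lam * c0 - C0)).

Lemma weak_sol_expx : weak_sol (expx lam) (ddexpx lam 0) (expx lam).
Proof.
have [r r0 Omr] := bounded_sub_cube bOm.
pose A := expR (lam * r); pose K := lam * A * (C0 + lam * C0).
have A0 : 0 <= A by exact: expR_ge0.
have l1 : 0 <= lam by exact: ltW.
have K0 : 0 <= K by rewrite !mulr_ge0 ?addr_ge0 ?mulr_ge0 ?(ltW C00).
have EA x : Om x -> `|expx lam x| <= A.
  by move=> Ox; rewrite ger0_norm ?expR_ge0//; have /andP[] := expx_bounds lam0 Omr Ox.
have DA i x : Om x -> `|dexpx lam i x| <= lam * A by exact: dexpx_le.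
have DDA x : Om x -> `|ddexpx lam 0 x| <= K by exact: ddexpx_le.
have mE := measurable_expx lam; have mD := measurable_dexpx lam.
have mDD := measurable_ddexpx lam 0.
have bdp (a : 'rV[R]_dim -> R) (M : R) : measurable_fun Om a -> 0 <= M ->
    (forall x, Om x -> `|a x| <= M) -> in_Lp p Om a.
  move=> ma M0 aM.
  have aM' x : Om x -> `|a x| <= M * `|cst (1 : R) x| by rewrite normr1 mulr1; exact: aM.
  by have [] := in_Lp_le p2 mOm M0 ma (in_Lp_cst p2 mOm fOm 1) aM'.
exists (dexpx lam); split.
- by split; [exact: bdp mE A0 EA|exact: bdp mDD K0 DDA].
- move=> i; split; first exact: bdp (mD i) (mulr_ge0 l1 A0) (DA i).
  move=> psi tpsi; rewrite expr1 mulN1r.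
  apply: (@classical_weak_partial _ _ Om oOm _ _ i r (A + lam * A) Omr) => //.
  + by move=> x Ox; rewrite (le_trans (EA x Ox))// lerDl mulr_ge0.
  + by move=> x Ox; rewrite (le_trans (DA i x Ox))// lerDr.
  + by move=> x _; exact: is_derive_expx.
- move=> psi tpsi.
  transitivity (\int[mu]_(x in Om) ((gam x * dexpx lam 0 x) * partial [:: 0] psi x)).
    apply: eq_Rintegral => x _; rewrite (bigD1 0)//= [X in _ + X]big1 ?addr0// => i i0.
    by rewrite /dexpx (negbTE i0) mulr0 mul0r.
  apply: (@classical_weak_partial _ _ Om oOm _ _ 0 r (C0 * (lam * A) + K) Omr) => //.
  + by apply: measurable_funM => //; exact: coefficient_measurable cgam.
  + move=> x Ox; apply: (@le_trans _ _ (C0 * (lam * A))); last by rewrite lerDl.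
    by rewrite normrM ler_pM ?coef_bd ?DA.
  + move=> x Ox; rewrite (le_trans (DDA x Ox))// lerDr.
    by rewrite !mulr_ge0 ?(ltW C00).
  + by move=> x Ox; exact: is_derive_gam_dexpx.
- exists (expx lam); split=> //; last exact: aeW.
  by apply: continuous_subspaceT; exact: continuous_expx.
Qed.

Variables (sb g : 'rV[R]_dim -> R) (e : R) (u du h dh : R -> 'rV[R]_dim -> R)
  (u2 h2 : 'rV[R]_dim -> R) (kap : R).
Hypotheses (csb : coef sb) (B : branch sb g e u du h dh u2 h2).
Hypotheses (kap0 : 0 < kap) (gkap : forall x, bdry Om x -> kap * expx lam x <= g x).

Let te : 0 <= (0 : R) < e. Proof. by rewrite (branch_gt0 B) andbT. Qed.

(* [s kap exp(lam x_0)] is a subsolution up to the quadratic term, which is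
   negligible compared with [s]. *)
Lemma branch_lower_bound : {ae mu, forall x, Om x -> kap * expx lam x <= du 0 x}.
Proof.
(* The estimate is applied to [s kap exp(lam x_0) - u s] with [F = h - sa u]. Where this function is
   positive, [sa u <= C0 s kap exp(lam x_0)], and this is absorbed by the divergence of the barrier,
   which is at least [(C0 + 1) s kap exp(lam x_0)]. *)
have step s : 0 < s < e -> N (fun x => Num.max (s * kap * expx lam x - u s x) 0) <=
    C * N (fun x => h s x + -1 * (sa x * u s x)).
  move=> se; have /andP[s0 se'] := se; have se0 : 0 <= s < e by rewrite (ltW s0).
  have ws := weak_solB
    (weak_solZ (s * kap) weak_sol_expx) (branch_sol B se).
  have bb x : bdry Om x -> s * kap * expx lam x - s * g x <= 0.
    by move=> bx; rewrite -mulrA -mulrBr pmulr_rle0// subr_le0 gkap.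
  have [qp _ _] := branch_dq B te.
  have Fp : in_Lp p Om (fun x => h s x + -1 * (sa x * u s x)) := qp s se0.
  apply: (CE ws bb Fp); apply: aeW => x Ox; rewrite subr_gt0 => us.
  apply: le_trans _ (ler_norm _); have /= := ddexpx_ge lam0 lamP Ox.
  have sk0 : 0 <= s * kap by rewrite mulr_ge0// ltW.
  move=> /(ler_wpM2l sk0) h1.
  have h3 : sa x * u s x <= C0 * (s * kap * expx lam x).
    have sa0 := coef_gt0 csa Ox; have saC := coef_bd csa Ox.
    rewrite (gtr0_norm sa0) in saC.
    apply: (@le_trans _ _ (sa x * (s * kap * expx lam x))).
      by rewrite ler_wpM2l ?ltW.
    by rewrite ler_wpM2r// mulr_ge0// expR_ge0.
  have h4 : 0 <= s * kap * expx lam x by rewrite mulr_ge0// expR_ge0.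
  have e1 : s * kap * ((C0 + 1) * expx lam x) =
    C0 * (s * kap * expx lam x) + s * kap * expx lam x by ring.
  by rewrite e1 in h1; move: h1 h3 h4; lra.
have [up wp _] := branch_du B te; have [qp qp' _] := branch_dq B te.
have [_ [[Ep _] _ _ _]] := weak_sol_expx.
have mE : measurable_fun Om (expx lam) := Ep.1.
pose dif x := Num.max (kap * expx lam x - du 0 x) 0.
have mdif : measurable_fun Om dif.
  apply: measurable_maxr => //; apply: measurable_funB; last exact: wp.1.
  exact: measurable_funM.
have le1 k : 0 < k -> in_Lp p Om dif /\ N dif <= k * (1 + C).
  move=> k0.
  have [s [se /andP[]]] :=
    Lp_derive_near te (branch_du B te) (branch_dq B te) (branch_dq B te) k0.
  rewrite !subr0 => s0 _ eu eq _.
  have [_ Eup] := in_Lp_quot p2 mOm te se (branch_du B te).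
  have [_ Eqp] := in_Lp_quot p2 mOm te se (branch_dq B te).
  rewrite !subr0 in Eup Eqp.
  have sV0 : 0 <= s^-1 by rewrite invr_ge0 ltW.
  have s0e : 0 < s < e by rewrite s0; case/andP: se.
  have [_ [[zp _] _ _ _]] := weak_solB
    (weak_solZ (s * kap) weak_sol_expx) (branch_sol B s0e).
  have zp' := in_Lp_max0 p2 mOm zp.
  (* Compare [du 0] with the quotient [u s / s]: [dif] is at most the excess handled by [step],
     divided by [s], plus the error of the quotient. *)
  have ae1 : {ae mu, forall x, Om x -> `|dif x| <=
      s^-1 * `|Num.max (s * kap * expx lam x - u s x) 0| +
      1 * `|(u s x - u 0 x) / s - du 0 x| }.
    apply: filterS (branch_0 B) => x h0 Ox; rewrite mul1r h0// subr0.
    have m0 (t : R) : 0 <= Num.max t 0 by rewrite le_max lexx orbT.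
    rewrite (ger0_norm (m0 _)) (ger0_norm (m0 _)) /dif ge_max.
    rewrite addr_ge0 ?mulr_ge0// andbT.
    rewrite (_ : kap * expx lam x - du 0 x = s^-1 * (s * kap * expx lam x - u s x) +
      (u s x / s - du 0 x)); last by field; rewrite gt_eqF.
    by apply: lerD; [rewrite ler_wpM2l// le_max lexx|exact: ler_norm].
  have [dp dN] := in_Lp_ae_leD p2 mOm sV0 ler01 mdif zp' Eup ae1.
  split=> //; apply: le_trans dN _; rewrite mul1r mulrDr mulr1 addrC.
  apply: lerD => //.
  (* The family [h - sa u] vanishes at 0 together with its derivative, so its norm at [s] is at most
     [s k]; after division by [s] the excess is at most [C k]. *)
  have ae2 : {ae mu, forall x, Om x -> `|h s x + -1 * (sa x * u s x)| <=
      s * `|(h s x + -1 * (sa x * u s x) - (h 0 x + -1 * (sa x * u 0 x))) / s -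
        (dh 0 x + -1 * (sa x * du 0 x))| +
      0 * `|(h s x + -1 * (sa x * u s x) - (h 0 x + -1 * (sa x * u 0 x))) / s -
        (dh 0 x + -1 * (sa x * du 0 x))| }.
    apply: filterS2 (branch_0 B) (branch_dq0 csb B) => x h0 h1 Ox.
    rewrite h1// subr0 (branch_qE B 0 Ox) h0// !mulr0 subr0 mul0r addr0.
    by rewrite normrM (ger0_norm sV0) [leRHS]mulrCA mulfV ?mulr1// gt_eqF.
  have [_ qN] := in_Lp_ae_leD p2 mOm (ltW s0) (lexx 0) (qp s se).1 Eqp Eqp ae2.
  rewrite mul0r addr0 in qN.
  have h1 := step s s0e.
  rewrite mulrC ler_pdivrMr//; apply: le_trans h1 _; rewrite mulrC -mulrA [C * s]mulrC mulrA.
  rewrite ler_wpM2r ?(ltW Cpos)//; apply: le_trans qN _.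
  by rewrite mulrC ler_wpM2r// ltW.
have [dp _] := le1 1 ltr01.
have N0 : N dif = 0.
  apply/eqP; rewrite eq_le Lp_nr_ge0 andbT.
  by apply: (@le0_of_small _ _ (1 + C)) => k k0 _; have [] := le1 k k0.
have := Lp_nr_eq0 p2 mOm dp N0; apply: filterS => x h1 Ox.
have : kap * expx lam x - du 0 x <= dif x by rewrite le_max lexx.
by rewrite h1// subr_le0.
Qed.

End barrier.

End branches.

(** * The two stability inequalities for a pair of coefficients *)

Section main.
Variables (Xi sa : 'rV[R]_dim -> R).
Local Notation N := (Lp_nr p Om).
Local Notation coef := (coefficient Om c0 C0).
Hypotheses (cXi : coef Xi) (csa : coef sa).
Variables (lam C : R).
Hypotheses (lam0 : 0 < lam) (lamP : C0 + 1 <= lam * (lam * c0 - C0)).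
Hypotheses (Cpos : 0 < C) (CE : energy_bound C).

(** The first factor is that of [branch_stability]; [c0^-1] bounds [1 / Xi]. *)
Definition stability_const := (1 + C0 * (2 * C)) * c0^-1.

Lemma stability_const_gt0 : 0 < stability_const.
Proof. by rewrite mulr_gt0 ?invr_gt0// addr_gt0// !mulr_gt0. Qed.

Section pair.
Variables (g sb sb' u1 u1' H2 H2' : 'rV[R]_dim -> R).
Hypotheses (csb : coef sb) (csb' : coef sb').
Hypothesis D : linearized_data p Om Xi gam sa sb g u1 H2.
Hypothesis D' : linearized_data p Om Xi gam sa sb' g u1' H2'.

Lemma stability_product :
  [/\ in_Lp p Om (fun x => H2 x - H2' x),
    in_Lp p Om (fun x => (sb x - sb' x) * u1 x ^+ 2) &
    N (fun x => (sb x - sb' x) * u1 x ^+ 2) <=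
      stability_const * N (fun x => H2 x - H2' x)].
Proof.
have [Hp [e [u [du [h [dh [u2 [B <-]]]]]]]] :=
  linearized_branch cXi csb D.
have [Hp' [e' [v [dv [k [dk [v2 [B' _]]]]]]]] :=
  linearized_branch cXi csb' D'.
pose m := Num.min e e'.
have m0 : 0 < m by rewrite lt_min (branch_gt0 B) (branch_gt0 B').
have [me me'] : m <= e /\ m <= e' by split; rewrite ge_min lexx ?orbT.
have Bm := branch_le m0 me B; have Bm' := branch_le m0 me' B'.
have Hd := in_LpB p2 mOm Hp Hp'.
have [st sp] := branch_stability csa Cpos CE csb Bm csb' Bm'.
split=> //; apply: le_trans st _; rewrite /stability_const -mulrA ler_wpM2l//.
  by rewrite addr_ge0// !mulr_ge0// ltW.
have mV : measurable_fun Om (fun x => (Xi x)^-1 * H2 x + -1 * ((Xi x)^-1 * H2' x)).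
  apply: measurable_funD; last apply: measurable_funM => //.
    by have [_ q _] := branch_ddh B; exact: q.1.
  by have [_ q _] := branch_ddh B'; exact: q.1.
have cV : 0 <= c0^-1 by rewrite invr_ge0 ltW.
apply: (in_Lp_le p2 mOm cV mV Hd _).2 => x Ox.
rewrite mulN1r -mulrBr normrM ler_wpM2r//.
have /andP[x0 _] := coefficient_bounds cXi Ox.
have X0 : 0 < Xi x by exact: lt_le_trans c00 x0.
by rewrite gtr0_norm ?invr_gt0// lef_pV2 ?posrE.
Qed.

Lemma stability_pointwise (r g_min : R) : 0 < g_min -> (closure Om `<=` cube 0 r) ->
  (forall x, bdry Om x -> g_min <= g x) ->
  N (fun x => sb x - sb' x) <=
    (g_min * expR (- (2 * lam * r))) ^- 2 *
    N (fun x => (sb x - sb' x) * u1 x ^+ 2) /\ in_Lp p Om (fun x => sb x - sb' x).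
Proof.
move=> gm0 Or gmin.
have [_ [e [u [du [h [dh [u2 [B u1E]]]]]]]] :=
  linearized_branch cXi csb D.
(* With this [kap] the barrier [kap exp(lam x_0)] is at most [g_min] on the boundary, as [x_0 <= r].
   Inside, [x_0 >= - r] bounds it below by [g_min exp(- 2 lam r)]. *)
pose kap := g_min * expR (- (lam * r)).
have kap0 : 0 < kap by rewrite mulr_gt0// expR_gt0.
have xr x : closure Om x -> - r <= x 0 0 <= r.
  by move=> /Or/(_ 0); rewrite mxE sub0r normrN => /ltW; rewrite ler_norml.
have gkap x : bdry Om x -> kap * expx lam x <= g x.
  move=> bx; apply: le_trans (gmin x bx); rewrite /kap -mulrA -expRD.
  rewrite ler_piMr ?(ltW gm0)// -[leRHS]expR0 ler_expR addrC subr_le0 ler_pM2l//.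
  by have /andP[] := xr x bx.1.
have lower := branch_lower_bound csa Cpos CE lam0 lamP csb B kap0 gkap.
pose m0 := g_min * expR (- (2 * lam * r)); rewrite -/m0.
have m00 : 0 < m0 by rewrite mulr_gt0// expR_gt0.
have [_ sp _] := stability_product.
have ms : measurable_fun Om (fun x => sb x - sb' x).
  by apply: measurable_funB; [exact: coefficient_measurable csb|
    exact: coefficient_measurable csb'].
have mV : 0 <= m0 ^- 2 by rewrite invr_ge0 exprn_ge0// ltW.
have ae1 : {ae @lebesgue_rV R dim, forall x, Om x ->
    `|sb x - sb' x| <= m0 ^- 2 * `|(sb x - sb' x) * u1 x ^+ 2| }.
  apply: filterS lower => x h1 Ox; have {h1} := h1 Ox; rewrite u1E => h1.
  have h2 : m0 <= u1 x.
    apply: le_trans h1; rewrite /m0 /kap -[leRHS]mulrA ler_wpM2l ?(ltW gm0)// -expRD ler_expR.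
    have /andP[h3 _] := xr x (subset_closure Ox).
    have h4 : lam * - r <= lam * x 0 0 by rewrite ler_wpM2l ?(ltW lam0).
    by move: h4; lra.
  have h3 : m0 ^+ 2 <= u1 x ^+ 2 by rewrite ler_sqr ?nnegrE ?(le_trans (ltW m00) h2)// ltW.
  rewrite mulrC normrM (ger0_norm (sqr_ge0 _)) ler_pdivlMr ?exprn_gt0//.
  by rewrite ler_wpM2l.
by have [] := in_Lp_ae_le p2 mOm mV ms sp ae1.
Qed.

End pair.
End main.

End elliptic.

Theorem theorem3p2 (R : realType) (d : nat) (Om : set 'rV[R]_d) (p c0 C0 : R)
    (Xi gamma sigma_a : 'rV[R]_d -> R) :
  (2 <= d)%N ->
  smooth_convex_domain Om ->
  d%:R < p ->
  0 < c0 ->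
  coefficient Om c0 C0 Xi ->
  coefficient Om c0 C0 gamma ->
  coefficient Om c0 C0 sigma_a ->
  (exists2 C : R, 0 < C &
    forall g sigma_b sigma_b' u1 u1' H2 H2' : 'rV[R]_d -> R,
      in_Wsp_bdry p 1 (1 - p^-1) Om g ->
      coefficient Om c0 C0 sigma_b ->
      coefficient Om c0 C0 sigma_b' ->
      linearized_data p Om Xi gamma sigma_a sigma_b g u1 H2 ->
      linearized_data p Om Xi gamma sigma_a sigma_b' g u1' H2' ->
      (Lp_norm p Om (fun x => (sigma_b x - sigma_b' x) * u1 x ^+ 2)%R
       <= C%:E * Wkp_norm p 2 Om (fun x => H2 x - H2' x)%R)%E) /\
  (forall g_min : R, 0 < g_min ->
    exists2 C : R, 0 < C &
    forall g sigma_b sigma_b' u1 u1' H2 H2' : 'rV[R]_d -> R,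
      in_Wsp_bdry p 1 (1 - p^-1) Om g ->
      inf (g @` bdry Om) = g_min ->
      coefficient Om c0 C0 sigma_b ->
      coefficient Om c0 C0 sigma_b' ->
      linearized_data p Om Xi gamma sigma_a sigma_b g u1 H2 ->
      linearized_data p Om Xi gamma sigma_a sigma_b' g u1' H2' ->
      (Lp_norm p Om (fun x => sigma_b x - sigma_b' x)%R
       <= C%:E * Wkp_norm p 2 Om (fun x => H2 x - H2' x)%R)%E).
Proof.
case: d => [//|n] in Om Xi gamma sigma_a *.
move=> d2 [oOm Om0 bOm _ _] dp c00 cXi cgam csa.
have p2 : 2 < p by apply: le_lt_trans dp; rewrite ler_nat.
have C00 := C0_gt0 Om0 c00 cgam.
have [lam lam0 lamP] : exists2 lam, 0 < lam & C0 + 1 <= lam * (lam * c0 - C0).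
  (* The second entry gives [lam c0 - C0 >= C0 + 1]; the first makes the outer factor [lam] at least
     1. *)
  pose lam := Num.max 1 ((2 * C0 + 1) / c0).
  have lam1 : 1 <= lam by rewrite le_max lexx.
  exists lam; first exact: lt_le_trans lam1.
  have h1 : 2 * C0 + 1 <= lam * c0 by rewrite -ler_pdivrMr// le_max lexx orbT.
  have h2 : C0 + 1 <= lam * c0 - C0 by move: h1; lra.
  apply: le_trans h2 _; rewrite ler_peMl//; move: h1 C00; lra.
have [C Cpos CE] := energy_estimate p2 oOm Om0 bOm c00 cgam lam0 lamP.
have WE (f w : 'rV[R]_n.+1 -> R) K : 0 <= K -> in_Lp p Om f -> in_Lp p Om w ->
    Lp_nr p Om f <= K * Lp_nr p Om w -> (Lp_norm p Om f <= K%:E * Wkp_norm p 2 Om w)%E.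
  move=> K0 fp wp fw; rewrite -(Lp_nrE fp).
  apply: (@le_trans _ _ (K%:E * Lp_norm p Om w)%E).
    by rewrite -(Lp_nrE wp) -EFinM lee_fin.
  by rewrite lee_wpmul2l ?lee_fin//; exact: Lp_norm_le_Wkp.
have S0 := stability_const_gt0 Om0 c00 cgam Cpos.
split.
  exists (stability_const c0 C0 C) => // g sb sb' u1 u1' H2 H2' _ csb csb' D D'.
  have [Hp sp st] := stability_product p2 oOm Om0 bOm c00 cgam cXi csa Cpos CE csb csb' D D'.
  exact: WE (ltW S0) sp Hp st.
move=> g_min gm0.
(* The radius must be valid on the closure, because the barrier is compared with [g] at boundary
   points. *)
have bcl : bounded_set (closure Om) by exact: compact_bounded (compact_closure bOm).
have [r r0 Or] := bounded_sub_cube bcl.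
pose K := (g_min * expR (- (2 * lam * r))) ^- 2.
have K0 : 0 < K by rewrite invr_gt0 exprn_gt0// mulr_gt0// expR_gt0.
exists (K * stability_const c0 C0 C); first exact: mulr_gt0.
move=> g sb sb' u1 u1' H2 H2' _ infg csb csb' D D'.
have gmin x : bdry Om x -> g_min <= g x.
  move=> bx; rewrite -infg; apply: ge_inf; last by exists x.
  (* If [g] were unbounded below on the boundary, [inf] would take its default value 0,
     contradicting [g_min > 0]. *)
  apply: contrapT => nlb; have : inf (g @` bdry Om) = 0.
    by apply: inf_out => -[].
  by rewrite infg => h; rewrite h ltxx in gm0.
have [Hp sp st] := stability_product p2 oOm Om0 bOm c00 cgam cXi csa Cpos CE csb csb' D D'.
have [pt pp] := stability_pointwise p2 oOm Om0 bOm c00 cgam cXi csa lam0 lamP Cpos CE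
  csb csb' D D' gm0 Or gmin.
apply: WE pp Hp _; first by rewrite mulr_ge0// ltW.
by apply: le_trans pt _; rewrite -[leRHS]mulrA ler_wpM2l ?(ltW K0).
Qed.
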